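(* Let $f_0$ be the partially expanding map described in the context, let $m$ be a positive integer, and for $\nu\in\mathbb Z$ consider the operator $M_\nu^*(0):H^m(\mathbb S^1)\to H^m(\mathbb S^1)$, $$M_\nu^*(0)\varphi(x)=\sum_{E_0(y)=x}\frac{e^{-i\nu\tau_0(y)}}{E_0'(y)}\varphi(y).$$ For $\nu=0$, the only eigenvalue of $M_0^*(0)$ on the unit circle is the simple eigenvalue $1$. In particular, the Lyapunov subspace of $M_0^*(0)$ associated to the eigenvalues of modulus $1$ (the direct sum of the corresponding generalized eigenspaces) is one dimensional. Moreover, if $f_0$ is partially captive then the spectral radius of $M_\nu^*(0):H^m(\mathbb S^1)\to H^m(\mathbb S^1)$ is strictly less than $1$ for all $\nu\ne0$.
   Context: $\mathbb S^1=\mathbb R/\mathbb Z$. Let $k\ge2$ be an integer, $g_0:\mathbb S^1\to\mathbb S^1$ an orientation-preserving $C^\infty$ diffeomorphism, $\tau_0:\mathbb S^1\to\mathbb R$ of class $C^\infty$, $E_0(x)=kg_0(x)\bmod 1$, and $f_0(x,s)=(E_0(x),\,s+\frac1{2\pi}\tau_0(x)\bmod 1)$ on $\mathbb T^2=\mathbb S^1\times\mathbb S^1$. Assume $\lambda_0:=\min_xE_0'(x)>1$ and put $\lambda=(\lambda_0+1)/2$. $H^m(\mathbb S^1)$ is the usual Sobolev space. Partial captivity of $f_0$. Fix $\kappa\in(1,\lambda)$ (e.g. $\kappa=(\lambda+1)/2$), $C_\tau=\max_x|\tau_0'(x)|+1$, $R_\kappa\ge C_\tau/(\lambda-\kappa)$,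 and $\mathcal Z=\mathbb S^1\times[-R_\kappa,R_\kappa]\subset T^*\mathbb S^1$. For $0\le j\le k-1$ and $(y,\eta)\in T^*\mathbb S^1=\mathbb S^1\times\mathbb R$ (with $y$ represented in $[0,1)$) let $F_j(y,\eta)=(x_j,\,E_0'(x_j)\eta+\tau_0'(x_j))$, $x_j=g_0^{-1}((y+j)/k)$. Let $\mathcal N(0;n)=\max_{(y,\eta)\in\mathcal Z}\#\{\alpha\in\{0,\dots,k-1\}^n:\ F_{\alpha_n}\circ\cdots\circ F_{\alpha_1}(y,\eta)\in\mathcal Z\}$. $f_0$ is partially captive if $\lim_{n\to\infty}\frac1n\log\mathcal N(0;n)=0$ (this does not depend on the choice of $\mathcal Z$). *)

(* Defs.v *)
From Stdlib Require Import Reals ZArith List Lia Lra.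
From Coquelicot Require Import Coquelicot.
Open Scope R_scope.

(* The circle is R/Z.  Functions on it are 1-periodic functions on R, and an
   orientation-preserving diffeomorphism is given by a lift to R. *)

Definition smooth (f : R -> R) : Prop := forall n x, ex_derive_n f n x.

Definition periodic {T : Type} (f : R -> T) : Prop := forall x, f (x + 1) = f x.

Definition is_maximum (f : R -> R) (c : R) : Prop :=
  (exists x, f x = c) /\ (forall x, f x <= c).

Definition is_minimum (f : R -> R) (c : R) : Prop :=
  (exists x, f x = c) /\ (forall x, c <= f x).

Record circle_diffeo : Type := CircleDiffeo {
  lift :> R -> R;
  lift_inv : R -> R;
  lift_invK : forall x, lift_inv (lift x) = x;
  lift_K : forall x, lift (lift_inv x) = x;
  lift_smooth : smooth lift;
  lift_inv_smooth : smooth lift_inv;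
  lift_shift : forall x, lift (x + 1) = lift x + 1;
  lift_incr : forall x y, x < y -> lift x < lift y
}.

(* The lift to R of E_0 = k g_0 mod 1. *)
Definition expand (k : nat) (g : circle_diffeo) (x : R) : R := INR k * g x.

(* x_j = g_0^{-1}((y + j)/k); by [branch_preimage] and [branch_inj] below,
   these are, for 0 <= j < k, the distinct E_0-preimages of y mod 1. *)
Definition branch (k : nat) (g : circle_diffeo) (j : nat) (y : R) : R :=
  lift_inv g ((y + INR j) / INR k).

Lemma lift_inv_shift (g : circle_diffeo) (n : Z) (x : R) :
  lift_inv g (x + IZR n) = lift_inv g x + IZR n.
Proof.
assert (S1 : forall x, lift_inv g (x + 1) = lift_inv g x + 1).
{ intros t. rewrite <- (lift_invK g (lift_inv g t + 1)), lift_shift, lift_K.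
  reflexivity. }
assert (Sn : forall p x, lift_inv g (x + INR p) = lift_inv g x + INR p).
{ intros p; induction p as [|p IH]; intros t.
  - simpl; rewrite !Rplus_0_r; reflexivity.
  - rewrite !S_INR, <- !Rplus_assoc, S1, IH; reflexivity. }
destruct (Z_le_gt_dec 0 n) as [h|h].
- rewrite <- (Z2Nat.id n h), <- INR_IZR_INZ; apply Sn.
- pose proof (Sn (Z.to_nat (- n)) (x + IZR n)) as H.
  rewrite INR_IZR_INZ, Z2Nat.id, opp_IZR in H by lia.
  replace (x + IZR n + - IZR n) with x in H by ring. lra.
Qed.

Lemma branch_preimage (k : nat) (g : circle_diffeo) (x y : R) : (0 < k)%nat ->
  (exists n : Z, expand k g y = x + IZR n) <->
  (exists (j : nat) (p : Z), (j < k)%nat /\ y = branch k g j x + IZR p).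
Proof.
intros k0.
assert (K : 0 < INR k) by now apply lt_0_INR.
unfold expand, branch; split.
- intros [n H].
  exists (Z.to_nat (n mod Z.of_nat k)), (n / Z.of_nat k)%Z.
  pose proof (Z.mod_pos_bound n (Z.of_nat k) ltac:(lia)) as B.
  split; [lia|].
  rewrite <- lift_inv_shift, <- (lift_invK g y); f_equal.
  rewrite INR_IZR_INZ, Z2Nat.id by lia.
  apply (Rmult_eq_reg_l (INR k)); [|lra].
  rewrite H, (Z.div_mod n (Z.of_nat k)) at 1 by lia.
  rewrite plus_IZR, mult_IZR, <- INR_IZR_INZ. field; lra.
- intros (j & p & _ & ->).
  exists (Z.of_nat j + Z.of_nat k * p)%Z.
  rewrite <- lift_inv_shift, lift_K, plus_IZR, mult_IZR, <- !INR_IZR_INZ.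
  field; lra.
Qed.

Lemma branch_inj (k : nat) (g : circle_diffeo) (x : R) (i j : nat) (p : Z) :
  (i < k)%nat -> (j < k)%nat ->
  branch k g i x = branch k g j x + IZR p -> i = j.
Proof.
intros hi hj H.
assert (K : 0 < INR k) by (apply lt_0_INR; lia).
unfold branch in H; rewrite <- lift_inv_shift in H.
apply (f_equal g) in H; rewrite !lift_K in H.
assert (H' : INR i = INR j + INR k * IZR p).
{ replace (INR i) with (INR k * ((x + INR i) / INR k) - x) by (field; lra).
  rewrite H; field; lra. }
rewrite !INR_IZR_INZ, <- mult_IZR, <- plus_IZR in H'; apply eq_IZR in H'.
assert (p = 0)%Z by nia.
subst p; lia.
Qed.

(* The maps F_j on T^*S^1; the base point y is first represented in [0,1). *)
Definition cotangent_branch (k : nat) (g : circle_diffeo) (tau : R -> R)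
    (j : nat) (p : R * R) : R * R :=
  let x := branch k g j (frac_part (fst p)) in
  (x, Derive (expand k g) x * snd p + Derive tau x).

Fixpoint words (k n : nat) : list (list nat) :=
  match n with
  | O => nil :: nil
  | S n' => flat_map (fun w => map (fun j => j :: w) (seq 0 k)) (words k n')
  end.

(* The head of the word acts first. *)
Definition follow (k : nat) (g : circle_diffeo) (tau : R -> R)
    (w : list nat) (p : R * R) : R * R :=
  fold_left (fun q j => cotangent_branch k g tau j q) w p.

Definition staying_count (k : nat) (g : circle_diffeo) (tau : R -> R) (Rk : R)
    (n : nat) (p : R * R) : nat :=
  length (filter
    (fun w => if Rle_dec (Rabs (snd (follow k g tau w p))) Rk
              then true else false)
    (words k n)).

Definition is_captivity_number (k : nat) (g : circle_diffeo) (tau : R -> R)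
    (Rk : R) (n N : nat) : Prop :=
  (exists p, 0 <= fst p < 1 /\ Rabs (snd p) <= Rk /\
             staying_count k g tau Rk n p = N) /\
  (forall p, 0 <= fst p < 1 -> Rabs (snd p) <= Rk ->
             (staying_count k g tau Rk n p <= N)%nat).

(* For Rk >= max|tau'| / (min E_0' - 1) one has N n >= 1 for all n, so the
   junk value of [ln] at 0 plays no role. *)
Definition partially_captive (k : nat) (g : circle_diffeo) (tau : R -> R)
    (Rk : R) : Prop :=
  exists N : nat -> nat,
    (forall n, is_captivity_number k g tau Rk n (N n)) /\
    is_lim_seq (fun n => / INR n * ln (INR (N n))) 0.

Definition cis (t : R) : C := (cos t, sin t).

Definition fourier (phi : R -> C) (n : Z) : C :=
  RInt (V := C_R_CompleteNormedModule)
    (fun x => Cmult (cis (- (2 * PI * IZR n * x))) (phi x)) 0 1.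

Definition sobolev_term (m : nat) (phi : R -> C) (n : Z) : R :=
  (1 + IZR n ^ 2) ^ m * Cmod (fourier phi n) ^ 2.

(* H^m(S^1) for m >= 1: square-summability of (1+n^2)^(m/2) phi^(n).  By the
   Sobolev embedding H^1(S^1) in C(S^1), each a.e. class in H^m(S^1) has exactly
   one continuous representative, which is the one used here; this makes
   equality in H^m pointwise equality. *)
Definition sobolev (m : nat) (phi : R -> C) : Prop :=
  periodic phi /\
  (forall x, continuous phi x) /\
  ex_series (fun n : nat => sobolev_term m phi (Z.of_nat n)) /\
  ex_series (fun n : nat => sobolev_term m phi (- Z.of_nat (S n))).

Definition sobolev_norm (m : nat) (phi : R -> C) : R :=
  sqrt (Series (fun n : nat => sobolev_term m phi (Z.of_nat n)) +
        Series (fun n : nat => sobolev_term m phi (- Z.of_nat (S n)))).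

Definition bounded_operator (m : nat) (T : (R -> C) -> R -> C) : Prop :=
  (forall phi, sobolev m phi -> sobolev m (T phi)) /\
  (forall phi psi, sobolev m phi -> sobolev m psi ->
     forall x, T (fun y => Cplus (phi y) (psi y)) x = Cplus (T phi x) (T psi x)) /\
  (forall (a : C) phi, sobolev m phi ->
     forall x, T (fun y => Cmult a (phi y)) x = Cmult a (T phi x)) /\
  (exists K : R, forall phi, sobolev m phi ->
     sobolev_norm m (T phi) <= K * sobolev_norm m phi).

Definition op_minus (T : (R -> C) -> R -> C) (z : C) (phi : R -> C) : R -> C :=
  fun x => Cminus (T phi x) (Cmult z (phi x)).

Definition resolvent_point (m : nat) (T : (R -> C) -> R -> C) (z : C) : Prop :=
  exists S : (R -> C) -> R -> C,
    bounded_operator m S /\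
    (forall phi, sobolev m phi -> forall x, S (op_minus T z phi) x = phi x) /\
    (forall phi, sobolev m phi -> forall x, op_minus T z (S phi) x = phi x).

Definition spectral_radius (m : nat) (T : (R -> C) -> R -> C) : Rbar :=
  Lub_Rbar (fun r => exists z : C, ~ resolvent_point m T z /\ r = Cmod z).

Definition eigenvalue (m : nat) (T : (R -> C) -> R -> C) (z : C) : Prop :=
  exists phi, sobolev m phi /\ (exists x, phi x <> RtoC 0) /\
              (forall x, T phi x = Cmult z (phi x)).

Definition gen_eigenspace (m : nat) (T : (R -> C) -> R -> C) (z : C)
    (phi : R -> C) : Prop :=
  sobolev m phi /\
  exists p : nat, forall x, Nat.iter p (op_minus T z) phi x = RtoC 0.

(* The sum of the generalized eigenspaces of the eigenvalues of modulus r. *)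
Definition lyapunov_subspace (m : nat) (T : (R -> C) -> R -> C) (r : R)
    (phi : R -> C) : Prop :=
  exists l : list (C * (R -> C)),
    (forall z psi, In (z, psi) l ->
       Cmod z = r /\ eigenvalue m T z /\ gen_eigenspace m T z psi) /\
    (forall x, phi x = fold_right (fun q s => Cplus (snd q x) s) (RtoC 0) l).

Definition one_dimensional (V : (R -> C) -> Prop) : Prop :=
  exists phi0, V phi0 /\ (exists x, phi0 x <> RtoC 0) /\
    forall phi, V phi <-> exists c : C, forall x, phi x = Cmult c (phi0 x).

Definition simple_eigenvalue (m : nat) (T : (R -> C) -> R -> C) (z : C) : Prop :=
  eigenvalue m T z /\ one_dimensional (gen_eigenspace m T z).

(* M_nu^*(0); [sum_n a (k - 1)] is a 0 + ... + a (k - 1). *)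
Definition transfer (k : nat) (g : circle_diffeo) (tau : R -> R) (nu : Z)
    (phi : R -> C) (x : R) : C :=
  sum_n (fun j : nat =>
    let y := branch k g j x in
    Cmult (Cdiv (cis (- (IZR nu * tau y))) (RtoC (Derive (expand k g) y)))
          (phi y)) (k - 1).

(* Main.v *)
Require Import Defs.
From Stdlib Require Import Reals ZArith List Lia Lra FunctionalExtensionality.
From Coquelicot Require Import Coquelicot.
Open Scope R_scope.

(** The operators [M_nu] average over the [k] inverse branches of the expanding
    map with the weights [1 / E'], twisted by phases [exp (- i nu tau)]. Three
    mechanisms drive the proof.

    Smoothing. Every derivative of a branch sum gains a factor [1 / E'], and the
    untwisted operator preserves a positive density [h]. Measured in [L^2] with
    the weight [1 / h], each derivative of [M_nu f] is therefore bounded by a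
    contraction of the same derivative of [f] plus lower derivatives
    ([wnorm_weighted_op_step]). Hence Sobolev norms stay bounded under iteration,
    and any exponential decay of the uniform norm passes to all Sobolev norms
    ([energy_growth]). These estimates are made for smooth functions and carried
    to [H^m] by [sobolev_extension]: Fourier series of [H^m] functions converge
    uniformly, and the Sobolev norm is lower semicontinuous.

    Mixing, for [nu = 0]. A coupling argument in a cone of densities with Hoelder
    logarithm ([ruelle_perron_frobenius]) yields [h] together with the
    convergence of the iterates of [f] to [h] times the integral of [f]. The
    iterates of the constant 1 are bounded in [H^m], so [h] lies in [H^m]. As
    integrals are preserved, an eigenvector for an eigenvalue of modulus 1 other
    than 1 would have integral zero and iterates tending to zero, which is
    absurd; and [h] spans the generalized eigenspace of 1.

    Cancellation, for [nu <> 0]. The derivatives of the Birkhoff sums of [tau]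
    along backward orbits, called slopes, govern the fibre dynamics of the maps
    [F_j]: a covector remains bounded along a word exactly when it is close to
    minus the slope of the word. If the slopes of all long words at a point nearly
    agreed, one covector would be kept in the box by all [k^n] words of a given
    length [n], for every [n], against partial captivity. So two words of any
    large length have slopes that differ by a fixed amount ([slope_gap]); the
    corresponding terms of the iterated operator turn at different speeds and
    cannot be aligned at both ends of a fixed interval ([two_point_loss]). The loss spreads by density of
    preimages and gives exponential decay in the uniform norm ([twisted_decay]).
    With the smoothing mechanism the iterates decay exponentially in [H^m], and
    the Neumann series provides the resolvent outside a disc of radius less
    than 1 ([spectral_radius_lt_1]). *)

(** * Finite sums *)

Fixpoint rsum (f : nat -> R) (n : nat) : R :=
  match n with O => 0 | S n' => rsum f n' + f n' end.

Fixpoint csum (f : nat -> C) (n : nat) : C :=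
  match n with O => RtoC 0 | S n' => Cplus (csum f n') (f n') end.

Lemma rsum_ext f g n : (forall i, (i < n)%nat -> f i = g i) -> rsum f n = rsum g n.
Proof.
induction n as [|n IH]; intros H; simpl; [reflexivity|].
rewrite IH, H by (auto with arith || (intros; apply H; lia)); reflexivity.
Qed.

Lemma rsum_le f g n : (forall i, (i < n)%nat -> f i <= g i) -> rsum f n <= rsum g n.
Proof.
induction n as [|n IH]; intros H; simpl; [lra|].
assert (f n <= g n) by (apply H; lia).
assert (rsum f n <= rsum g n) by (apply IH; intros; apply H; lia). lra.
Qed.

Lemma rsum_ge0 f n : (forall i, (i < n)%nat -> 0 <= f i) -> 0 <= rsum f n.
Proof.
induction n as [|n IH]; intros H; simpl; [lra|].
assert (0 <= f n) by (apply H; lia).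
assert (0 <= rsum f n) by (apply IH; intros; apply H; lia). lra.
Qed.

Lemma rsum_plus f g n : rsum (fun i => f i + g i) n = rsum f n + rsum g n.
Proof. induction n as [|n IH]; simpl; [ring|rewrite IH; ring]. Qed.

Lemma rsum_scal a f n : rsum (fun i => a * f i) n = a * rsum f n.
Proof. induction n as [|n IH]; simpl; [ring|rewrite IH; ring]. Qed.

Lemma rsum_const a n : rsum (fun _ => a) n = INR n * a.
Proof. induction n as [|n IH]; [simpl; ring|rewrite S_INR; cbn [rsum]; rewrite IH; ring]. Qed.

Lemma rsum_term_le f n i :
  (forall j, (j < n)%nat -> 0 <= f j) -> (i < n)%nat -> f i <= rsum f n.
Proof.
induction n as [|n IH]; intros H hi; simpl; [lia|].
assert (0 <= f n) by (apply H; lia).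
assert (0 <= rsum f n) by (apply rsum_ge0; intros; apply H; lia).
destruct (Nat.eq_dec i n) as [->|ne]; [lra|].
assert (f i <= rsum f n) by (apply IH; [intros; apply H|]; lia). lra.
Qed.

Lemma rsum_mono f n p :
  (forall j, 0 <= f j) -> (n <= p)%nat -> rsum f n <= rsum f p.
Proof.
intros H h; induction h as [|p h IH]; simpl; [lra|]. specialize (H p); lra.
Qed.

Lemma rsum_shift f n : rsum f (S n) = f O + rsum (fun i => f (S i)) n.
Proof.
induction n as [|n IH]; [simpl; ring|].
change (rsum f (S (S n))) with (rsum f (S n) + f (S n)); rewrite IH; simpl; ring.
Qed.

Lemma sum_n_rsum f n : sum_n f n = rsum f (S n).
Proof.
induction n as [|n IH]; [rewrite sum_O; symmetry; apply Rplus_0_l|].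
rewrite sum_Sn, IH; reflexivity.
Qed.

Lemma sum_n_csum (f : nat -> C) n : sum_n f n = csum f (S n).
Proof.
induction n as [|n IH]; [rewrite sum_O; symmetry; apply Cplus_0_l|].
rewrite sum_Sn, IH; reflexivity.
Qed.

(** Jensen's inequality for the square. The weights will be the values of an
    invariant density at the preimages of a point, or a geometric sequence. *)
Lemma rsum_sqr_le g a n :
  (forall i, (i < n)%nat -> 0 <= g i) ->
  (rsum (fun i => g i * a i) n) ^ 2 <= rsum g n * rsum (fun i => g i * a i ^ 2) n.
Proof.
induction n as [|n IH]; intros H; cbn [rsum]; [lra|].
assert (Hn : 0 <= g n) by (apply H; lia).
assert (G0 : 0 <= rsum g n) by (apply rsum_ge0; intros; apply H; lia).
assert (S0 : 0 <= rsum (fun i => g i * a i ^ 2) n).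
{ apply rsum_ge0; intros; apply Rmult_le_pos; [apply H; lia|apply pow2_ge_0]. }
assert (IH' := IH (fun i hi => H i (Nat.lt_lt_succ_r _ _ hi))).
set (G := rsum g n) in *; set (T := rsum (fun i => g i * a i ^ 2) n) in *.
set (W := rsum (fun i => g i * a i) n) in *.
assert (K : 2 * W * a n <= G * a n ^ 2 + T).
{ destruct (Rle_lt_or_eq_dec 0 G G0) as [Gp|G00].
  - apply Rmult_le_reg_l with G; [assumption|].
    assert (0 <= (G * a n - W) ^ 2) by apply pow2_ge_0. nra.
  - rewrite <- G00 in *. assert (U0 : W = 0) by nra. rewrite U0. lra. }
assert (K' : 0 <= g n * (G * a n ^ 2 + T - 2 * W * a n)) by (apply Rmult_le_pos; lra).
replace ((G + g n) * (T + g n * a n ^ 2)) with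
  ((W + g n * a n) ^ 2 + (G * T - W ^ 2) + g n * (G * a n ^ 2 + T - 2 * W * a n)) by ring.
lra.
Qed.

Lemma csum_ext f g n : (forall i, (i < n)%nat -> f i = g i) -> csum f n = csum g n.
Proof.
induction n as [|n IH]; intros H; simpl; [reflexivity|].
rewrite IH by (intros; apply H; lia). rewrite H by lia; reflexivity.
Qed.

Lemma csum_plus f g n : csum (fun i => Cplus (f i) (g i)) n = Cplus (csum f n) (csum g n).
Proof. induction n as [|n IH]; simpl; [ring|rewrite IH; ring]. Qed.

Lemma csum_scal a f n : csum (fun i => Cmult a (f i)) n = Cmult a (csum f n).
Proof. induction n as [|n IH]; simpl; [ring|rewrite IH; ring]. Qed.

Lemma csum_shift f n : csum f (S n) = Cplus (f O) (csum (fun i => f (S i)) n).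
Proof.
induction n as [|n IH]; [simpl; ring|].
change (csum f (S (S n))) with (Cplus (csum f (S n)) (f (S n))); rewrite IH; simpl; ring.
Qed.

Lemma csum_fst f n : fst (csum f n) = rsum (fun i => fst (f i)) n.
Proof. induction n as [|n IH]; simpl; [reflexivity|rewrite IH; reflexivity]. Qed.

Lemma csum_snd f n : snd (csum f n) = rsum (fun i => snd (f i)) n.
Proof. induction n as [|n IH]; simpl; [reflexivity|rewrite IH; reflexivity]. Qed.

Lemma csum_mod f n : Cmod (csum f n) <= rsum (fun i => Cmod (f i)) n.
Proof.
induction n as [|n IH]; simpl; [rewrite Cmod_0; lra|].
eapply Rle_trans; [apply Cmod_triangle|lra].
Qed.

(** * Complex numbers *)

Lemma Cmod_sqr (z : C) : Cmod z ^ 2 = fst z ^ 2 + snd z ^ 2.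
Proof. apply Cmod2_alt. Qed.

Lemma fst_le_Cmod (z : C) : Rabs (fst z) <= Cmod z.
Proof. eapply Rle_trans; [apply Rmax_l|apply Rmax_Cmod]. Qed.

Lemma snd_le_Cmod (z : C) : Rabs (snd z) <= Cmod z.
Proof. eapply Rle_trans; [apply Rmax_r|apply Rmax_Cmod]. Qed.

Lemma Cmod_le_sum (z : C) : Cmod z <= Rabs (fst z) + Rabs (snd z).
Proof.
apply Rsqr_incr_0_var; [|generalize (Rabs_pos (fst z)) (Rabs_pos (snd z)); lra].
rewrite !Rsqr_pow2, Cmod_sqr.
rewrite <- (pow2_abs (fst z)), <- (pow2_abs (snd z)).
generalize (Rabs_pos (fst z)) (Rabs_pos (snd z)); nra.
Qed.

Lemma Cmod_minus_sym (z w : C) : Cmod (Cminus z w) = Cmod (Cminus w z).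
Proof. rewrite <- Cmod_opp; f_equal; ring. Qed.

Lemma Cmod_triangle_minus (z w : C) : Cmod z <= Cmod w + Cmod (Cminus z w).
Proof. replace z with (Cplus w (Cminus z w)) at 1 by ring; apply Cmod_triangle. Qed.

Lemma Cmod_split (z w v : C) : Cmod (Cminus z v) <= Cmod (Cminus z w) + Cmod (Cminus w v).
Proof. replace (Cminus z v) with (Cplus (Cminus z w) (Cminus w v)) by ring; apply Cmod_triangle. Qed.

Lemma Cmod_small_eq0 (z : C) : (forall eps, 0 < eps -> Cmod z <= eps) -> z = RtoC 0.
Proof.
intros H; apply Cmod_eq_0; apply Rle_antisym; [|apply Cmod_ge_0].
apply le_epsilon; intros e he; rewrite Rplus_0_l; auto.
Qed.

(** Young's inequality with a factor at the first term as close to 1 as wanted,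
    so that a contraction survives the addition of a remainder. *)
Lemma Cmod_plus_sqr (L : R) (a b : C) : 1 < L ->
  Cmod (Cplus a b) ^ 2 <= L * Cmod a ^ 2 + L / (L - 1) * Cmod b ^ 2.
Proof.
intros hL.
assert (H := Cmod_triangle a b).
assert (P := Cmod_ge_0 (Cplus a b)).
assert (Cmod (Cplus a b) ^ 2 <= (Cmod a + Cmod b) ^ 2).
{ apply pow_incr; lra. }
eapply Rle_trans; [eassumption|].
set (x := Cmod a); set (y := Cmod b).
assert (E : L * x ^ 2 + L / (L - 1) * y ^ 2 - (x + y) ^ 2 =
            ((L - 1) * x - y) ^ 2 / (L - 1)) by (field; lra).
assert (0 <= ((L - 1) * x - y) ^ 2 / (L - 1)).
{ apply Rmult_le_pos; [apply pow2_ge_0|left; apply Rinv_0_lt_compat; lra]. }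
lra.
Qed.

Lemma cis_plus s t : cis (s + t) = Cmult (cis s) (cis t).
Proof. unfold cis, Cmult; simpl; rewrite cos_plus, sin_plus; f_equal; ring. Qed.

Lemma cis_0 : cis 0 = RtoC 1.
Proof. unfold cis; rewrite cos_0, sin_0; reflexivity. Qed.

Lemma Cmod_cis t : Cmod (cis t) = 1.
Proof.
apply Rsqr_inj; [apply Cmod_ge_0|lra|].
rewrite !Rsqr_pow2, Cmod_sqr; simpl fst; simpl snd.
generalize (sin2_cos2 t); rewrite !Rsqr_pow2; lra.
Qed.

Lemma cis_opp t : cis (- t) = Cconj (cis t).
Proof. unfold cis, Cconj; simpl; rewrite cos_neg, sin_neg; reflexivity. Qed.

(** * Continuity and integrals of complex-valued functions *)

Notation ccont f := (forall x : R, continuous (f : R -> C) x).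
Notation rcont f := (forall x : R, continuous (f : R -> R) x).

Lemma ccont_pair (f : R -> C) :
  rcont (fun x => fst (f x)) -> rcont (fun x => snd (f x)) -> ccont f.
Proof.
intros H1 H2 x.
apply (continuous_ext (fun x => (fst (f x), snd (f x)))); [intros t; destruct (f t); reflexivity|].
apply (continuous_comp_2 (fun x => fst (f x)) (fun x => snd (f x)) (fun a b => (a, b) : C)); auto.
apply continuous_ext with (fun z : R * R => z); [intros [a b]; reflexivity|apply continuous_id].
Qed.

Lemma ccont_fst (f : R -> C) : ccont f -> rcont (fun x => fst (f x)).
Proof.
intros H x; apply (continuous_comp f (fun z : R * R => fst z)); [apply H|].
destruct (f x); apply continuous_fst.
Qed.

Lemma ccont_snd (f : R -> C) : ccont f -> rcont (fun x => snd (f x)).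
Proof.
intros H x; apply (continuous_comp f (fun z : R * R => snd z)); [apply H|].
destruct (f x); apply continuous_snd.
Qed.

Lemma rcont_plus f g : rcont f -> rcont g -> rcont (fun x => f x + g x).
Proof. intros H1 H2 x; apply (continuous_plus f g); auto. Qed.

Lemma rcont_mult f g : rcont f -> rcont g -> rcont (fun x => f x * g x).
Proof. intros H1 H2 x; apply (continuous_mult f g); auto. Qed.

Lemma rcont_minus f g : rcont f -> rcont g -> rcont (fun x => f x - g x).
Proof. intros H1 H2 x; apply (continuous_minus f g); auto. Qed.

Lemma rcont_const c : rcont (fun _ => c).
Proof. intros x; apply continuous_const. Qed.

Lemma rcont_comp f g : rcont f -> rcont g -> rcont (fun x => f (g x)).
Proof. intros H1 H2 x; apply (continuous_comp g f); auto. Qed.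

Lemma rcont_inv f : rcont f -> (forall x, f x <> 0) -> rcont (fun x => / f x).
Proof. intros H1 H2 x; apply (continuous_Rinv_comp f); auto. Qed.

Lemma rcont_pow f n : rcont f -> rcont (fun x => f x ^ n).
Proof.
intros H; induction n as [|n IH]; simpl; [apply rcont_const|apply rcont_mult; assumption].
Qed.

Lemma rcont_rsum (F : nat -> R -> R) n :
  (forall i, (i < n)%nat -> rcont (F i)) -> rcont (fun x => rsum (fun i => F i x) n).
Proof.
induction n as [|n IH]; intros H; simpl; [apply rcont_const|].
apply (rcont_plus (fun x => rsum (fun i => F i x) n) (F n)).
- apply IH; intros; apply H; lia.
- apply H; lia.
Qed.

Lemma ccont_plus f g : ccont f -> ccont g -> ccont (fun x => Cplus (f x) (g x)).
Proof.
intros H1 H2; apply ccont_pair; simpl.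
- apply (rcont_plus _ _ (ccont_fst _ H1) (ccont_fst _ H2)).
- apply (rcont_plus _ _ (ccont_snd _ H1) (ccont_snd _ H2)).
Qed.

Lemma ccont_mult f g : ccont f -> ccont g -> ccont (fun x => Cmult (f x) (g x)).
Proof.
intros H1 H2; apply ccont_pair; simpl.
- apply rcont_minus; apply rcont_mult; (apply ccont_fst || apply ccont_snd); assumption.
- apply rcont_plus; apply rcont_mult; (apply ccont_fst || apply ccont_snd); assumption.
Qed.

Lemma ccont_const c : ccont (fun _ => c).
Proof. intros x; apply continuous_const. Qed.

Lemma ccont_RtoC f : rcont f -> ccont (fun x => RtoC (f x)).
Proof. intros H; apply ccont_pair; simpl; [assumption|apply rcont_const]. Qed.

Lemma ccont_comp (f : R -> C) g : ccont f -> rcont g -> ccont (fun x => f (g x)).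
Proof. intros H1 H2 x; apply (continuous_comp g f); auto. Qed.

Lemma ccont_minus f g : ccont f -> ccont g -> ccont (fun x => Cminus (f x) (g x)).
Proof.
intros H1 H2; apply ccont_pair; simpl.
- apply (rcont_minus _ _ (ccont_fst _ H1) (ccont_fst _ H2)).
- apply (rcont_minus _ _ (ccont_snd _ H1) (ccont_snd _ H2)).
Qed.

Lemma ccont_csum (F : nat -> R -> C) n :
  (forall i, (i < n)%nat -> ccont (F i)) -> ccont (fun x => csum (fun i => F i x) n).
Proof.
induction n as [|n IH]; intros H; simpl; [apply ccont_const|].
apply (ccont_plus (fun x => csum (fun i => F i x) n) (F n)).
- apply IH; intros; apply H; lia.
- apply H; lia.
Qed.

Lemma rcont_Cmod f : ccont f -> rcont (fun x => Cmod (f x)).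
Proof.
intros H. unfold Cmod. intros x; apply (continuous_sqrt_comp (fun x => fst (f x) ^ 2 + snd (f x) ^ 2)).
revert x; apply rcont_plus; apply rcont_pow; (apply ccont_fst || apply ccont_snd); assumption.
Qed.

(* The integral lives in a normed module, which hides the field R from [ring]. *)
Ltac eqR := match goal with |- @eq _ ?a ?b => change (@eq R a b) end.

Lemma ex_RInt_rcont f a b : rcont f -> ex_RInt f a b.
Proof. intros H; apply (ex_RInt_continuous (V := R_CompleteNormedModule)); auto. Qed.

(** Taken componentwise, to reduce everything to real integrals. *)
Definition cint (f : R -> C) : C :=
  (RInt (fun x => fst (f x)) 0 1, RInt (fun x => snd (f x)) 0 1).

Lemma cint_RInt f : ccont f -> RInt (V := C_R_CompleteNormedModule) f 0 1 = cint f.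
Proof.
intros H; apply is_RInt_unique.
apply (is_RInt_fct_extend_pair);
apply (RInt_correct (V := R_CompleteNormedModule)), ex_RInt_rcont;
(apply ccont_fst || apply ccont_snd); assumption.
Qed.

Lemma RInt_plus_r f g a b : rcont f -> rcont g ->
  RInt (fun x => f x + g x) a b = RInt f a b + RInt g a b.
Proof. intros H1 H2; apply (RInt_plus f g); apply ex_RInt_rcont; assumption. Qed.

Lemma RInt_minus_r f g a b : rcont f -> rcont g ->
  RInt (fun x => f x - g x) a b = RInt f a b - RInt g a b.
Proof. intros H1 H2; apply (RInt_minus f g); apply ex_RInt_rcont; assumption. Qed.

Lemma RInt_scal_r c f a b : rcont f -> RInt (fun x => c * f x) a b = c * RInt f a b.
Proof. intros H1; apply (RInt_scal f); apply ex_RInt_rcont; assumption. Qed.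

Lemma RInt_const_r c a b : RInt (fun _ => c) a b = (b - a) * c.
Proof. apply (RInt_const (V := R_CompleteNormedModule)). Qed.

Lemma RInt_le_r f g a b : a <= b -> rcont f -> rcont g ->
  (forall x, f x <= g x) -> RInt f a b <= RInt g a b.
Proof. intros ab H1 H2 H; apply RInt_le; auto using ex_RInt_rcont. Qed.

Lemma RInt_nonneg f a b : a <= b -> rcont f -> (forall x, 0 <= f x) -> 0 <= RInt f a b.
Proof. intros ab H1 H; apply RInt_ge_0; auto using ex_RInt_rcont. Qed.

Lemma RInt_rsum (F : nat -> R -> R) n a b :
  (forall i, (i < n)%nat -> rcont (F i)) ->
  RInt (fun x => rsum (fun i => F i x) n) a b = rsum (fun i => RInt (F i) a b) n.
Proof.
induction n as [|n IH]; intros H; simpl; [rewrite RInt_const_r; ring|].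
rewrite (RInt_plus_r (fun x => rsum (fun i => F i x) n) (F n)).
- rewrite IH; [reflexivity|intros; apply H; lia].
- apply rcont_rsum; intros; apply H; lia.
- apply H; lia.
Qed.

Lemma cint_plus f g : ccont f -> ccont g ->
  cint (fun x => Cplus (f x) (g x)) = Cplus (cint f) (cint g).
Proof.
intros H1 H2; unfold cint, Cplus; simpl; f_equal;
apply RInt_plus_r; (apply ccont_fst || apply ccont_snd); assumption.
Qed.

Lemma cint_scal c f : ccont f ->
  cint (fun x => Cmult c (f x)) = Cmult c (cint f).
Proof.
intros H; assert (H1 := ccont_fst _ H); assert (H2 := ccont_snd _ H).
unfold cint, Cmult; simpl; f_equal.
- rewrite RInt_minus_r, !RInt_scal_r; auto; apply rcont_mult; auto; apply rcont_const.
- rewrite RInt_plus_r, !RInt_scal_r; auto; apply rcont_mult; auto; apply rcont_const.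
Qed.

Lemma cint_minus f g : ccont f -> ccont g ->
  cint (fun x => Cminus (f x) (g x)) = Cminus (cint f) (cint g).
Proof.
intros H1 H2; unfold cint, Cminus, Cplus, Copp; simpl; f_equal;
apply RInt_minus_r; (apply ccont_fst || apply ccont_snd); assumption.
Qed.

Lemma cint_ext f g : (forall x, f x = g x) -> cint f = cint g.
Proof. intros H; f_equal; apply functional_extensionality; assumption. Qed.

Lemma cint_bound f M : ccont f -> (forall x, 0 <= x <= 1 -> Cmod (f x) <= M) -> Cmod (cint f) <= 2 * M.
Proof.
intros H B; eapply Rle_trans; [apply Cmod_le_sum|]; simpl.
assert (Rabs (RInt (fun x => fst (f x)) 0 1) <= (1 - 0) * M).
{ apply abs_RInt_le_const; [lra|apply ex_RInt_rcont, ccont_fst, H|].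
  intros t ht; eapply Rle_trans; [apply fst_le_Cmod|apply B, ht]. }
assert (Rabs (RInt (fun x => snd (f x)) 0 1) <= (1 - 0) * M).
{ apply abs_RInt_le_const; [lra|apply ex_RInt_rcont, ccont_snd, H|].
  intros t ht; eapply Rle_trans; [apply snd_le_Cmod|apply B, ht]. }
lra.
Qed.

(** * Periodic functions *)

Lemma periodic_Z {T} (f : R -> T) : periodic f -> forall (n : Z) x, f (x + IZR n) = f x.
Proof.
intros H.
assert (N : forall p x, f (x + INR p) = f x).
{ induction p as [|p IH]; intros x; [simpl; rewrite Rplus_0_r; reflexivity|].
  rewrite S_INR, <- Rplus_assoc, H; apply IH. }
intros n x; destruct (Z_le_gt_dec 0 n) as [h|h].
- rewrite <- (Z2Nat.id n h), <- INR_IZR_INZ; apply N.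
- rewrite <- (N (Z.to_nat (- n)) (x + IZR n)); f_equal.
  rewrite INR_IZR_INZ, Z2Nat.id, opp_IZR by lia; ring.
Qed.

Lemma periodic_near {T} (f : R -> T) (H : periodic f) a x :
  exists y, a <= y < a + 1 /\ f y = f x.
Proof.
exists (x + IZR (- Int_part (x - a))).
split; [|apply (periodic_Z f H)].
rewrite opp_IZR; generalize (base_Int_part (x - a)); lra.
Qed.

Lemma periodic_bounded f : periodic f -> rcont f ->
  exists M, 0 < M /\ forall x, Rabs (f x) <= M.
Proof.
intros P H.
destruct (continuity_ab_maj (fun x => Rabs (f x)) 0 1) as [c [Hc _]]; [lra| |].
{ intros x _; apply continuity_pt_filterlim.
  apply (continuous_comp f Rabs); [apply H|apply continuous_Rabs]. }
exists (Rabs (f c) + 1); split; [generalize (Rabs_pos (f c)); lra|].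
intros x; destruct (periodic_near f P 0 x) as [y [hy <-]].
specialize (Hc y ltac:(lra)); simpl in Hc; lra.
Qed.

Lemma periodic_cbounded (f : R -> C) : periodic f -> ccont f ->
  exists M, 0 < M /\ forall x, Cmod (f x) <= M.
Proof.
intros P H.
destruct (periodic_bounded (fun x => Cmod (f x))) as [M [M0 HM]].
- intros x; rewrite P; reflexivity.
- apply rcont_Cmod, H.
- exists M; split; [assumption|]; intros x; specialize (HM x).
  rewrite Rabs_pos_eq in HM by apply Cmod_ge_0; assumption.
Qed.

Lemma RInt_periodic f a : periodic f -> rcont f -> RInt f a (a + 1) = RInt f 0 1.
Proof.
intros P H.
assert (C1 := RInt_Chasles f 0 a (a + 1) (ex_RInt_rcont _ _ _ H) (ex_RInt_rcont _ _ _ H)).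
assert (C2 := RInt_Chasles f 0 1 (a + 1) (ex_RInt_rcont _ _ _ H) (ex_RInt_rcont _ _ _ H)).
assert (S : RInt f 1 (a + 1) = RInt f 0 a).
{ assert (E := RInt_comp_lin f 1 1 0 a).
  replace (1 * 0 + 1) with 1 in E by ring; replace (1 * a + 1) with (a + 1) in E by ring.
  rewrite <- E by (apply ex_RInt_rcont, H).
  apply RInt_ext; intros x _; unfold scal; simpl; unfold mult; simpl.
  rewrite !Rmult_1_l; apply P. }
unfold plus in *; simpl in *. lra.
Qed.

(** * Derivatives of complex-valued functions *)

Definition is_cder (f : R -> C) (x : R) (l : C) : Prop :=
  is_derive (fun t => fst (f t)) x (fst l) /\ is_derive (fun t => snd (f t)) x (snd l).

Definition cD (f : R -> C) (x : R) : C :=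
  (Derive (fun t => fst (f t)) x, Derive (fun t => snd (f t)) x).

Lemma is_cder_cD f x l : is_cder f x l -> cD f x = l.
Proof.
intros [H1 H2]; unfold cD; destruct l; f_equal; apply is_derive_unique; assumption.
Qed.

Lemma is_cder_cont f : (forall x, exists l, is_cder f x l) -> ccont f.
Proof.
intros H; apply ccont_pair; intros x; destruct (H x) as [l [H1 H2]];
apply (ex_derive_continuous (V := R_NormedModule)); eexists; eassumption.
Qed.

Lemma is_cder_plus f g x a b : is_cder f x a -> is_cder g x b ->
  is_cder (fun t => Cplus (f t) (g t)) x (Cplus a b).
Proof.
intros [H1 H2] [K1 K2]; split; simpl.
- exact (is_derive_plus _ _ _ _ _ H1 K1).
- exact (is_derive_plus _ _ _ _ _ H2 K2).
Qed.

Lemma is_derive_mult_r (f g : R -> R) x a b : is_derive f x a -> is_derive g x b ->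
  is_derive (fun t => f t * g t) x (a * g x + f x * b).
Proof. intros H K; exact (is_derive_mult f g x a b H K Rmult_comm). Qed.

Lemma is_cder_mult f g x a b : is_cder f x a -> is_cder g x b ->
  is_cder (fun t => Cmult (f t) (g t)) x (Cplus (Cmult a (g x)) (Cmult (f x) b)).
Proof.
intros [H1 H2] [K1 K2]; split; simpl.
- evar_last.
  + apply (is_derive_minus (fun t => fst (f t) * fst (g t)) (fun t => snd (f t) * snd (g t)));
    apply is_derive_mult_r; eassumption.
  + unfold minus, plus, opp; simpl; ring.
- evar_last.
  + apply (is_derive_plus (fun t => fst (f t) * snd (g t)) (fun t => snd (f t) * fst (g t)));
    apply is_derive_mult_r; eassumption.
  + unfold plus; simpl; ring.
Qed.

Lemma is_cder_const c x : is_cder (fun _ => c) x (RtoC 0).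
Proof. split; simpl; apply (is_derive_const (V := R_NormedModule)). Qed.

Lemma is_cder_RtoC f x a : is_derive f x a -> is_cder (fun t => RtoC (f t)) x (RtoC a).
Proof. intros H; split; simpl; [assumption|apply (is_derive_const (V := R_NormedModule))]. Qed.

Lemma is_cder_comp f g x a b : is_cder f (g x) a -> is_derive g x b ->
  is_cder (fun t => f (g t)) x (Cmult (RtoC b) a).
Proof.
intros [H1 H2] K; split; simpl.
- evar_last; [apply (is_derive_comp (fun t => fst (f t)) g); eassumption|].
  unfold scal; simpl; unfold mult; simpl; ring.
- evar_last; [apply (is_derive_comp (fun t => snd (f t)) g); eassumption|].
  unfold scal; simpl; unfold mult; simpl; ring.
Qed.

Lemma is_cder_cis f x a : is_derive f x a ->
  is_cder (fun t => cis (f t)) x (Cmult (0, a) (cis (f x))).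
Proof.
intros H; split; simpl.
- evar_last; [apply (is_derive_comp cos f); [apply is_derive_cos|eassumption]|].
  unfold scal; simpl; unfold mult; simpl; ring.
- evar_last; [apply (is_derive_comp sin f); [apply is_derive_sin|eassumption]|].
  unfold scal; simpl; unfold mult; simpl; ring.
Qed.

Lemma is_cder_csum (F : nat -> R -> C) (l : nat -> C) n x :
  (forall i, (i < n)%nat -> is_cder (F i) x (l i)) ->
  is_cder (fun t => csum (fun i => F i t) n) x (csum l n).
Proof.
induction n as [|n IH]; intros H; simpl; [apply is_cder_const|].
apply (is_cder_plus (fun t => csum (fun i => F i t) n) (F n)).
- apply IH; intros; apply H; lia.
- apply H; lia.
Qed.

Definition cdiff (f : R -> C) : Prop := forall x, is_cder f x (cD f x).

(** Differentiability of order [n] as iterated first-order differentiability: a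
    class of functions whose derivatives are built from the same class is then
    smooth by a one-line induction. *)
Fixpoint ncd (n : nat) (f : R -> C) : Prop :=
  match n with O => True | S n' => cdiff f /\ ncd n' (cD f) end.

Definition csmooth (f : R -> C) : Prop := periodic f /\ forall n, ncd n f.

Lemma cdiff_intro f g : (forall x, is_cder f x (g x)) -> cdiff f /\ cD f = g.
Proof.
intros H.
assert (E : cD f = g) by (apply functional_extensionality; intros x; apply is_cder_cD, H).
split; [intros x; rewrite E; apply H|exact E].
Qed.

Lemma ncd_intro n f g : (forall x, is_cder f x (g x)) -> ncd n g -> ncd (S n) f.
Proof. intros H K; destruct (cdiff_intro f g H) as [H1 H2]; split; [|rewrite H2]; assumption. Qed.

Lemma ncd_le n p f : (n <= p)%nat -> ncd p f -> ncd n f.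
Proof.
revert p f; induction n as [|n IH]; intros p f h H; simpl; [exact I|].
destruct p as [|p]; [lia|]; destruct H as [H1 H2]; split; [assumption|].
apply IH with p; [lia|assumption].
Qed.

Lemma ncd_plus n f g : ncd n f -> ncd n g -> ncd n (fun x => Cplus (f x) (g x)).
Proof.
revert f g; induction n as [|n IH]; intros f g Hf Hg; [exact I|].
apply ncd_intro with (fun x => Cplus (cD f x) (cD g x)).
- intros x; apply is_cder_plus; [apply Hf|apply Hg].
- apply IH; [apply Hf|apply Hg].
Qed.

Lemma ncd_mult n f g : ncd n f -> ncd n g -> ncd n (fun x => Cmult (f x) (g x)).
Proof.
revert f g; induction n as [|n IH]; intros f g Hf Hg; [exact I|].
apply ncd_intro with (fun x => Cplus (Cmult (cD f x) (g x)) (Cmult (f x) (cD g x))).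
- intros x; apply is_cder_mult; [apply Hf|apply Hg].
- apply ncd_plus; apply IH; try apply Hf; try apply Hg.
  + apply ncd_le with (S n); [lia|assumption].
  + apply ncd_le with (S n); [lia|assumption].
Qed.

Lemma ncd_const n c : ncd n (fun _ => c).
Proof.
revert c; induction n as [|n IH]; intros c; [exact I|].
apply ncd_intro with (fun _ => RtoC 0); [intros x; apply is_cder_const|apply IH].
Qed.

Lemma ncd_Rinv n (f : R -> R) : (forall x, f x <> 0) ->
  ncd n (fun x => RtoC (f x)) -> ncd n (fun x => RtoC (/ f x)).
Proof.
intros f0; revert f f0; induction n as [|n IH]; intros f f0 Hf; [exact I|].
assert (Hn : ncd n (fun x => RtoC (f x))) by (apply ncd_le with (S n); [lia|assumption]).
destruct Hf as [H1 H2].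
assert (K : forall x, ex_derive f x).
{ intros x; destruct (H1 x) as [H3 _]; eexists; exact H3. }
assert (E : cD (fun x => RtoC (f x)) = fun x => RtoC (Derive f x)).
{ apply functional_extensionality; intros x; apply is_cder_cD, is_cder_RtoC, Derive_correct, K. }
rewrite E in H2.
apply ncd_intro with
  (fun x => Cmult (Cmult (RtoC (-1)) (RtoC (Derive f x))) (Cmult (RtoC (/ f x)) (RtoC (/ f x)))).
- intros x.
  replace (Cmult _ _) with (RtoC (- Derive f x / f x ^ 2)).
  + apply is_cder_RtoC. apply is_derive_inv; [apply Derive_correct, K|apply f0].
  + rewrite <- !RtoC_mult; f_equal; field; apply f0.
- apply ncd_mult; [apply ncd_mult; [apply ncd_const|assumption]|].
  apply ncd_mult; apply IH; assumption.
Qed.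

Lemma smooth_Derive f : smooth f -> smooth (Derive f).
Proof.
intros H n x. destruct n as [|n]; [exact I|].
apply ex_derive_ext with (Derive_n f (S n)).
- intros t; change (Derive f) with (Derive_n f 1). rewrite Derive_n_comp.
  f_equal; lia.
- exact (H (S (S n)) x).
Qed.

Lemma smooth_ex_derive f : smooth f -> forall x, ex_derive f x.
Proof. intros H x; exact (H 1%nat x). Qed.

Lemma smooth_rcont f : smooth f -> rcont f.
Proof. intros H x; apply (ex_derive_continuous (V := R_NormedModule)), smooth_ex_derive, H. Qed.

Lemma ncd_RtoC n f : smooth f -> ncd n (fun x => RtoC (f x)).
Proof.
revert f; induction n as [|n IH]; intros f H; [exact I|].
apply ncd_intro with (fun x => RtoC (Derive f x)).
- intros x; apply is_cder_RtoC, Derive_correct, smooth_ex_derive, H.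
- apply IH, smooth_Derive, H.
Qed.

Lemma ncd_cis n f : smooth f -> ncd n (fun x => cis (f x)).
Proof.
intros H; induction n as [|n IH]; [exact I|].
apply ncd_intro with (fun x => Cmult (Cmult Ci (RtoC (Derive f x))) (cis (f x))).
- intros x; replace (Cmult Ci (RtoC (Derive f x))) with (0, Derive f x).
  + apply is_cder_cis, Derive_correct, smooth_ex_derive, H.
  + unfold Ci, Cmult, RtoC; simpl; f_equal; ring.
- apply ncd_mult; [|assumption].
  apply ncd_mult; [apply ncd_const|apply ncd_RtoC, smooth_Derive, H].
Qed.

Lemma csmooth_cdiff f : csmooth f -> cdiff f.
Proof. intros [_ H]; exact (proj1 (H 1%nat)). Qed.

Lemma csmooth_cont f : csmooth f -> ccont f.
Proof. intros H; apply is_cder_cont; intros x; exists (cD f x); apply csmooth_cdiff, H. Qed.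

Lemma Derive_periodic f : periodic f -> (forall x, ex_derive f x) -> periodic (Derive f).
Proof.
intros P H x.
assert (is_derive (fun t => f (t + 1)) x (Derive f (x + 1))).
{ evar_last.
  - apply (is_derive_comp f (fun t => t + 1)); [apply Derive_correct, H|].
    apply (is_derive_plus (fun t => t) (fun _ => 1)); [apply is_derive_id|apply is_derive_const].
  - unfold scal, plus, one, zero; simpl; unfold mult; simpl; ring. }
symmetry; apply is_derive_unique.
apply is_derive_ext with (fun t => f (t + 1)); [apply P|assumption].
Qed.

Lemma csmooth_cD f : csmooth f -> csmooth (cD f).
Proof.
intros H; split; [|intros n; exact (proj2 (proj2 H (S n)))].
intros x; unfold cD; f_equal; apply Derive_periodic.
- intros t; rewrite (proj1 H); reflexivity.
- intros t; destruct (csmooth_cdiff f H t) as [K _]; eexists; exact K.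
- intros t; rewrite (proj1 H); reflexivity.
- intros t; destruct (csmooth_cdiff f H t) as [_ K]; eexists; exact K.
Qed.

Lemma csmooth_plus f g : csmooth f -> csmooth g -> csmooth (fun x => Cplus (f x) (g x)).
Proof.
intros Hf Hg; split.
- intros x; rewrite (proj1 Hf), (proj1 Hg); reflexivity.
- intros n; apply ncd_plus; [apply Hf|apply Hg].
Qed.

Lemma csmooth_mult f g : csmooth f -> csmooth g -> csmooth (fun x => Cmult (f x) (g x)).
Proof.
intros Hf Hg; split.
- intros x; rewrite (proj1 Hf), (proj1 Hg); reflexivity.
- intros n; apply ncd_mult; [apply Hf|apply Hg].
Qed.

Lemma csmooth_const c : csmooth (fun _ => c).
Proof. split; [intros x; reflexivity|intros n; apply ncd_const]. Qed.

Lemma csmooth_csum (F : nat -> R -> C) n :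
  (forall i, (i < n)%nat -> csmooth (F i)) -> csmooth (fun x => csum (fun i => F i x) n).
Proof.
induction n as [|n IH]; intros H; simpl; [apply csmooth_const|].
apply (csmooth_plus (fun x => csum (fun i => F i x) n) (F n)).
- apply IH; intros; apply H; lia.
- apply H; lia.
Qed.

Definition cDn (j : nat) (f : R -> C) : R -> C := Nat.iter j cD f.

Lemma csmooth_cDn j f : csmooth f -> csmooth (cDn j f).
Proof. intros H; induction j as [|j IH]; [assumption|apply csmooth_cD, IH]. Qed.

Lemma cD_plus f g : csmooth f -> csmooth g ->
  cD (fun x => Cplus (f x) (g x)) = fun x => Cplus (cD f x) (cD g x).
Proof.
intros Hf Hg; apply cdiff_intro; intros x.
apply is_cder_plus; apply csmooth_cdiff; assumption.
Qed.

(** * Fourier coefficients *)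

Definition expi (n : Z) (x : R) : C := cis (2 * PI * IZR n * x).

Lemma cis_2PI_Z n : cis (2 * PI * IZR n) = RtoC 1.
Proof.
assert (S : sin (IZR n * PI) = 0) by (apply sin_eq_0_1; exists n; reflexivity).
unfold cis, RtoC.
replace (2 * PI * IZR n) with (2 * (IZR n * PI)) by ring.
rewrite cos_2a_sin, sin_2a, S; f_equal; ring.
Qed.

Lemma expi_opp n x : cis (- (2 * PI * IZR n * x)) = expi (- n) x.
Proof. unfold expi; rewrite opp_IZR; f_equal; ring. Qed.

Lemma expi_conj n x : expi (- n) x = Cconj (expi n x).
Proof. rewrite <- expi_opp; unfold expi; apply cis_opp. Qed.

Lemma expi_plus n p x : expi (n + p) x = Cmult (expi n x) (expi p x).
Proof. unfold expi; rewrite <- cis_plus, plus_IZR; f_equal; ring. Qed.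

Lemma expi_0 x : expi 0 x = RtoC 1.
Proof. unfold expi; rewrite Rmult_0_r, Rmult_0_l; apply cis_0. Qed.

Lemma Cmod_expi n x : Cmod (expi n x) = 1.
Proof. apply Cmod_cis. Qed.

Lemma expi_periodic n : periodic (expi n).
Proof.
intros x; unfold expi; rewrite Rmult_plus_distr_l, cis_plus, Rmult_1_r, cis_2PI_Z; ring.
Qed.

Lemma expi_is_cder n x : is_cder (expi n) x (Cmult (0, 2 * PI * IZR n) (expi n x)).
Proof. apply (is_cder_cis (fun t => 2 * PI * IZR n * t)); auto_derive; [exact I|ring]. Qed.

Lemma csmooth_expi n : csmooth (expi n).
Proof.
split; [apply expi_periodic|].
induction n0 as [|p IH]; [exact I|].
apply ncd_intro with (fun x => Cmult (0, 2 * PI * IZR n) (expi n x)).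
- intros x; apply expi_is_cder.
- apply ncd_mult; [apply ncd_const|exact IH].
Qed.

Lemma ccont_expi n : ccont (expi n).
Proof. apply csmooth_cont, csmooth_expi. Qed.

Lemma fourier_cint f n : ccont f -> fourier f n = cint (fun x => Cmult (expi (- n) x) (f x)).
Proof.
intros H; unfold fourier; rewrite <- cint_RInt.
- f_equal; apply functional_extensionality; intros x; rewrite expi_opp; reflexivity.
- apply ccont_mult; [apply ccont_expi|assumption].
Qed.

Lemma fourier_plus f g n : ccont f -> ccont g ->
  fourier (fun x => Cplus (f x) (g x)) n = Cplus (fourier f n) (fourier g n).
Proof.
intros Hf Hg; rewrite (fourier_cint _ _ (ccont_plus f g Hf Hg)), !fourier_cint by assumption.
rewrite <- cint_plus by (apply ccont_mult; auto; apply ccont_expi).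
apply cint_ext; intros x; ring.
Qed.

Lemma fourier_minus f g n : ccont f -> ccont g ->
  fourier (fun x => Cminus (f x) (g x)) n = Cminus (fourier f n) (fourier g n).
Proof.
intros Hf Hg; rewrite !fourier_cint by auto using ccont_minus.
rewrite <- cint_minus by (apply ccont_mult; auto; apply ccont_expi).
apply cint_ext; intros x; ring.
Qed.

Lemma fourier_scal c f n : ccont f ->
  fourier (fun x => Cmult c (f x)) n = Cmult c (fourier f n).
Proof.
intros Hf; rewrite !fourier_cint by (try apply ccont_mult; auto; apply ccont_const).
rewrite <- cint_scal by (apply ccont_mult; auto; apply ccont_expi).
apply cint_ext; intros x; ring.
Qed.

Lemma cint_cD f : csmooth f -> cint (cD f) = RtoC 0.
Proof.
intros H; assert (K := csmooth_cdiff f H).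
assert (KD := csmooth_cont _ (csmooth_cD f H)).
unfold cint, cD; cbn [fst snd].
rewrite !RInt_Derive.
- replace (f 1) with (f 0); [unfold RtoC; f_equal; ring|].
  rewrite <- (proj1 H 0); f_equal; ring.
- intros x _; exists (snd (cD f x)); exact (proj2 (K x)).
- intros x _; apply (ccont_snd _ KD x).
- intros x _; exists (fst (cD f x)); exact (proj1 (K x)).
- intros x _; apply (ccont_fst _ KD x).
Qed.

Lemma fourier_cD f n : csmooth f -> fourier (cD f) n = Cmult (0, 2 * PI * IZR n) (fourier f n).
Proof.
intros H.
assert (Hc := csmooth_cont f H). assert (Hd := csmooth_cont _ (csmooth_cD f H)).
rewrite !fourier_cint by assumption.
assert (E : cD (fun x => Cmult (expi (- n) x) (f x)) =
  fun x => Cplus (Cmult (Cmult (0, 2 * PI * IZR (- n)) (expi (- n) x)) (f x))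
                 (Cmult (expi (- n) x) (cD f x))).
{ apply cdiff_intro; intros x; apply is_cder_mult; [apply expi_is_cder|apply csmooth_cdiff, H]. }
assert (Z := cint_cD _ (csmooth_mult _ _ (csmooth_expi (- n)) H)).
rewrite E in Z.
rewrite cint_plus in Z.
- rewrite (cint_ext _ (fun x => Cmult (0, 2 * PI * IZR (- n)) (Cmult (expi (- n) x) (f x)))) in Z
    by (intros; ring).
  rewrite cint_scal in Z by (apply ccont_mult; [apply ccont_expi|assumption]).
  rewrite opp_IZR in Z.
  replace (0, 2 * PI * - IZR n) with (Copp (0, 2 * PI * IZR n)) in Z
    by (unfold Copp; simpl; f_equal; ring).
  set (A := cint (fun x => Cmult (expi (- n) x) (cD f x))) in *.
  set (B := cint (fun x => Cmult (expi (- n) x) (f x))) in *.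
  set (w := (0, 2 * PI * IZR n)) in *.
  replace A with (Cplus (Cmult w B) (Cplus (Cmult (Copp w) B) A)) by ring.
  rewrite Z; ring.
- apply ccont_mult; [|assumption]. apply ccont_mult; [apply ccont_const|apply ccont_expi].
- apply ccont_mult; [apply ccont_expi|assumption].
Qed.

Lemma fourier_cDn j f n : csmooth f ->
  fourier (cDn j f) n = Cmult (Cpow (0, 2 * PI * IZR n) j) (fourier f n).
Proof.
intros H; induction j as [|j IH]; [simpl; ring|].
change (cDn (S j) f) with (cD (cDn j f)).
rewrite fourier_cD by (apply csmooth_cDn, H). rewrite IH; simpl; ring.
Qed.

Lemma Cmod_imag a : Cmod (0, a) = Rabs a.
Proof.
apply Rsqr_inj; [apply Cmod_ge_0|apply Rabs_pos|].
rewrite !Rsqr_pow2, Cmod_sqr, pow2_abs; simpl; ring.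
Qed.

Lemma fourier_expi n p : fourier (expi n) p = if Z.eq_dec n p then RtoC 1 else RtoC 0.
Proof.
rewrite fourier_cint by apply ccont_expi.
rewrite (cint_ext _ (expi (n - p))) by (intros x; rewrite <- expi_plus; f_equal; lia).
destruct (Z.eq_dec n p) as [->|ne].
- rewrite (cint_ext _ (fun _ => RtoC 1)) by (intros x; rewrite Z.sub_diag; apply expi_0).
  unfold cint, RtoC; cbn [fst snd]; rewrite !RInt_const_r; f_equal; ring.
- assert (Z := cint_cD _ (csmooth_expi (n - p))).
  replace (cD (expi (n - p))) with (fun x => Cmult (0, 2 * PI * IZR (n - p)) (expi (n - p) x)) in Z
    by (symmetry; apply cdiff_intro; intros x; apply expi_is_cder).
  rewrite cint_scal in Z by apply ccont_expi.
  apply (f_equal Cmod) in Z; rewrite Cmod_mult, Cmod_0, Cmod_imag in Z.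
  apply Cmod_eq_0; apply Rmult_integral in Z; destruct Z as [Z|Z]; [exfalso|assumption].
  assert (IZR (n - p) <> 0) by (apply not_0_IZR; lia).
  revert Z; apply Rabs_no_R0; generalize PI_RGT_0; intros.
  apply Rmult_integral_contrapositive; split; [lra|assumption].
Qed.

(** A single index 0, -1, 1, -2, 2, ... for the two half-lines of frequencies. *)
Definition zenum (i : nat) : Z :=
  if Nat.even i then Z.of_nat (Nat.div2 i) else (- Z.of_nat (S (Nat.div2 i)))%Z.

Lemma zenum_even i : zenum (2 * i) = Z.of_nat i.
Proof. unfold zenum; rewrite Nat.even_even, Nat.div2_double; reflexivity. Qed.

Lemma zenum_odd i : zenum (S (2 * i)) = (- Z.of_nat (S i))%Z.
Proof.
unfold zenum. replace (S (2 * i)) with (2 * i + 1)%nat by lia.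
rewrite Nat.even_odd. replace (2 * i + 1)%nat with (S (2 * i)) by lia.
rewrite Nat.div2_succ_double; reflexivity.
Qed.

Lemma zenum_parity i : exists p, (i = 2 * p /\ zenum i = Z.of_nat p)%nat \/
                                 (i = S (2 * p) /\ zenum i = (- Z.of_nat (S p))%Z)%nat.
Proof.
destruct (Nat.Even_or_Odd i) as [[p ->]|[p ->]]; exists p.
- left; split; [reflexivity|apply zenum_even].
- right; split; [lia|]. replace (2 * p + 1)%nat with (S (2 * p)) by lia. apply zenum_odd.
Qed.

Lemma zenum_inj i j : zenum i = zenum j -> i = j.
Proof.
destruct (zenum_parity i) as [p [[-> ->]|[-> ->]]];
destruct (zenum_parity j) as [q [[-> ->]|[-> ->]]]; lia.
Qed.

Lemma rsum_zenum f N : rsum (fun i => f (zenum i)) (2 * N) =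
  rsum (fun i => f (Z.of_nat i)) N + rsum (fun i => f (- Z.of_nat (S i))%Z) N.
Proof.
induction N as [|N IH]; [simpl; ring|].
replace (2 * S N)%nat with (S (S (2 * N))) by lia.
cbn [rsum]; rewrite IH, zenum_even, zenum_odd; ring.
Qed.

Definition fourier_sum (c : Z -> C) (N : nat) (x : R) : C :=
  csum (fun i => Cmult (c (zenum i)) (expi (zenum i) x)) N.

Lemma csmooth_fourier_sum c N : csmooth (fourier_sum c N).
Proof.
apply csmooth_csum; intros i _; apply csmooth_mult; [apply csmooth_const|apply csmooth_expi].
Qed.

Lemma ccont_fourier_sum c N : ccont (fourier_sum c N).
Proof. apply csmooth_cont, csmooth_fourier_sum. Qed.

Lemma fourier_fourier_sum c N p : fourier (fourier_sum c N) p =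
  csum (fun i => if Z.eq_dec (zenum i) p then c p else RtoC 0) N.
Proof.
induction N as [|N IH].
- unfold fourier_sum; simpl. rewrite fourier_cint by apply ccont_const.
  rewrite (cint_ext _ (fun x => Cmult (RtoC 0) (RtoC 1))) by (intros; ring).
  rewrite cint_scal by apply ccont_const; ring.
- unfold fourier_sum; cbn [csum].
  rewrite fourier_plus; [|apply (ccont_fourier_sum c N)|apply ccont_mult; [apply ccont_const|apply ccont_expi]].
  change (fun x => csum _ N) with (fourier_sum c N); rewrite IH; f_equal.
  rewrite fourier_scal, fourier_expi by apply ccont_expi.
  destruct (Z.eq_dec (zenum N) p) as [<-|]; ring.
Qed.

Lemma fourier_fourier_sum_in c N i : (i < N)%nat -> fourier (fourier_sum c N) (zenum i) = c (zenum i).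
Proof.
intros hi; rewrite fourier_fourier_sum; induction N as [|N IH]; [lia|]; cbn [csum].
destruct (Nat.eq_dec i N) as [->|ne].
- destruct (Z.eq_dec (zenum N) (zenum N)) as [_|n]; [|congruence].
  rewrite (csum_ext _ (fun _ => Cmult (RtoC 0) (RtoC 0))).
  + rewrite csum_scal; ring.
  + intros j hj; destruct (Z.eq_dec (zenum j) (zenum N)) as [e|_]; [|ring].
    apply zenum_inj in e; lia.
- rewrite IH by lia.
  destruct (Z.eq_dec (zenum N) (zenum i)) as [e|_]; [apply zenum_inj in e; lia|ring].
Qed.

Lemma fourier_fourier_sum_out c N i : (N <= i)%nat -> fourier (fourier_sum c N) (zenum i) = RtoC 0.
Proof.
intros hi; rewrite fourier_fourier_sum.
rewrite (csum_ext _ (fun _ => Cmult (RtoC 0) (RtoC 0))).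
- rewrite csum_scal; ring.
- intros j hj; destruct (Z.eq_dec (zenum j) (zenum i)) as [e|_]; [|ring].
  apply zenum_inj in e; lia.
Qed.

(** The squared norm of [L^2(R/Z)]. *)
Definition sqnorm (f : R -> C) : R := RInt (fun x => Cmod (f x) ^ 2) 0 1.

Lemma rcont_Cmod2 f : ccont f -> rcont (fun x => Cmod (f x) ^ 2).
Proof. intros H; apply rcont_pow, rcont_Cmod, H. Qed.

Lemma sqnorm_pos f : ccont f -> 0 <= sqnorm f.
Proof. intros H; apply RInt_nonneg; [lra|apply rcont_Cmod2, H|intros; apply pow2_ge_0]. Qed.

(** The effect of one character on the squared norm. Adding the frequencies one
    at a time turns it into Bessel's inequality and, for trigonometric
    polynomials, into Parseval's identity. *)
Lemma sqnorm_minus_expi f c n : ccont f ->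
  sqnorm (fun x => Cminus (f x) (Cmult c (expi n x))) =
  sqnorm f - 2 * fst (Cmult (Cconj c) (fourier f n)) + Cmod c ^ 2.
Proof.
intros H; unfold sqnorm.
assert (P : forall x, Cmod (Cminus (f x) (Cmult c (expi n x))) ^ 2 =
  Cmod (f x) ^ 2 - 2 * fst (Cmult (Cconj c) (Cmult (expi (- n) x) (f x))) + Cmod c ^ 2).
{ intros x; rewrite expi_conj.
  replace (Cmod c ^ 2) with (Cmod (Cmult c (expi n x)) ^ 2) by (rewrite Cmod_mult, Cmod_expi; ring).
  rewrite !Cmod_sqr; destruct (f x), c, (expi n x); unfold Cconj; simpl; ring. }
assert (G : ccont (fun x => Cmult (expi (- n) x) (f x))).
{ apply ccont_mult; [apply ccont_expi|assumption]. }
assert (G' : ccont (fun x => Cmult (Cconj c) (Cmult (expi (- n) x) (f x)))).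
{ apply (ccont_mult (fun _ => Cconj c)); [apply ccont_const|assumption]. }
assert (G2 := ccont_fst _ G').
rewrite (RInt_ext _ (fun x => (Cmod (f x) ^ 2 -
   2 * fst (Cmult (Cconj c) (Cmult (expi (- n) x) (f x)))) + Cmod c ^ 2)) by (intros; apply P).
assert (H2 := rcont_Cmod2 _ H).
assert (G3 : rcont (fun x => 2 * fst (Cmult (Cconj c) (Cmult (expi (- n) x) (f x))))).
{ apply (rcont_mult (fun _ => 2)); [apply rcont_const|exact G2]. }
rewrite RInt_plus_r; [|apply rcont_minus; assumption|apply rcont_const].
rewrite RInt_minus_r by assumption.
rewrite RInt_scal_r by exact G2.
rewrite RInt_const_r.
change (RInt (fun x => fst (Cmult (Cconj c) (Cmult (expi (- n) x) (f x)))) 0 1)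
  with (fst (cint (fun x => Cmult (Cconj c) (Cmult (expi (- n) x) (f x))))).
rewrite cint_scal by exact G.
rewrite fourier_cint by exact H. ring.
Qed.

Lemma fst_conj_mult c : fst (Cmult (Cconj c) c) = Cmod c ^ 2.
Proof. rewrite Cmod_sqr; destruct c; simpl; ring. Qed.

Lemma bessel_eq f N : ccont f ->
  sqnorm (fun x => Cminus (f x) (fourier_sum (fourier f) N x)) =
  sqnorm f - rsum (fun i => Cmod (fourier f (zenum i)) ^ 2) N.
Proof.
intros H; induction N as [|N IH].
- unfold sqnorm, fourier_sum; cbn [csum rsum]; rewrite Rminus_0_r.
  apply RInt_ext; intros x _; f_equal; f_equal; ring.
- assert (K : ccont (fun x => Cminus (f x) (fourier_sum (fourier f) N x)))
    by (apply ccont_minus; [assumption|apply ccont_fourier_sum]).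
  assert (E := sqnorm_minus_expi _ (fourier f (zenum N)) (zenum N) K).
  rewrite IH, fourier_minus in E by (assumption || apply ccont_fourier_sum).
  rewrite fourier_fourier_sum_out in E by lia.
  replace (Cminus (fourier f (zenum N)) (RtoC 0)) with (fourier f (zenum N)) in E by ring.
  rewrite fst_conj_mult in E.
  cbn [rsum].
  match type of E with ?a = _ => match goal with |- ?b = _ => replace b with a end end.
  + rewrite E; ring.
  + f_equal; apply functional_extensionality; intros x; unfold fourier_sum; cbn [csum]; ring.
Qed.

Lemma bessel f N : ccont f -> rsum (fun i => Cmod (fourier f (zenum i)) ^ 2) N <= sqnorm f.
Proof.
intros H; assert (E := bessel_eq f N H).
assert (0 <= sqnorm (fun x => Cminus (f x) (fourier_sum (fourier f) N x))).
{ apply sqnorm_pos, ccont_minus; [assumption|apply ccont_fourier_sum]. }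
lra.
Qed.

Lemma parseval_fourier_sum c N : sqnorm (fourier_sum c N) = rsum (fun i => Cmod (c (zenum i)) ^ 2) N.
Proof.
induction N as [|N IH].
- unfold sqnorm, fourier_sum; cbn [csum rsum].
  rewrite (RInt_ext _ (fun _ => 0)) by (intros; rewrite Cmod_0; apply pow_i; lia).
  rewrite RInt_const_r; ring.
- assert (E := sqnorm_minus_expi _ (Copp (c (zenum N))) (zenum N) (ccont_fourier_sum c N)).
  rewrite IH, fourier_fourier_sum_out, Cmod_opp in E by lia.
  cbn [rsum].
  match type of E with ?a = _ => match goal with |- ?b = _ => replace b with a end end.
  + rewrite E; simpl; ring.
  + f_equal; apply functional_extensionality; intros x; unfold fourier_sum; cbn [csum]; ring.
Qed.

Lemma cDn_fourier_sum j c N :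
  cDn j (fourier_sum c N) = fourier_sum (fun n => Cmult (Cpow (0, 2 * PI * IZR n) j) (c n)) N.
Proof.
induction j as [|j IH].
- apply functional_extensionality; intros x; apply csum_ext; intros i _; simpl; ring.
- change (cDn (S j) (fourier_sum c N)) with (cD (cDn j (fourier_sum c N))); rewrite IH.
  apply cdiff_intro; intros x; unfold fourier_sum.
  apply is_cder_csum; intros i _.
  evar_last.
  + apply (is_cder_mult (fun _ => _)); [apply is_cder_const|apply expi_is_cder].
  + simpl; ring.
Qed.

(** ** A continuous function with vanishing Fourier coefficients is zero *)

(** Multiplication by a trigonometric polynomial of degree one only shifts and
    combines Fourier coefficients, so vanishing coefficients survive it. *)
Lemma fourier_0_mult f a c1 c2 p : ccont f -> (forall n, fourier f n = RtoC 0) ->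
  forall n, cint (fun x => Cmult (expi n x) (Cmult
    (Cpow (Cplus a (Cplus (Cmult c1 (expi 1 x)) (Cmult c2 (expi (-1) x)))) p) (f x))) = RtoC 0.
Proof.
intros Hc H0; induction p as [|p IH]; intros n.
- rewrite <- (H0 (- n)%Z), fourier_cint by assumption.
  apply cint_ext; intros x; rewrite Z.opp_involutive; simpl; ring.
- set (q := fun x => Cplus a (Cplus (Cmult c1 (expi 1 x)) (Cmult c2 (expi (-1) x)))) in *.
  assert (Qc : ccont q).
  { unfold q; apply (ccont_plus (fun _ => a)); [apply ccont_const|apply ccont_plus];
    (apply (ccont_mult (fun _ => _)); [apply ccont_const|apply ccont_expi]). }
  assert (Qp : ccont (fun x => Cpow (q x) p)).
  { clear - Qc; induction p as [|p IH]; simpl; [apply ccont_const|apply ccont_mult; assumption]. }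
  assert (K : forall l, ccont (fun x => Cmult (expi l x) (Cmult (Cpow (q x) p) (f x)))).
  { intros l; apply ccont_mult; [apply ccont_expi|apply ccont_mult; assumption]. }
  rewrite (cint_ext _ (fun x =>
    Cplus (Cmult a (Cmult (expi n x) (Cmult (Cpow (q x) p) (f x))))
    (Cplus (Cmult c1 (Cmult (expi (n + 1) x) (Cmult (Cpow (q x) p) (f x))))
           (Cmult c2 (Cmult (expi (n + -1) x) (Cmult (Cpow (q x) p) (f x))))))).
  + assert (K' : forall b l, ccont (fun x => Cmult b (Cmult (expi l x) (Cmult (Cpow (q x) p) (f x))))).
    { intros b l; apply (ccont_mult (fun _ => b)); [apply ccont_const|apply K]. }
    rewrite cint_plus; [|apply K'|apply ccont_plus; apply K'].
    rewrite cint_plus by apply K'.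
    rewrite !cint_scal by apply K.
    rewrite !IH; ring.
  + intros x; rewrite !expi_plus; cbn [Cpow]; fold (q x); unfold q at 1; ring.
Qed.

Lemma rcont_eps f : rcont f -> forall x eps, 0 < eps ->
  exists d, 0 < d /\ forall y, Rabs (y - x) < d -> Rabs (f y - f x) < eps.
Proof.
intros H x eps he.
destruct (proj1 (filterlim_locally f (f x)) (H x) (mkposreal eps he)) as [d Hd].
exists d; split; [apply cond_pos|]; intros y hy; exact (Hd y hy).
Qed.

(** For [a = cos (2 PI d)], the powers of [1 - a + cos (2 PI t)] blow up near
    [t = 0] and stay bounded by 1 for [d <= |t| <= 1/2], so that integration
    against them detects a positive value at [x0]. *)
Lemma unique_pos (r : R -> R) x0 : periodic r -> rcont r ->
  (forall a p, RInt (fun x => (1 - a + cos (2 * PI * (x - x0))) ^ p * r x) 0 1 = 0) ->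
  ~ 0 < r x0.
Proof.
intros P Hc H0 hr.
destruct (rcont_eps r Hc x0 (r x0 / 2) ltac:(lra)) as [d0 [d0p Hd0]].
set (d := Rmin (d0 / 2) (1 / 4)).
assert (dp : 0 < d /\ d < d0 /\ d <= 1 / 4).
{ unfold d; split; [apply Rmin_pos; lra|split; [|apply Rmin_r]].
  eapply Rle_lt_trans; [apply Rmin_l|lra]. }
destruct (periodic_bounded r P Hc) as [M [Mp HM]].
assert (pi := PI_RGT_0).
set (a := cos (2 * PI * d)).
set (Q := fun x => 1 - a + cos (2 * PI * (x - x0))).
assert (cosabs : forall t, cos (2 * PI * t) = cos (2 * PI * Rabs t)).
{ intros t; unfold Rabs; destruct (Rcase_abs t); [|reflexivity].
  rewrite <- cos_neg; f_equal; ring. }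
assert (a0 : 0 <= a).
{ unfold a; apply cos_ge_0; [nra|nra]. }
set (eta := cos (2 * PI * (d / 2)) - a).
assert (etap : 0 < eta).
{ unfold eta, a; assert (cos (2 * PI * d) < cos (2 * PI * (d / 2))); [|lra].
  apply cos_decreasing_1; nra. }
assert (Qc : rcont Q).
{ unfold Q; apply (rcont_plus (fun _ => 1 - a)); [apply rcont_const|].
  intros x; apply (continuous_cos_comp (fun x => 2 * PI * (x - x0))).
  revert x; apply (rcont_mult (fun _ => 2 * PI)); [apply rcont_const|].
  apply (rcont_minus (fun x => x)); [intros x; apply continuous_id|apply rcont_const]. }
assert (Qin : forall x, Rabs (x - x0) <= d / 2 -> 1 + eta <= Q x).
{ intros x hx; unfold Q, eta; rewrite (cosabs (x - x0)).
  assert (cos (2 * PI * (d / 2)) <= cos (2 * PI * Rabs (x - x0))); [|lra].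
  generalize (Rabs_pos (x - x0)); intros; apply cos_decr_1; nra. }
assert (Qmid : forall x, Rabs (x - x0) <= d -> 1 <= Q x).
{ intros x hx; unfold Q, a; rewrite (cosabs (x - x0)).
  assert (cos (2 * PI * d) <= cos (2 * PI * Rabs (x - x0))); [|lra].
  generalize (Rabs_pos (x - x0)); intros; apply cos_decr_1; nra. }
assert (Qout : forall x, d <= Rabs (x - x0) <= 1 / 2 -> Rabs (Q x) <= 1).
{ intros x hx; unfold Q, a; rewrite (cosabs (x - x0)).
  assert (cos (2 * PI * Rabs (x - x0)) <= cos (2 * PI * d)).
  { apply cos_decr_1; nra. }
  apply Rabs_le; split; [|lra].
  generalize (COS_bound (2 * PI * Rabs (x - x0))) (COS_bound (2 * PI * d)); lra. }
assert (rin : forall x, Rabs (x - x0) <= d -> r x0 / 2 <= r x).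
{ intros x hx; specialize (Hd0 x ltac:(lra)); apply Rabs_def2 in Hd0; lra. }
destruct (nfloor_ex (2 * M / (d * (r x0 / 2)) / eta)) as [p [_ hp]].
{ repeat apply Rmult_le_pos; try lra; try (left; apply Rinv_0_lt_compat; nra). }
set (n := S p).
set (F := fun x => Q x ^ n * r x).
assert (Fc : rcont F) by (unfold F; apply rcont_mult; [apply rcont_pow|]; assumption).
assert (FP : periodic F).
{ intros x; unfold F; rewrite P; f_equal; f_equal; unfold Q.
  replace (2 * PI * (x + 1 - x0)) with (2 * PI * (x - x0) + 2 * INR 1 * PI) by (simpl; ring).
  rewrite cos_period; reflexivity. }
assert (I0 : RInt F (x0 - 1 / 2) (x0 - 1 / 2 + 1) = 0).
{ rewrite RInt_periodic by assumption; apply H0. }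
assert (ch : RInt F (x0 - 1 / 2) (x0 - 1 / 2 + 1) =
  RInt F (x0 - 1 / 2) (x0 - d / 2) + (RInt F (x0 - d / 2) (x0 + d / 2)
   + RInt F (x0 + d / 2) (x0 - 1 / 2 + 1))).
{ symmetry.
  rewrite <- (RInt_Chasles F (x0 - 1 / 2) (x0 - d / 2) (x0 - 1 / 2 + 1));
    [|apply ex_RInt_rcont, Fc..].
  rewrite <- (RInt_Chasles F (x0 - d / 2) (x0 + d / 2) (x0 - 1 / 2 + 1));
    [|apply ex_RInt_rcont, Fc..]. reflexivity. }
assert (Fout : forall x, Rabs (x - x0) <= 1 / 2 -> - M <= F x).
{ intros x hx; unfold F; destruct (Rle_lt_dec (Rabs (x - x0)) d) as [h|h].
  - apply Rle_trans with 0; [lra|].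
    apply Rmult_le_pos; [apply pow_le; specialize (Qmid x h); lra|specialize (rin x h); lra].
  - specialize (Qout x ltac:(lra)); specialize (HM x).
    assert (B : Rabs (Q x ^ n * r x) <= M).
    { rewrite Rabs_mult, <- RPow_abs.
      assert (Rabs (Q x) ^ n <= 1).
      { rewrite <- (pow1 n); apply pow_incr; split; [apply Rabs_pos|assumption]. }
      assert (0 <= Rabs (Q x) ^ n) by (apply pow_le, Rabs_pos).
      generalize (Rabs_pos (r x)); nra. }
    apply Rabs_le_between in B; lra. }
assert (lowM : forall u v, x0 - 1 / 2 <= u <= v -> v <= x0 + 1 / 2 -> - M <= RInt F u v).
{ intros u v huv hv.
  apply Rle_trans with (RInt (fun _ => - M) u v).
  - rewrite RInt_const_r. nra.
  - apply RInt_le; [lra|apply ex_RInt_rcont, rcont_const|apply ex_RInt_rcont, Fc|].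
    intros x hx; apply Fout; apply Rabs_le; lra. }
assert (L1 := lowM (x0 - 1 / 2) (x0 - d / 2) ltac:(lra) ltac:(lra)).
assert (L3 := lowM (x0 + d / 2) (x0 - 1 / 2 + 1) ltac:(lra) ltac:(lra)).
assert (L2 : d * ((1 + eta) ^ n * (r x0 / 2)) <= RInt F (x0 - d / 2) (x0 + d / 2)).
{ apply Rle_trans with (RInt (fun _ => (1 + eta) ^ n * (r x0 / 2)) (x0 - d / 2) (x0 + d / 2)).
  - rewrite RInt_const_r. right; field.
  - apply RInt_le; [lra|apply ex_RInt_rcont, rcont_const|apply ex_RInt_rcont, Fc|].
    intros x hx; unfold F; apply Rmult_le_compat.
    + apply pow_le; lra.
    + lra.
    + apply pow_incr; split; [lra|apply Qin; apply Rabs_le; lra].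
    + apply rin, Rabs_le; lra. }
assert (B : 1 + INR n * eta <= (1 + eta) ^ n) by (apply poly; assumption).
assert (hp' : 2 * M < d * (INR n * eta * (r x0 / 2))).
{ unfold n; rewrite S_INR.
  apply (Rmult_lt_compat_r (d * (r x0 / 2) * eta)) in hp; [|apply Rmult_lt_0_compat; nra].
  replace (2 * M / (d * (r x0 / 2)) / eta * (d * (r x0 / 2) * eta)) with (2 * M) in hp by (field; lra).
  lra. }
assert (d * (INR n * eta * (r x0 / 2)) <= d * ((1 + eta) ^ n * (r x0 / 2))).
{ apply Rmult_le_compat_l; [lra|]. apply Rmult_le_compat_r; lra. }
lra.
Qed.

Lemma kernel_cos x0 a x :
  Cplus (RtoC (1 - a)) (Cplus (Cmult (Cmult (RtoC (/ 2)) (cis (- (2 * PI * x0)))) (expi 1 x))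
                   (Cmult (Cmult (RtoC (/ 2)) (cis (2 * PI * x0))) (expi (-1) x)))
  = RtoC (1 - a + cos (2 * PI * (x - x0))).
Proof.
unfold expi; rewrite <- !Cmult_assoc, <- !cis_plus.
replace (- (2 * PI * x0) + 2 * PI * 1 * x) with (2 * PI * (x - x0)) by ring.
replace (2 * PI * x0 + 2 * PI * -1 * x) with (- (2 * PI * (x - x0))) by ring.
unfold cis; rewrite cos_neg, sin_neg; unfold RtoC, Cplus, Cmult; simpl; f_equal; field.
Qed.

Theorem fourier_unique f : periodic f -> ccont f -> (forall n, fourier f n = RtoC 0) ->
  forall x, f x = RtoC 0.
Proof.
intros P Hc H0 x0.
assert (K : forall a p, cint (fun x => Cmult (RtoC ((1 - a + cos (2 * PI * (x - x0))) ^ p)) (f x)) = RtoC 0).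
{ intros a p.
  rewrite <- (fourier_0_mult f (RtoC (1 - a)) (Cmult (RtoC (/ 2)) (cis (- (2 * PI * x0))))
     (Cmult (RtoC (/ 2)) (cis (2 * PI * x0))) p Hc H0 0).
  apply cint_ext; intros x; rewrite expi_0, kernel_cos, RtoC_pow; ring. }
assert (K1 : forall a p, RInt (fun x => (1 - a + cos (2 * PI * (x - x0))) ^ p * fst (f x)) 0 1 = 0).
{ intros a p; specialize (K a p); apply (f_equal fst) in K; simpl in K.
  etransitivity; [|exact K]; apply RInt_ext; intros x _; cbn; ring. }
assert (K2 : forall a p, RInt (fun x => (1 - a + cos (2 * PI * (x - x0))) ^ p * snd (f x)) 0 1 = 0).
{ intros a p; specialize (K a p); apply (f_equal snd) in K; simpl in K.
  etransitivity; [|exact K]; apply RInt_ext; intros x _; cbn; ring. }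
assert (G : forall r, periodic r -> rcont r ->
  (forall a p, RInt (fun x => (1 - a + cos (2 * PI * (x - x0))) ^ p * r x) 0 1 = 0) -> r x0 = 0).
{ intros r Pr Hr Kr.
  destruct (Rtotal_order (r x0) 0) as [h|[h|h]]; [exfalso|assumption|exfalso].
  - apply (unique_pos (fun x => -1 * r x) x0).
    + intros x; rewrite Pr; reflexivity.
    + apply (rcont_mult (fun _ => -1)); [apply rcont_const|assumption].
    + intros a p.
      rewrite (RInt_ext _ (fun x => -1 * ((1 - a + cos (2 * PI * (x - x0))) ^ p * r x)))
        by (intros x _; eqR; ring).
      rewrite RInt_scal_r, Kr; [apply Rmult_0_r|].
      apply (rcont_mult (fun x => (1 - a + cos (2 * PI * (x - x0))) ^ p)); [|assumption].
      apply rcont_pow.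
      apply (rcont_plus (fun _ => 1 - a)); [apply rcont_const|].
      intros x; apply (continuous_cos_comp (fun x => 2 * PI * (x - x0))).
      revert x; apply (rcont_mult (fun _ => 2 * PI)); [apply rcont_const|].
      apply (rcont_minus (fun x => x)); [intros x; apply continuous_id|apply rcont_const].
    + lra.
  - apply (unique_pos r x0 Pr Hr Kr h). }
destruct (f x0) as [u v] eqn:E.
assert (u = 0).
{ change u with (fst (u, v)); rewrite <- E.
  apply (G (fun x => fst (f x))); [intros x; rewrite P; reflexivity|apply ccont_fst, Hc|exact K1]. }
assert (v = 0).
{ change v with (snd (u, v)); rewrite <- E.
  apply (G (fun x => snd (f x))); [intros x; rewrite P; reflexivity|apply ccont_snd, Hc|exact K2]. }
subst; reflexivity.
Qed.

(** * Series and uniform limits *)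

Lemma is_series_rsum a l : is_series a l <-> is_lim_seq (rsum a) l.
Proof.
assert (E : forall n, sum_n a n = rsum a (S n)) by (intros; apply sum_n_rsum).
split; intros H.
- apply is_lim_seq_incr_1. apply is_lim_seq_ext with (sum_n a); [exact E|exact H].
- apply is_lim_seq_incr_1 in H.
  apply (is_lim_seq_ext _ (sum_n a)) in H; [exact H|intros; symmetry; apply E].
Qed.

Lemma nonneg_series a B : (forall i, 0 <= a i) -> (forall n, rsum a n <= B) ->
  ex_series a /\ Series a <= B /\ forall n, rsum a n <= Series a.
Proof.
intros P H.
assert (L : ex_finite_lim_seq (rsum a)).
{ apply ex_finite_lim_seq_incr with B; [intros n; simpl; specialize (P n); lra|exact H]. }
destruct L as [l L].
assert (S : is_series a l) by (apply is_series_rsum, L).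
rewrite (is_series_unique _ _ S); split; [eexists; exact S|split].
- apply (is_lim_seq_le (rsum a) (fun _ => B) l B); [exact H|exact L|apply is_lim_seq_const].
- intros n; apply (is_lim_seq_incr_compare (rsum a)); [exact L|].
  intros p; simpl; specialize (P p); lra.
Qed.

Lemma rsum_tail a M n p : (forall i, Rabs (a i) <= M i) ->
  Rabs (rsum a (n + p) - rsum a n) <= rsum M (n + p) - rsum M n.
Proof.
intros H; induction p as [|p IH].
- rewrite Nat.add_0_r, !Rminus_diag, Rabs_R0; lra.
- rewrite Nat.add_succ_r; cbn [rsum].
  replace (rsum a (n + p) + a (n + p)%nat - rsum a n)
    with ((rsum a (n + p) - rsum a n) + a (n + p)%nat) by ring.
  eapply Rle_trans; [apply Rabs_triang|]. specialize (H (n + p)%nat); lra.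
Qed.

Lemma series_tail a M : (forall i, Rabs (a i) <= M i) -> ex_series M ->
  forall n, Rabs (rsum a n - Series a) <= Series M - rsum M n.
Proof.
intros H [m Hm] n.
assert (Ha : ex_series a).
{ apply (ex_series_le (V := R_CompleteNormedModule) a M); [exact H|exists m; exact Hm]. }
destruct Ha as [l Ha].
rewrite (is_series_unique _ _ Ha), (is_series_unique _ _ Hm).
apply is_series_rsum in Ha. apply is_series_rsum in Hm.
apply (is_lim_seq_le (fun p => Rabs (rsum a n - rsum a (p + n)))
  (fun p => rsum M (p + n) - rsum M n) (Rabs (rsum a n - l)) (m - rsum M n)).
- intros p; rewrite Rabs_minus_sym, Nat.add_comm; apply rsum_tail, H.
- apply (is_lim_seq_abs _ (Finite _)).
  apply (is_lim_seq_minus' (fun _ => rsum a n)); [apply is_lim_seq_const|].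
  apply (is_lim_seq_incr_n (rsum a)), Ha.
- apply (is_lim_seq_minus' _ (fun _ => rsum M n)); [|apply is_lim_seq_const].
  apply (is_lim_seq_incr_n (rsum M)), Hm.
Qed.

Lemma series_tail_0 M : ex_series M -> forall eps, 0 < eps ->
  exists N, forall n, (N <= n)%nat -> Series M - rsum M n <= eps.
Proof.
intros [m Hm] eps he; rewrite (is_series_unique _ _ Hm).
apply is_series_rsum, is_lim_seq_spec in Hm.
destruct (Hm (mkposreal eps he)) as [N HN]; exists N; intros n hn.
specialize (HN n hn); simpl in HN; apply Rabs_def2 in HN; lra.
Qed.

Definition CSeries (a : nat -> C) : C := (Series (fun n => fst (a n)), Series (fun n => snd (a n))).

Lemma cseries_tail a M : (forall i, Cmod (a i) <= M i) -> ex_series M ->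
  forall n, Cmod (Cminus (csum a n) (CSeries a)) <= 2 * (Series M - rsum M n).
Proof.
intros H HM n; eapply Rle_trans; [apply Cmod_le_sum|].
assert (H1 := series_tail (fun i => fst (a i)) M
  (fun i => Rle_trans _ _ _ (fst_le_Cmod _) (H i)) HM n).
assert (H2 := series_tail (fun i => snd (a i)) M
  (fun i => Rle_trans _ _ _ (snd_le_Cmod _) (H i)) HM n).
unfold CSeries; simpl; rewrite csum_fst, csum_snd. unfold Rminus in *; lra.
Qed.

Definition ulim (F : nat -> R -> C) (f : R -> C) : Prop :=
  forall eps, 0 < eps -> exists N, forall n, (N <= n)%nat -> forall x,
    Cmod (Cminus (F n x) (f x)) <= eps.

Lemma ulim_series (F : nat -> R -> C) M : (forall i x, Cmod (F i x) <= M i) -> ex_series M ->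
  ulim (fun n x => csum (fun i => F i x) n) (fun x => CSeries (fun i => F i x)).
Proof.
intros H HM eps he.
destruct (series_tail_0 M HM (eps / 2) ltac:(lra)) as [N HN].
exists N; intros n hn x.
eapply Rle_trans; [apply (cseries_tail _ M); auto|]. specialize (HN n hn); lra.
Qed.

Lemma ulim_periodic F f : (forall n, periodic (F n)) -> ulim F f -> periodic f.
Proof.
intros P H x.
assert (E : Cminus (f (x + 1)) (f x) = RtoC 0).
{ apply Cmod_small_eq0; intros eps he.
  destruct (H (eps / 2) ltac:(lra)) as [N HN].
  assert (H1 := HN N (le_n N) (x + 1)); assert (H2 := HN N (le_n N) x).
  rewrite P in H1.
  eapply Rle_trans; [apply (Cmod_split _ (F N x))|]. rewrite (Cmod_minus_sym (f (x + 1))); lra. }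
replace (f (x + 1)) with (Cplus (f x) (Cminus (f (x + 1)) (f x))) by ring.
rewrite E; ring.
Qed.

Lemma ccont_intro (f : R -> C) :
  (forall x eps, 0 < eps -> exists d, 0 < d /\
     forall y, Rabs (y - x) < d -> Cmod (Cminus (f y) (f x)) < eps) -> ccont f.
Proof.
intros H x; apply filterlim_locally; intros eps.
destruct (H x eps (cond_pos eps)) as [d [dp Hd]].
exists (mkposreal d dp); intros y hy.
apply (C_NormedModule_mixin_compat1 (f x) (f y) eps), Hd, hy.
Qed.

Lemma ccont_eps f : ccont f -> forall x eps, 0 < eps -> exists d, 0 < d /\
     forall y, Rabs (y - x) < d -> Cmod (Cminus (f y) (f x)) < eps.
Proof.
intros H x eps he.
destruct (rcont_eps (fun y => Cmod (Cminus (f y) (f x)))) with (x := x) (eps := eps)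
  as [d [dp Hd]]; [|assumption|].
- apply rcont_Cmod, ccont_minus; [assumption|apply ccont_const].
- exists d; split; [assumption|]; intros y hy; specialize (Hd y hy).
  replace (Cminus (f x) (f x)) with (RtoC 0) in Hd by ring.
  rewrite Cmod_0, Rminus_0_r in Hd; apply Rabs_def2 in Hd; lra.
Qed.

Lemma ulim_cont F f : (forall n, ccont (F n)) -> ulim F f -> ccont f.
Proof.
intros Hc H; apply ccont_intro; intros x eps he.
destruct (H (eps / 4) ltac:(lra)) as [N HN]; specialize (HN N (le_n N)).
destruct (ccont_eps (F N) (Hc N) x (eps / 4) ltac:(lra)) as [d [dp Hd]].
exists d; split; [assumption|]; intros y hy; specialize (Hd y hy).
assert (H1 := HN x); assert (H2 := HN y).
assert (K := Cmod_split (f y) (F N y) (f x)).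
assert (K' := Cmod_split (F N y) (F N x) (f x)).
rewrite (Cmod_minus_sym (f y) (F N y)) in K; lra.
Qed.

Lemma ulim_ext F G f : (forall n x, F n x = G n x) -> ulim F f -> ulim G f.
Proof.
intros E H eps he; destruct (H eps he) as [N HN]; exists N; intros n hn x.
rewrite <- E; apply HN, hn.
Qed.

Lemma fourier_bound f n M : ccont f -> (forall x, Cmod (f x) <= M) -> Cmod (fourier f n) <= 2 * M.
Proof.
intros Hc H; rewrite fourier_cint by assumption.
apply cint_bound; [apply ccont_mult; [apply ccont_expi|assumption]|].
intros x _; rewrite Cmod_mult, Cmod_expi, Rmult_1_l; apply H.
Qed.

Lemma ulim_fourier F f p : (forall n, ccont (F n)) -> ulim F f ->
  is_lim_seq (fun n => Cmod (Cminus (fourier (F n) p) (fourier f p))) 0.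
Proof.
intros Hc H; assert (fc := ulim_cont F f Hc H).
apply is_lim_seq_spec; intros eps.
destruct (H (eps / 4)) as [N HN]; [generalize (cond_pos eps); lra|].
exists N; intros n hn.
rewrite Rminus_0_r, Rabs_pos_eq by apply Cmod_ge_0.
rewrite <- fourier_minus by auto.
eapply Rle_lt_trans; [apply (fourier_bound _ _ (eps / 4))|].
- apply ccont_minus; auto.
- apply HN, hn.
- generalize (cond_pos eps); lra.
Qed.

Lemma is_lim_seq_Cmod (a : nat -> C) l :
  is_lim_seq (fun n => Cmod (Cminus (a n) l)) 0 -> is_lim_seq (fun n => Cmod (a n)) (Cmod l).
Proof.
intros H; apply is_lim_seq_spec; intros eps; apply is_lim_seq_spec in H.
destruct (H eps) as [N HN]; exists N; intros n hn; specialize (HN n hn).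
rewrite Rminus_0_r, Rabs_pos_eq in HN by apply Cmod_ge_0.
assert (K1 := Cmod_triangle_minus (a n) l).
assert (K2 := Cmod_triangle_minus l (a n)). rewrite Cmod_minus_sym in K2.
apply Rabs_def1; lra.
Qed.

Lemma is_lim_seq_rsum (a : nat -> nat -> R) (l : nat -> R) N :
  (forall i, is_lim_seq (fun n => a n i) (l i)) ->
  is_lim_seq (fun n => rsum (a n) N) (rsum l N).
Proof.
intros H; induction N as [|N IH]; simpl; [apply is_lim_seq_const|].
apply (is_lim_seq_plus' (fun n => rsum (a n) N)); [exact IH|apply H].
Qed.

(** * Sobolev spaces *)

Definition sobolev_sum (m : nat) (f : R -> C) (N : nat) : R :=
  rsum (fun i => sobolev_term m f (zenum i)) N.

Lemma sq1_pos n : 1 <= 1 + IZR n ^ 2.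
Proof. generalize (pow2_ge_0 (IZR n)); lra. Qed.

Lemma sobolev_term_pos m f n : 0 <= sobolev_term m f n.
Proof.
unfold sobolev_term; apply Rmult_le_pos; [apply pow_le|apply pow2_ge_0].
generalize (sq1_pos n); lra.
Qed.

(** Lower semicontinuity of the Sobolev norm: finitely many Fourier coefficients
    depend continuously on the function. *)
Lemma ulim_sobolev_sum m F f N B : (forall n, ccont (F n)) -> ulim F f ->
  (forall n, sobolev_sum m (F n) N <= B) -> sobolev_sum m f N <= B.
Proof.
intros Hc H HB.
apply (is_lim_seq_le (fun n => sobolev_sum m (F n) N) (fun _ => B) (sobolev_sum m f N) B HB);
  [|apply is_lim_seq_const].
apply (is_lim_seq_rsum (fun n i => sobolev_term m (F n) (zenum i))); intros i.
unfold sobolev_term.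
apply (is_lim_seq_scal_l (fun n => Cmod (fourier (F n) (zenum i)) ^ 2) _ (Finite _)).
simpl; rewrite !Rmult_1_r.
assert (L := is_lim_seq_Cmod _ _ (ulim_fourier F f (zenum i) Hc H)).
apply is_lim_seq_ext with
  (fun n => Cmod (fourier (F n) (zenum i)) * Cmod (fourier (F n) (zenum i))); [intros; ring|].
apply (is_lim_seq_mult' _ _ _ _ L L).
Qed.

Lemma sobolev_sum_le_2 m f N : sobolev_sum m f N <= sobolev_sum m f (2 * N).
Proof. apply rsum_mono; [intros; apply sobolev_term_pos|lia]. Qed.

Lemma sobolev_sum_split m f N : sobolev_sum m f (2 * N) =
  rsum (fun n => sobolev_term m f (Z.of_nat n)) N +
  rsum (fun n => sobolev_term m f (- Z.of_nat (S n))) N.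
Proof. apply (rsum_zenum (sobolev_term m f)). Qed.

Lemma sobolev_norm_pos m f : 0 <= sobolev_norm m f.
Proof. apply sqrt_pos. Qed.

Lemma ex_series_rsum_le a : (forall i, 0 <= a i) -> ex_series a -> forall n, rsum a n <= Series a.
Proof.
intros P [l H] n; rewrite (is_series_unique _ _ H).
apply (is_lim_seq_incr_compare (rsum a)); [apply is_series_rsum, H|].
intros p; simpl; specialize (P p); lra.
Qed.

Lemma sobolev_sum_le_norm m f N : sobolev m f -> sobolev_sum m f N <= sobolev_norm m f ^ 2.
Proof.
intros (_ & _ & H1 & H2).
assert (K1 := ex_series_rsum_le _ (fun i => sobolev_term_pos m f _) H1).
assert (K2 := ex_series_rsum_le _ (fun i => sobolev_term_pos m f _) H2).
unfold sobolev_norm; rewrite pow2_sqrt.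
- eapply Rle_trans; [apply sobolev_sum_le_2|]; rewrite sobolev_sum_split.
  specialize (K1 N); specialize (K2 N); lra.
- specialize (K1 O); specialize (K2 O); cbn [rsum] in K1, K2; lra.
Qed.

(** Membership and norm bounds are read off finite sums; all later estimates are
    made on these and pass to uniform limits. *)
Lemma sobolev_sum_sobolev m f B : periodic f -> ccont f -> (forall N, sobolev_sum m f N <= B) ->
  sobolev m f /\ sobolev_norm m f ^ 2 <= B.
Proof.
intros P Hc H.
set (a := fun n => sobolev_term m f (Z.of_nat n)).
set (b := fun n => sobolev_term m f (- Z.of_nat (S n))).
assert (a0 : forall i, 0 <= a i) by (intros; apply sobolev_term_pos).
assert (b0 : forall i, 0 <= b i) by (intros; apply sobolev_term_pos).
assert (AB : forall N, rsum a N + rsum b N <= B).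
{ intros N; unfold a, b; rewrite <- (sobolev_sum_split m f N); apply H. }
assert (rsa : forall N, 0 <= rsum a N) by (intros; apply rsum_ge0; auto).
assert (rsb : forall N, 0 <= rsum b N) by (intros; apply rsum_ge0; auto).
destruct (nonneg_series a B a0) as [A1 [_ A2]].
{ intros n; specialize (AB n); specialize (rsb n); lra. }
destruct (nonneg_series b B b0) as [B1 [_ B2]].
{ intros n; specialize (AB n); specialize (rsa n); lra. }
split; [exact (conj P (conj Hc (conj A1 B1)))|].
unfold sobolev_norm; fold a b; rewrite pow2_sqrt.
- destruct A1 as [la A1]; destruct B1 as [lb B1].
  rewrite (is_series_unique _ _ A1), (is_series_unique _ _ B1).
  apply (is_lim_seq_le (fun N => rsum a N + rsum b N) (fun _ => B) (la + lb) B AB).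
  + apply is_lim_seq_plus'; apply is_series_rsum; assumption.
  + apply is_lim_seq_const.
- specialize (A2 O); specialize (B2 O); cbn [rsum] in A2, B2; lra.
Qed.

Lemma sobolev_sum_plus m f g N : ccont f -> ccont g ->
  sobolev_sum m (fun x => Cplus (f x) (g x)) N <= 2 * sobolev_sum m f N + 2 * sobolev_sum m g N.
Proof.
intros Hf Hg; unfold sobolev_sum; rewrite <- !rsum_scal, <- rsum_plus.
apply rsum_le; intros i _; unfold sobolev_term.
rewrite fourier_plus by assumption.
assert (K := Cmod_plus_sqr 2 (fourier f (zenum i)) (fourier g (zenum i)) ltac:(lra)).
replace (2 / (2 - 1)) with 2 in K by field.
assert (0 <= (1 + IZR (zenum i) ^ 2) ^ m) by (apply pow_le; generalize (sq1_pos (zenum i)); lra).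
nra.
Qed.

Lemma sobolev_sum_scal m c f N : ccont f ->
  sobolev_sum m (fun x => Cmult c (f x)) N = Cmod c ^ 2 * sobolev_sum m f N.
Proof.
intros Hf; unfold sobolev_sum; rewrite <- rsum_scal; apply rsum_ext; intros i _; unfold sobolev_term.
rewrite fourier_scal, Cmod_mult by assumption; ring.
Qed.

Lemma sobolev_periodic m f : sobolev m f -> periodic f.
Proof. intros H; apply H. Qed.

Lemma sobolev_ccont m f : sobolev m f -> ccont f.
Proof. intros H; apply H. Qed.

Lemma sobolev_plus m f g : sobolev m f -> sobolev m g -> sobolev m (fun x => Cplus (f x) (g x)).
Proof.
intros Hf Hg.
apply (sobolev_sum_sobolev m _ (2 * sobolev_norm m f ^ 2 + 2 * sobolev_norm m g ^ 2)).
- intros x; rewrite (sobolev_periodic m f Hf), (sobolev_periodic m g Hg); reflexivity.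
- exact (ccont_plus _ _ (sobolev_ccont m f Hf) (sobolev_ccont m g Hg)).
- intros N; eapply Rle_trans; [exact (sobolev_sum_plus m f g N (sobolev_ccont m f Hf) (sobolev_ccont m g Hg))|].
  assert (K1 := sobolev_sum_le_norm m f N Hf); assert (K2 := sobolev_sum_le_norm m g N Hg); lra.
Qed.

Lemma sobolev_scal m c f : sobolev m f -> sobolev m (fun x => Cmult c (f x)).
Proof.
intros Hf.
apply (sobolev_sum_sobolev m _ (Cmod c ^ 2 * sobolev_norm m f ^ 2)).
- intros x; rewrite (sobolev_periodic m f Hf); reflexivity.
- apply (ccont_mult (fun _ => c)); [apply ccont_const|exact (sobolev_ccont m f Hf)].
- intros N; rewrite sobolev_sum_scal by exact (sobolev_ccont m f Hf).
  apply Rmult_le_compat_l; [apply pow2_ge_0|apply sobolev_sum_le_norm, Hf].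
Qed.

Lemma rsum_inv_zenum N : rsum (fun i => / (1 + IZR (zenum i) ^ 2)) N <= 16.
Proof.
(* The [i]-th term is at most 16 / ((i + 1) (i + 2)), which telescopes. *)
assert (K : rsum (fun i => / (1 + IZR (zenum i) ^ 2)) N <= 16 - 16 / (INR N + 1)).
{ induction N as [|N IH]; [simpl; lra|]; cbn [rsum]; rewrite S_INR.
  assert (n0 := pos_INR N).
  assert (T : / (1 + IZR (zenum N) ^ 2) <= 16 / (INR N + 1) - 16 / (INR N + 1 + 1)).
  { assert (Z : (INR N + 1) * (INR N + 2) / 16 <= 1 + IZR (zenum N) ^ 2).
    { destruct (zenum_parity N) as [p [[-> ->]|[-> ->]]].
      - rewrite <- INR_IZR_INZ, mult_INR; simpl (INR 2); generalize (pos_INR p); nra.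
      - rewrite opp_IZR, <- INR_IZR_INZ, !S_INR, mult_INR; simpl (INR 2); generalize (pos_INR p); nra. }
    replace (16 / (INR N + 1) - 16 / (INR N + 1 + 1))
      with (/ ((INR N + 1) * (INR N + 2) / 16)) by (field; lra).
    apply Rinv_le_contravar; [nra|exact Z]. }
  lra. }
assert (0 <= 16 / (INR N + 1)).
{ apply Rmult_le_pos; [lra|left; apply Rinv_0_lt_compat; generalize (pos_INR N); lra]. }
lra.
Qed.

(** For [m >= 1] the coefficients are absolutely summable, by
    [|c_n| <= 1 / (1 + n^2) + (1 + n^2) |c_n|^2]. The sum of the series has the
    coefficients of [f], hence equals [f] by uniqueness. *)
Theorem sobolev_ulim m f : (1 <= m)%nat -> sobolev m f -> ulim (fourier_sum (fourier f)) f.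
Proof.
intros hm Hf.
set (c := fourier f).
assert (T : forall n, (1 + IZR n ^ 2) * Cmod (c n) ^ 2 <= sobolev_term m f n).
{ intros n; unfold sobolev_term; apply Rmult_le_compat_r; [apply pow2_ge_0|].
  rewrite <- (pow_1 (1 + IZR n ^ 2)) at 1. apply Rle_pow; [apply sq1_pos|assumption]. }
set (M := fun i => Cmod (c (zenum i))).
destruct (nonneg_series M (16 + sobolev_norm m f ^ 2)) as [HM _].
{ intros i; apply Cmod_ge_0. }
{ intros N.
  apply Rle_trans with (rsum (fun i => / (1 + IZR (zenum i) ^ 2) + sobolev_term m f (zenum i)) N).
  - apply rsum_le; intros i _; unfold M.
    eapply Rle_trans; [|apply Rplus_le_compat_l, T].
    assert (q := sq1_pos (zenum i)); set (s := 1 + IZR (zenum i) ^ 2) in *.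
    set (t := Cmod (c (zenum i))).
    assert (E : / s + s * t ^ 2 - t = (/ s) * ((s * t - / 2) ^ 2 + 3 / 4)) by (field; lra).
    assert (0 <= / s * ((s * t - / 2) ^ 2 + 3 / 4)); [|lra].
    apply Rmult_le_pos; [left; apply Rinv_0_lt_compat; lra|generalize (pow2_ge_0 (s * t - / 2)); lra].
  - rewrite rsum_plus; assert (K := sobolev_sum_le_norm m f N Hf); assert (K' := rsum_inv_zenum N).
    unfold sobolev_sum in K; lra. }
set (g := fun x => CSeries (fun i => Cmult (c (zenum i)) (expi (zenum i) x))).
assert (L : ulim (fourier_sum c) g).
{ apply (ulim_series (fun i x => Cmult (c (zenum i)) (expi (zenum i) x)) M); [|exact HM].
  intros i x; rewrite Cmod_mult, Cmod_expi; unfold M; lra. }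
assert (gc : ccont g) by (apply (ulim_cont (fourier_sum c)); [intros; apply ccont_fourier_sum|exact L]).
assert (gp : periodic g) by (apply (ulim_periodic (fourier_sum c)); [intros; apply csmooth_fourier_sum|exact L]).
assert (fc := sobolev_ccont m f Hf). assert (fp := sobolev_periodic m f Hf).
assert (Z : forall x, Cminus (g x) (f x) = RtoC 0).
{ apply (fourier_unique (fun x => Cminus (g x) (f x))).
  - intros x; rewrite gp, fp; reflexivity.
  - apply ccont_minus; assumption.
  - intros p; rewrite fourier_minus by assumption.
    assert (Lp := ulim_fourier (fourier_sum c) g p (ccont_fourier_sum c) L).
    assert (E : exists i, zenum i = p).
    { destruct (Z_le_gt_dec 0 p) as [h|h].
      - exists (2 * Z.to_nat p)%nat; rewrite zenum_even; lia.
      - exists (S (2 * Z.to_nat (- p - 1))); rewrite zenum_odd; lia. }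
    destruct E as [i Ei].
    assert (L' : is_lim_seq (fun _ => Cmod (Cminus (fourier g p) (c p))) 0).
    { apply is_lim_seq_ext_loc with (2 := Lp).
      exists (S i); intros n hn. rewrite <- Ei at 1. rewrite fourier_fourier_sum_in by lia.
      rewrite Ei; apply Cmod_minus_sym. }
    apply is_lim_seq_unique in L'; rewrite Lim_seq_const in L'.
    apply Cmod_eq_0; injection L'; auto. }
intros eps he; destruct (L eps he) as [N HN]; exists N; intros n hn x.
replace (f x) with (Cminus (g x) (Cminus (g x) (f x))) by ring. rewrite Z.
replace (Cminus (g x) (RtoC 0)) with (g x) by ring. apply HN, hn.
Qed.

(** * Energies of smooth functions *)

Lemma sqnorm_cDn_fourier_sum j m f N : (j <= m)%nat -> sqnorm (cDn j (fourier_sum (fourier f) N)) <= 64 ^ m * sobolev_sum m f N.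
Proof.
intros hj; rewrite cDn_fourier_sum, parseval_fourier_sum; unfold sobolev_sum; rewrite <- rsum_scal.
apply rsum_le; intros i _; unfold sobolev_term.
rewrite Cmod_mult, Cmod_pow, Cmod_imag, Rpow_mult_distr, <- Rmult_assoc.
apply Rmult_le_compat_r; [apply pow2_ge_0|].
rewrite <- pow_mult, (Nat.mul_comm j), pow_mult, pow2_abs, <- Rpow_mult_distr.
apply Rle_trans with ((64 * (1 + IZR (zenum i) ^ 2)) ^ j).
- apply pow_incr; split; [apply pow2_ge_0|].
  assert (pi := PI_RGT_0); assert (pi4 := PI_4).
  rewrite Rpow_mult_distr. assert ((2 * PI) ^ 2 <= 64) by nra.
  generalize (pow2_ge_0 (IZR (zenum i))) (pow2_ge_0 (2 * PI)); nra.
- apply Rle_pow; [generalize (sq1_pos (zenum i)); lra|assumption].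
Qed.

Lemma pow_1_plus_le t m : 0 <= t -> (1 + t) ^ m <= 2 ^ m * (1 + t ^ m).
Proof.
intros ht; destruct (Rle_lt_dec t 1) as [h|h].
- apply Rle_trans with (2 ^ m); [apply pow_incr; lra|].
  assert (0 <= 2 ^ m) by (apply pow_le; lra). assert (0 <= t ^ m) by (apply pow_le; lra). nra.
- apply Rle_trans with ((2 * t) ^ m); [apply pow_incr; lra|].
  rewrite Rpow_mult_distr. assert (0 <= 2 ^ m) by (apply pow_le; lra).
  nra.
Qed.

Lemma sobolev_sum_le_sqnorm m f N : csmooth f -> sobolev_sum m f N <= 2 ^ m * (sqnorm f + sqnorm (cDn m f)).
Proof.
intros H.
assert (B0 := bessel f N (csmooth_cont f H)).
assert (B1 := bessel (cDn m f) N (csmooth_cont _ (csmooth_cDn m f H))).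
apply Rle_trans with (2 ^ m * (rsum (fun i => Cmod (fourier f (zenum i)) ^ 2) N +
   rsum (fun i => Cmod (fourier (cDn m f) (zenum i)) ^ 2) N));
  [|apply Rmult_le_compat_l; [apply pow_le|]; lra].
rewrite <- rsum_plus, <- rsum_scal; unfold sobolev_sum; apply rsum_le; intros i _; unfold sobolev_term.
rewrite fourier_cDn, Cmod_mult, Cmod_pow, Cmod_imag, Rpow_mult_distr by assumption.
rewrite <- pow_mult, (Nat.mul_comm m), pow_mult, pow2_abs.
set (s := Cmod (fourier f (zenum i)) ^ 2).
assert (s0 : 0 <= s) by apply pow2_ge_0.
set (n := IZR (zenum i)).
assert (K := pow_1_plus_le (n ^ 2) m (pow2_ge_0 n)).
assert (K' : (n ^ 2) ^ m <= ((2 * PI * n) ^ 2) ^ m).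
{ apply pow_incr; split; [apply pow2_ge_0|].
  assert (pi : 3 < PI) by (generalize PI2_3_2; unfold PI2; lra).
  rewrite Rpow_mult_distr; assert (1 <= (2 * PI) ^ 2) by nra.
  generalize (pow2_ge_0 n); nra. }
assert (0 < 2 ^ m) by (apply pow_lt; lra).
replace (s + ((2 * PI * n) ^ 2) ^ m * s) with ((1 + ((2 * PI * n) ^ 2) ^ m) * s) by ring.
rewrite <- Rmult_assoc; apply Rmult_le_compat_r; [assumption|].
eapply Rle_trans; [exact K|]. apply Rmult_le_compat_l; lra.
Qed.

(** The variance of [g] on the interval is nonnegative. *)
Lemma RInt_sqr_le g a b : rcont g -> a <= b -> (RInt g a b) ^ 2 <= (b - a) * RInt (fun x => g x ^ 2) a b.
Proof.
intros H ab.
destruct (Rle_lt_or_eq_dec a b ab) as [lt|<-].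
2: { rewrite RInt_point. unfold zero; simpl; lra. }
set (I := RInt g a b); set (c := I / (b - a)).
assert (P : 0 <= RInt (fun x => (g x - c) ^ 2) a b).
{ apply RInt_nonneg; [assumption| |intros; apply pow2_ge_0].
  apply rcont_pow, rcont_minus; [assumption|apply rcont_const]. }
rewrite (RInt_ext _ (fun x => (g x ^ 2 - (2 * c) * g x) + c ^ 2)) in P
  by (intros; simpl; ring).
assert (G1 : rcont (fun x => 2 * c * g x)) by (apply (rcont_mult (fun _ => 2 * c)); [apply rcont_const|assumption]).
assert (G2 : rcont (fun x => g x ^ 2)) by (apply rcont_pow, H).
rewrite RInt_plus_r, RInt_minus_r, RInt_scal_r, RInt_const_r in P;
  auto using rcont_minus, rcont_const.
fold I in P.
assert (E : (b - a) * (2 * c * I - (b - a) * c ^ 2) = I ^ 2) by (unfold c; field; lra).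
rewrite <- E; apply Rmult_le_compat_l; lra.
Qed.

Lemma RInt_sub_period f x y : periodic f -> rcont f -> (forall t, 0 <= f t) ->
  x <= y <= x + 1 -> RInt f x y <= RInt f 0 1.
Proof.
intros P Hc H0 h; rewrite <- (RInt_periodic f x) by assumption.
rewrite <- (RInt_Chasles f x y (x + 1)) by (apply ex_RInt_rcont, Hc).
assert (0 <= RInt f y (x + 1)) by (apply RInt_nonneg; auto; lra).
unfold plus; simpl; lra.
Qed.

(** The embedding of [H^1] into the Hoelder functions of exponent 1/2; it is the
    reason for the modulus [sqrt |x - y|] in all uniform estimates below. *)
Lemma csmooth_holder f x y : csmooth f -> Rabs (x - y) <= 1 ->
  Cmod (Cminus (f x) (f y)) ^ 2 <= Rabs (x - y) * sqnorm (cD f).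
Proof.
intros H.
assert (G : forall x y, x <= y <= x + 1 -> Cmod (Cminus (f y) (f x)) ^ 2 <= (y - x) * sqnorm (cD f)).
{ clear x y; intros x y h.
  assert (K := csmooth_cdiff f H).
  assert (KD := csmooth_cont _ (csmooth_cD f H)).
  assert (c1 := ccont_fst _ KD); assert (c2 := ccont_snd _ KD).
  assert (E1 : fst (f y) - fst (f x) = RInt (fun t => fst (cD f t)) x y).
  { unfold cD; cbn [fst]; rewrite RInt_Derive; [reflexivity| |intros t _; apply c1].
    intros t _; exists (fst (cD f t)); exact (proj1 (K t)). }
  assert (E2 : snd (f y) - snd (f x) = RInt (fun t => snd (cD f t)) x y).
  { unfold cD; cbn [snd]; rewrite RInt_Derive; [reflexivity| |intros t _; apply c2].
    intros t _; exists (snd (cD f t)); exact (proj2 (K t)). }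
  rewrite Cmod_sqr; unfold Cminus, Cplus, Copp; cbn [fst snd].
  change (fst (f y) + - fst (f x)) with (fst (f y) - fst (f x)).
  change (snd (f y) + - snd (f x)) with (snd (f y) - snd (f x)).
  rewrite E1, E2.
  assert (S1 := RInt_sqr_le _ x y c1 ltac:(lra)).
  assert (S2 := RInt_sqr_le _ x y c2 ltac:(lra)).
  assert (S3 : RInt (fun t => Cmod (cD f t) ^ 2) x y <= sqnorm (cD f)).
  { apply (RInt_sub_period (fun t => Cmod (cD f t) ^ 2)); [|apply rcont_Cmod2, KD|intros; apply pow2_ge_0|lra].
    intros t; rewrite (proj1 (csmooth_cD f H)); reflexivity. }
  rewrite (RInt_ext _ (fun t => fst (cD f t) ^ 2 + snd (cD f t) ^ 2)) in S3
    by (intros; apply Cmod_sqr).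
  rewrite RInt_plus_r in S3 by (apply rcont_pow; assumption).
  nra. }
intros h; unfold Rabs in *; destruct (Rcase_abs (x - y)) as [c|c].
- rewrite Cmod_minus_sym; replace (- (x - y)) with (y - x) by ring; apply G; lra.
- apply G; lra.
Qed.

Lemma csmooth_sup f x : csmooth f -> Cmod (f x) ^ 2 <= 2 * sqnorm f + 2 * sqnorm (cD f).
Proof.
intros H.
destruct (periodic_near f (proj1 H) 0 x) as [y [hy <-]].
assert (c := rcont_Cmod2 f (csmooth_cont f H)).
assert (u1 := sqnorm_pos _ (csmooth_cont _ (csmooth_cD f H))).
apply Rle_trans with (RInt (fun t => 2 * Cmod (f t) ^ 2 + 2 * sqnorm (cD f)) 0 1).
- assert (E : @eq R (RInt (fun _ => Cmod (f y) ^ 2) 0 1) (Cmod (f y) ^ 2)) by (rewrite RInt_const_r; ring).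
  rewrite <- E.
  apply RInt_le; [lra|apply ex_RInt_rcont, rcont_const| |].
  + apply ex_RInt_rcont, rcont_plus; [apply (rcont_mult (fun _ => 2)); [apply rcont_const|exact c]|apply rcont_const].
  + intros t ht.
    assert (d : Rabs (y - t) <= 1) by (apply Rabs_le; lra).
    assert (K := csmooth_holder f y t H d).
    assert (P := Cmod_plus_sqr 2 (f t) (Cminus (f y) (f t)) ltac:(lra)).
    replace (Cplus (f t) (Cminus (f y) (f t))) with (f y) in P by ring.
    replace (2 / (2 - 1)) with 2 in P by field.
    assert (Rabs (y - t) * sqnorm (cD f) <= sqnorm (cD f)) by (generalize (Rabs_pos (y - t)); nra).
    lra.
- rewrite RInt_plus_r, RInt_scal_r, RInt_const_r; unfold sqnorm; auto using rcont_const; try lra.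
  apply (rcont_mult (fun _ => 2)); [apply rcont_const|exact c].
Qed.

Lemma ulim_pointwise_le F f (g : C -> R) x B : ulim F f ->
  (forall z w, Rabs (g z - g w) <= Cmod (Cminus z w)) -> (forall n, g (F n x) <= B) -> g (f x) <= B.
Proof.
intros H L HB; apply le_epsilon; intros eps he.
destruct (H eps he) as [N HN]; specialize (HN N (le_n N) x); specialize (HB N).
specialize (L (f x) (F N x)); rewrite Cmod_minus_sym in L; apply Rabs_le_between in L; lra.
Qed.

Lemma ulim_Cmod_le F f x B : ulim F f -> (forall n, Cmod (F n x) <= B) -> Cmod (f x) <= B.
Proof.
intros H; apply (ulim_pointwise_le F f Cmod x B H); intros z w.
assert (K1 := Cmod_triangle_minus z w).
assert (K2 := Cmod_triangle_minus w z); rewrite Cmod_minus_sym in K2.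
apply Rabs_le; lra.
Qed.

Lemma sqr_le_sqrt a b : 0 <= a -> a ^ 2 <= b -> a <= sqrt b.
Proof.
intros ha h; rewrite <- (sqrt_pow2 a) by assumption. apply sqrt_le_1_alt, h.
Qed.

Lemma sobolev_sup m f x : (1 <= m)%nat -> sobolev m f ->
  Cmod (f x) <= sqrt (4 * 64 ^ m) * sobolev_norm m f.
Proof.
intros hm H.
apply (ulim_Cmod_le (fourier_sum (fourier f)) f); [apply (sobolev_ulim m); assumption|].
intros n; rewrite <- (sqrt_pow2 (sobolev_norm m f)) by apply sobolev_norm_pos.
rewrite <- sqrt_mult; [|apply Rmult_le_pos; [lra|apply pow_le; lra]|apply pow2_ge_0].
apply sqr_le_sqrt; [apply Cmod_ge_0|].
eapply Rle_trans; [apply csmooth_sup, csmooth_fourier_sum|].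
assert (K0 := sqnorm_cDn_fourier_sum 0 m f n ltac:(lia)).
assert (K1 := sqnorm_cDn_fourier_sum 1 m f n ltac:(lia)).
change (sqnorm (cDn 1 (fourier_sum (fourier f) n))) with (sqnorm (cD (fourier_sum (fourier f) n))) in K1.
change (sqnorm (cDn 0 (fourier_sum (fourier f) n))) with (sqnorm (fourier_sum (fourier f) n)) in K0.
assert (K2 := sobolev_sum_le_norm m f n H).
assert (0 <= 64 ^ m) by (apply pow_le; lra). nra.
Qed.

Lemma sobolev_holder m f x y : (1 <= m)%nat -> sobolev m f -> Rabs (x - y) <= 1 ->
  Cmod (Cminus (f x) (f y)) <= sqrt (64 ^ m) * sobolev_norm m f * sqrt (Rabs (x - y)).
Proof.
intros hm H h.
assert (L := sobolev_ulim m f hm H).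
rewrite <- (Rplus_0_l x) at 1; rewrite <- (Rplus_0_l y) at 1.
apply (ulim_Cmod_le (fun n t => Cminus (fourier_sum (fourier f) n (t + x)) (fourier_sum (fourier f) n (t + y)))
   (fun t => Cminus (f (t + x)) (f (t + y))) 0).
- intros eps he; destruct (L (eps / 2) ltac:(lra)) as [N HN]; exists N; intros n hn t.
  assert (H1 := HN n hn (t + x)); assert (H2 := HN n hn (t + y)).
  replace (Cminus (Cminus (fourier_sum (fourier f) n (t + x)) (fourier_sum (fourier f) n (t + y)))
    (Cminus (f (t + x)) (f (t + y)))) with
    (Cminus (Cminus (fourier_sum (fourier f) n (t + x)) (f (t + x))) (Cminus (fourier_sum (fourier f) n (t + y)) (f (t + y))))
    by ring.
  assert (T := Cmod_triangle (Cminus (fourier_sum (fourier f) n (t + x)) (f (t + x)))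
     (Copp (Cminus (fourier_sum (fourier f) n (t + y)) (f (t + y))))).
  rewrite Cmod_opp in T; unfold Cminus at 1; lra.
- intros n; rewrite !Rplus_0_l.
  rewrite <- (sqrt_pow2 (sobolev_norm m f)) by apply sobolev_norm_pos.
  assert (p64 : 0 <= 64 ^ m) by (apply pow_le; lra).
  rewrite <- !sqrt_mult; auto using pow2_ge_0, Rabs_pos, Rmult_le_pos.
  apply sqr_le_sqrt; [apply Cmod_ge_0|].
  eapply Rle_trans; [apply csmooth_holder; [apply csmooth_fourier_sum|exact h]|].
  rewrite (Rmult_comm (Rabs _)); apply Rmult_le_compat_r; [apply Rabs_pos|].
  eapply Rle_trans; [apply (sqnorm_cDn_fourier_sum 1 m f n hm)|].
  apply Rmult_le_compat_l; [apply pow_le; lra|apply sobolev_sum_le_norm, H].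
Qed.

Definition energy (m : nat) (f : R -> C) : R := rsum (fun j => sqnorm (cDn j f)) (S m).

Lemma energy_pos m f : csmooth f -> 0 <= energy m f.
Proof. intros H; apply rsum_ge0; intros j _; apply sqnorm_pos, csmooth_cont, csmooth_cDn, H. Qed.

Lemma energy_fourier_sum m f N : energy m (fourier_sum (fourier f) N) <= INR (S m) * (64 ^ m * sobolev_sum m f N).
Proof.
unfold energy; rewrite <- rsum_const; apply rsum_le; intros j hj; apply sqnorm_cDn_fourier_sum; lia.
Qed.

(** Estimates are proved for smooth functions, where they involve derivatives,
    and reach the whole Sobolev space through the partial sums of the Fourier
    series: these converge uniformly and have bounded energy, and the Sobolev
    norm is lower semicontinuous. *)
Lemma sobolev_extension m (T : (R -> C) -> R -> C) B : (1 <= m)%nat -> 0 <= B ->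
  (forall F f, (forall n, csmooth (F n)) -> ulim F f -> ulim (fun n => T (F n)) (T f)) ->
  (forall f, csmooth f -> csmooth (T f)) ->
  (forall f, csmooth f -> energy m (T f) <= B * energy m f) ->
  forall f, sobolev m f -> sobolev m (T f) /\
    sobolev_norm m (T f) ^ 2 <= (2 ^ m * 2 * INR (S m) * 64 ^ m) * B * sobolev_norm m f ^ 2.
Proof.
intros hm B0 Hu Hs HE f Hf.
assert (L := sobolev_ulim m f hm Hf).
assert (L' := Hu _ _ (csmooth_fourier_sum (fourier f)) L).
assert (S' : forall n, csmooth (T (fourier_sum (fourier f) n))) by (intros; apply Hs, csmooth_fourier_sum).
apply sobolev_sum_sobolev.
- apply (ulim_periodic _ _ (fun n => proj1 (S' n)) L').
- apply (ulim_cont _ _ (fun n => csmooth_cont _ (S' n)) L').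
- intros N; apply (ulim_sobolev_sum m _ _ N _ (fun n => csmooth_cont _ (S' n)) L').
  intros n; eapply Rle_trans; [apply sobolev_sum_le_sqnorm, S'|].
  assert (E1 : sqnorm (T (fourier_sum (fourier f) n)) <= energy m (T (fourier_sum (fourier f) n))).
  { apply (rsum_term_le (fun j => sqnorm (cDn j (T (fourier_sum (fourier f) n)))) (S m) 0); [|lia].
    intros j _; apply sqnorm_pos, csmooth_cont, csmooth_cDn, S'. }
  assert (E2 : sqnorm (cDn m (T (fourier_sum (fourier f) n))) <= energy m (T (fourier_sum (fourier f) n))).
  { apply (rsum_term_le (fun j => sqnorm (cDn j (T (fourier_sum (fourier f) n)))) (S m) m); [|lia].
    intros j _; apply sqnorm_pos, csmooth_cont, csmooth_cDn, S'. }
  assert (E3 := HE _ (csmooth_fourier_sum (fourier f) n)).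
  assert (E4 := energy_fourier_sum m f n). assert (E5 := sobolev_sum_le_norm m f n Hf).
  assert (p2 : 0 <= 2 ^ m) by (apply pow_le; lra).
  assert (p64 : 0 <= 64 ^ m) by (apply pow_le; lra).
  assert (pm := pos_INR (S m)).
  replace (2 ^ m * 2 * INR (S m) * 64 ^ m * B * sobolev_norm m f ^ 2)
    with (2 ^ m * (2 * (B * (INR (S m) * (64 ^ m * sobolev_norm m f ^ 2))))) by ring.
  apply Rmult_le_compat_l; [assumption|].
  assert (B * energy m (fourier_sum (fourier f) n) <= B * (INR (S m) * (64 ^ m * sobolev_norm m f ^ 2))).
  { apply Rmult_le_compat_l; [assumption|]. eapply Rle_trans; [exact E4|].
    apply Rmult_le_compat_l; [assumption|]. apply Rmult_le_compat_l; assumption. }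
  lra.
Qed.

Lemma bounded_derive_lipschitz f df B : (forall x, is_derive f x (df x)) ->
  (forall x, Rabs (df x) <= B) -> forall x y, Rabs (f x - f y) <= B * Rabs (x - y).
Proof.
intros H HB x y.
destruct (MVT_gen f y x df) as [c [_ E]].
- intros t _; apply H.
- intros t _; apply continuity_pt_filterlim, (ex_derive_continuous (V := R_NormedModule)).
  exists (df t); apply H.
- rewrite E, Rabs_mult; apply Rmult_le_compat_r; [apply Rabs_pos|apply HB].
Qed.

Lemma smooth_lipschitz f : smooth f -> periodic (Derive f) ->
  exists B, 0 < B /\ forall x y, Rabs (f x - f y) <= B * Rabs (x - y).
Proof.
intros H P.
destruct (periodic_bounded (Derive f) P (smooth_rcont _ (smooth_Derive f H))) as [B [Bp HB]].
exists B; split; [assumption|].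
apply (bounded_derive_lipschitz f (Derive f)); [|assumption].
intros x; apply Derive_correct, smooth_ex_derive, H.
Qed.

Lemma csmooth_lipschitz f : csmooth f -> exists B, 0 < B /\
  forall x y, Cmod (Cminus (f x) (f y)) <= B * Rabs (x - y).
Proof.
intros H; assert (K := csmooth_cdiff f H); assert (KD := csmooth_cD f H).
destruct (periodic_cbounded (cD f) (proj1 KD) (csmooth_cont _ KD)) as [B [Bp HB]].
exists (2 * B); split; [lra|]; intros x y.
eapply Rle_trans; [apply Cmod_le_sum|].
assert (H1 := bounded_derive_lipschitz (fun t => fst (f t)) (fun t => fst (cD f t)) B
  (fun t => proj1 (K t)) (fun t => Rle_trans _ _ _ (fst_le_Cmod _) (HB t)) x y).
assert (H2 := bounded_derive_lipschitz (fun t => snd (f t)) (fun t => snd (cD f t)) B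
  (fun t => proj2 (K t)) (fun t => Rle_trans _ _ _ (snd_le_Cmod _) (HB t)) x y).
unfold Rminus in *; simpl; lra.
Qed.

Class expanding (k : nat) (g : circle_diffeo) (lam : R) : Prop := Expanding {
  expanding_degree : (2 <= k)%nat;
  expanding_gt1 : 1 < lam;
  expanding_le : forall x, lam <= Derive (expand k g) x
}.

Section Dynamics.

Context {k : nat} {g : circle_diffeo} {lam : R} {Hexp : expanding k g lam}.
Let hk : (2 <= k)%nat := expanding_degree.
Let lam1 : 1 < lam := expanding_gt1.
Let hlam : forall x, lam <= Derive (expand k g) x := expanding_le.

(** * The expanding map and its inverse branches *)

Notation dE := (Derive (expand k g)).
Notation yb := (branch k g).

Lemma k_pos : 0 < INR k.
Proof. apply lt_0_INR; lia. Qed.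

Lemma expand_derive x : is_derive (expand k g) x (INR k * Derive g x).
Proof.
apply (is_derive_scal g x (INR k)), Derive_correct, smooth_ex_derive, lift_smooth.
Qed.

Lemma dE_eq x : dE x = INR k * Derive g x.
Proof. apply is_derive_unique, expand_derive. Qed.

Lemma dE_pos x : 0 < dE x.
Proof. generalize (hlam x); lra. Qed.

Lemma lift_derive_periodic : periodic (Derive g).
Proof.
intros x.
assert (is_derive (fun t => g (t + 1)) x (Derive g (x + 1))).
{ evar_last.
  - apply (is_derive_comp g (fun t => t + 1));
      [apply Derive_correct, smooth_ex_derive, lift_smooth|].
    apply (is_derive_plus (fun t => t) (fun _ => 1)); [apply is_derive_id|apply is_derive_const].
  - unfold scal, plus, one, zero; simpl; unfold mult; simpl; ring. }
assert (is_derive (fun t => g t + 1) x (Derive g x)).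
{ evar_last.
  - apply (is_derive_plus g (fun _ => 1));
      [apply Derive_correct, smooth_ex_derive, lift_smooth|apply is_derive_const].
  - unfold plus, zero; simpl; ring. }
rewrite <- (is_derive_unique _ _ _ H), <- (is_derive_unique _ _ _ H0).
apply Derive_ext; intros t; apply lift_shift.
Qed.

Lemma dE_periodic : periodic dE.
Proof. intros x; rewrite !dE_eq, lift_derive_periodic; reflexivity. Qed.

Lemma dE_smooth : smooth dE.
Proof.
intros n x; apply ex_derive_n_ext with (fun x => INR k * Derive g x).
- intros t; symmetry; apply dE_eq.
- apply ex_derive_n_scal_l, smooth_Derive, lift_smooth.
Qed.

Lemma dE_bounded : exists L, 1 < L /\ forall x, dE x <= L.
Proof.
destruct (periodic_bounded dE dE_periodic (smooth_rcont _ dE_smooth)) as [M [Mp HM]].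
exists (M + 1); split; [lra|]; intros x.
specialize (HM x); rewrite Rabs_pos_eq in HM by (left; apply dE_pos); lra.
Qed.

Lemma dE_lipschitz : exists B, 0 < B /\ forall x y, Rabs (dE x - dE y) <= B * Rabs (x - y).
Proof.
apply smooth_lipschitz; [apply dE_smooth|].
apply Derive_periodic; [apply dE_periodic|apply smooth_ex_derive, dE_smooth].
Qed.

Lemma expand_branch j x : expand k g (yb j x) = x + INR j.
Proof. unfold expand, branch; rewrite lift_K; field; apply Rgt_not_eq, k_pos. Qed.

Lemma branch_derive j x : is_derive (yb j) x (/ dE (yb j x)).
Proof.
assert (H : is_derive (yb j) x (/ INR k * Derive (lift_inv g) ((x + INR j) / INR k))).
{ evar_last.
  - apply (is_derive_comp (lift_inv g) (fun t => (t + INR j) / INR k)).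
    + apply Derive_correct, smooth_ex_derive, lift_inv_smooth.
    + auto_derive; [exact I|reflexivity].
  - unfold scal; simpl; unfold mult; simpl; field; apply Rgt_not_eq, k_pos. }
assert (K : is_derive (fun t => expand k g (yb j t)) x
   (dE (yb j x) * (/ INR k * Derive (lift_inv g) ((x + INR j) / INR k)))).
{ evar_last.
  - apply (is_derive_comp (expand k g) (yb j)); [|exact H].
    apply Derive_correct; eexists; apply expand_derive.
  - unfold scal; simpl; unfold mult; simpl; ring. }
assert (K' : is_derive (fun t => expand k g (yb j t)) x 1).
{ apply is_derive_ext with (fun t => t + INR j); [intros t; symmetry; apply expand_branch|].
  auto_derive; [exact I|ring]. }
assert (E : dE (yb j x) * (/ INR k * Derive (lift_inv g) ((x + INR j) / INR k)) = 1).
{ rewrite <- (is_derive_unique _ _ _ K); apply is_derive_unique, K'. }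
replace (/ dE (yb j x)) with (/ INR k * Derive (lift_inv g) ((x + INR j) / INR k)); [exact H|].
assert (P := dE_pos (yb j x)). apply (Rmult_eq_reg_l (dE (yb j x))); [|lra].
rewrite E; field; lra.
Qed.

Lemma branch_cont j : rcont (yb j).
Proof. intros x; apply (ex_derive_continuous (V := R_NormedModule)); eexists; apply branch_derive. Qed.

Lemma branch_contr j x y : Rabs (yb j x - yb j y) <= / lam * Rabs (x - y).
Proof.
apply (bounded_derive_lipschitz (yb j) (fun t => / dE (yb j t))); [apply branch_derive|].
intros t; rewrite Rabs_pos_eq.
- apply Rinv_le_contravar; [lra|apply hlam].
- left; apply Rinv_0_lt_compat, dE_pos.
Qed.

Lemma branch_contr1 j x y : Rabs (yb j x - yb j y) <= Rabs (x - y).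
Proof.
eapply Rle_trans; [apply branch_contr|].
rewrite <- (Rmult_1_l (Rabs (x - y))) at 2. apply Rmult_le_compat_r; [apply Rabs_pos|].
rewrite <- Rinv_1; apply Rinv_le_contravar; lra.
Qed.

(** The contraction rate of the branches for the distance [sqrt |x - y|]. *)
Definition theta : R := sqrt (/ lam).

Lemma theta_range : 0 < theta < 1.
Proof.
unfold theta; split.
- apply sqrt_lt_R0, Rinv_0_lt_compat; lra.
- rewrite <- sqrt_1; apply sqrt_lt_1_alt; split.
  + left; apply Rinv_0_lt_compat; lra.
  + rewrite <- Rinv_1; apply Rinv_lt_contravar; lra.
Qed.

Lemma branch_sqrt j x y : sqrt (Rabs (yb j x - yb j y)) <= theta * sqrt (Rabs (x - y)).
Proof.
unfold theta; rewrite <- sqrt_mult; [apply sqrt_le_1_alt, branch_contr| |apply Rabs_pos].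
left; apply Rinv_0_lt_compat; lra.
Qed.

Lemma branch_shift j x : yb j (x + 1) = yb (S j) x.
Proof. unfold branch; rewrite S_INR; f_equal; f_equal; ring. Qed.

Lemma branch_wrap x : yb k x = yb 0 x + 1.
Proof.
unfold branch; rewrite <- (lift_inv_shift g 1); f_equal; simpl; field.
apply Rgt_not_eq, k_pos.
Qed.

Lemma rsum_branch_periodic f : periodic f -> periodic (fun x => rsum (fun j => f (yb j x)) k).
Proof.
intros P x.
assert (E := rsum_shift (fun j => f (yb j x)) k); cbn [rsum] in E.
rewrite branch_wrap, P in E.
rewrite (rsum_ext _ (fun j => f (yb (S j) x))); [lra|].
intros; rewrite branch_shift; reflexivity.
Qed.

Lemma csum_branch_periodic (f : R -> C) :
  periodic f -> periodic (fun x => csum (fun j => f (yb j x)) k).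
Proof.
intros P x.
assert (E := csum_shift (fun j => f (yb j x)) k); cbn [csum] in E.
rewrite branch_wrap, P in E.
rewrite (csum_ext _ (fun j => f (yb (S j) x))).
- set (A := csum (fun j => f (yb (S j) x)) k) in *; set (B := csum (fun j => f (yb j x)) k) in *.
  set (w := f (yb 0 x)) in *.
  replace A with (Cminus (Cplus w A) w) by ring. rewrite <- E; ring.
- intros; rewrite branch_shift; reflexivity.
Qed.

(** * The Ruelle operator on real functions *)

(** The density of the image, under the expanding map, of the measure with
    density [f]. *)
Definition ruelle (f : R -> R) (x : R) : R := rsum (fun j => / dE (yb j x) * f (yb j x)) k.

Lemma ruelle_ext f f' : (forall x, f x = f' x) -> forall x, ruelle f x = ruelle f' x.
Proof. intros H x; apply rsum_ext; intros; rewrite H; reflexivity. Qed.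

Lemma weight_pos y : 0 < / dE y.
Proof. apply Rinv_0_lt_compat, dE_pos. Qed.

Lemma ruelle_le f f' : (forall x, f x <= f' x) -> forall x, ruelle f x <= ruelle f' x.
Proof.
intros H x; apply rsum_le; intros; apply Rmult_le_compat_l; [left; apply weight_pos|apply H].
Qed.

Lemma ruelle_periodic f : periodic f -> periodic (ruelle f).
Proof.
intros P; apply (rsum_branch_periodic (fun y => / dE y * f y)).
intros x; rewrite P, dE_periodic; reflexivity.
Qed.

Lemma ruelle_cont f : rcont f -> rcont (ruelle f).
Proof.
intros H; apply (rcont_rsum (fun j x => / dE (yb j x) * f (yb j x))); intros j _.
apply rcont_mult.
- apply (rcont_comp (fun y => / dE y)); [|apply branch_cont].
  apply rcont_inv; [apply smooth_rcont, dE_smooth|intros y; apply Rgt_not_eq, dE_pos].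
- apply rcont_comp; [assumption|apply branch_cont].
Qed.

Lemma ruelle_plus f f' x : ruelle (fun y => f y + f' y) x = ruelle f x + ruelle f' x.
Proof. unfold ruelle; rewrite <- rsum_plus; apply rsum_ext; intros; ring. Qed.

Lemma ruelle_scal a f x : ruelle (fun y => a * f y) x = a * ruelle f x.
Proof. unfold ruelle; rewrite <- rsum_scal; apply rsum_ext; intros; ring. Qed.

(** The branches tile a fundamental domain, and [1 / E'] is their Jacobian. *)
Lemma RInt_ruelle f : periodic f -> rcont f -> RInt (ruelle f) 0 1 = RInt f 0 1.
Proof.
intros P H.
assert (wc : rcont (fun y => / dE y)).
{ apply rcont_inv; [apply smooth_rcont, dE_smooth|intros y; apply Rgt_not_eq, dE_pos]. }
unfold ruelle; rewrite RInt_rsum.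
2:{ intros j _; apply (rcont_mult (fun x => / dE (yb j x)) (fun x => f (yb j x))).
    - apply (rcont_comp (fun y => / dE y)); [exact wc|apply branch_cont].
    - apply rcont_comp; [assumption|apply branch_cont]. }
assert (B : forall j, RInt (fun x => / dE (yb j x) * f (yb j x)) 0 1 = RInt f (yb j 0) (yb (S j) 0)).
{ intros j. rewrite <- branch_shift, Rplus_0_l.
  apply (RInt_comp f (yb j) (fun x => / dE (yb j x))).
  - intros; apply H.
  - intros x _; split; [apply branch_derive|].
    apply (rcont_comp (fun y => / dE y)); [exact wc|apply branch_cont]. }
rewrite (rsum_ext _ (fun j => RInt f (yb j 0) (yb (S j) 0))) by (intros; apply B).
assert (T : forall n, rsum (fun j => RInt f (yb j 0) (yb (S j) 0)) n = RInt f (yb 0 0) (yb n 0)).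
{ induction n as [|n IH]; cbn [rsum]; [rewrite RInt_point; reflexivity|].
  rewrite IH; apply (RInt_Chasles f); apply ex_RInt_rcont, H. }
rewrite T, branch_wrap; apply RInt_periodic; assumption.
Qed.

(** ** A contracted cone of densities *)

(** Logarithms that are Hoelder of exponent 1/2 with constant [A]. Restricting to
    [|x - x'| <= 1] loses nothing by periodicity and makes Lipschitz bounds
    imply Hoelder ones. *)
Definition log_holder_cone (A : R) (f : R -> R) : Prop :=
  periodic f /\ (forall x, 0 < f x) /\
  forall x x', Rabs (x - x') <= 1 -> f x <= f x' * exp (A * sqrt (Rabs (x - x'))).

Lemma exp_le x y : x <= y -> exp x <= exp y.
Proof. intros [h| ->]; [left; apply exp_increasing, h|right; reflexivity]. Qed.

Lemma sqrt_le_1_of d : d <= 1 -> sqrt d <= 1.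
Proof. intros h; rewrite <- sqrt_1; apply sqrt_le_1_alt, h. Qed.

Lemma le_sqrt_of d : 0 <= d <= 1 -> d <= sqrt d.
Proof.
intros h; rewrite <- (sqrt_sqrt d) at 1 by lra.
assert (a := sqrt_le_1_of d (proj2 h)); assert (b := sqrt_pos d); nra.
Qed.

Lemma cone_mono A A' f : A <= A' -> log_holder_cone A f -> log_holder_cone A' f.
Proof.
intros h (P & p & H); repeat split; auto; intros x x' hx.
eapply Rle_trans; [apply H, hx|]; apply Rmult_le_compat_l; [left; apply p|].
apply exp_le, Rmult_le_compat_r; [apply sqrt_pos|assumption].
Qed.

Lemma cone_near A f x x' : 0 <= A -> log_holder_cone A f -> Rabs (x - x') <= 1 -> f x <= f x' * exp A.
Proof.
intros hA (P & p & H) h; eapply Rle_trans; [apply H, h|].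
apply Rmult_le_compat_l; [left; apply p|]; apply exp_le.
generalize (sqrt_le_1_of _ h) (sqrt_pos (Rabs (x - x'))); nra.
Qed.

Lemma cone_far A f x x' : 0 <= A -> log_holder_cone A f -> f x <= f x' * exp A.
Proof.
intros hA Hf; destruct (periodic_near f (proj1 Hf) x' x) as [y [hy <-]].
apply (cone_near A); auto; apply Rabs_le; lra.
Qed.

Lemma cone_cont A f : 0 <= A -> log_holder_cone A f -> rcont f.
Proof.
intros hA Hf x; apply filterlim_locally; intros eps.
assert (Hf' := Hf); destruct Hf' as (P & p & H).
set (F := f 0 * exp A).
assert (Fp : 0 < F) by (apply Rmult_lt_0_compat; [apply p|apply exp_pos]).
assert (HF : forall y, f y <= F) by (intros; apply cone_far; assumption).
set (e := eps / F).
assert (ep : 0 < e) by (apply Rdiv_lt_0_compat; [apply cond_pos|assumption]).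
set (c := ln (1 + e) / (A + 1)).
assert (lp : 0 < ln (1 + e)) by (rewrite <- ln_1; apply ln_increasing; lra).
assert (cp : 0 < c) by (apply Rdiv_lt_0_compat; lra).
assert (dp : 0 < Rmin 1 (c ^ 2)) by (apply Rmin_pos; [lra|apply pow_lt, cp]).
exists (mkposreal _ dp); intros y hy; change (Rabs (y - x) < Rmin 1 (c ^ 2)) in hy.
assert (h1 : Rabs (y - x) <= 1) by (left; eapply Rlt_le_trans; [exact hy|apply Rmin_l]).
assert (h2 : sqrt (Rabs (y - x)) < c).
{ rewrite <- (sqrt_pow2 c) by lra. apply sqrt_lt_1_alt; split; [apply Rabs_pos|].
  eapply Rlt_le_trans; [exact hy|apply Rmin_r]. }
set (r := sqrt (Rabs (y - x))) in *.
assert (r0 : 0 <= r) by apply sqrt_pos.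
assert (ex : exp (A * r) < 1 + e).
{ rewrite <- (exp_ln (1 + e)) by lra. apply exp_increasing.
  replace (ln (1 + e)) with ((A + 1) * c) by (unfold c; field; lra). nra. }
assert (e1 : 1 <= exp (A * r)) by (rewrite <- exp_0; apply exp_le; nra).
assert (G1 := H y x h1). fold r in G1.
assert (G2 := H x y). rewrite (Rabs_minus_sym x y) in G2; specialize (G2 h1); fold r in G2.
assert (Fe : F * e = eps) by (unfold e; field; lra).
assert (Hy := HF y); assert (Hx := HF x); assert (py := p y); assert (px := p x).
change (Rabs (f y - f x) < eps); apply Rabs_def1; nra.
Qed.

Lemma cone_bounds A f : 0 <= A -> log_holder_cone A f -> RInt f 0 1 = 1 ->
  forall x, exp (- A) <= f x <= exp A.
Proof.
intros hA Hf I x; assert (c := cone_cont A f hA Hf).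
assert (eA := exp_pos A).
split.
- assert (RInt f 0 1 <= RInt (fun _ => f x * exp A) 0 1).
  { apply RInt_le_r; [lra|assumption|apply rcont_const|intros; apply cone_far; assumption]. }
  rewrite RInt_const_r, I in H. rewrite exp_Ropp.
  apply (Rmult_le_reg_r (exp A)); [assumption|]. rewrite Rinv_l; lra.
- assert (RInt (fun _ => f x * exp (- A)) 0 1 <= RInt f 0 1).
  { apply RInt_le_r; [lra|apply rcont_const|assumption|].
    intros t; apply (Rmult_le_reg_r (exp A)); [assumption|].
    rewrite Rmult_assoc, <- exp_plus, Rplus_opp_l, exp_0, Rmult_1_r; apply cone_far; assumption. }
  rewrite RInt_const_r, I, exp_Ropp in H.
  apply (Rmult_le_reg_r (/ exp A)); [apply Rinv_0_lt_compat, eA|]. rewrite Rinv_r; lra.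
Qed.

Lemma cone_scal A f c : 0 < c -> log_holder_cone A f -> log_holder_cone A (fun x => c * f x).
Proof.
intros hc (P & p & H); repeat split.
- intros x; rewrite P; reflexivity.
- intros x; apply Rmult_lt_0_compat; auto.
- intros x x' h; rewrite Rmult_assoc; apply Rmult_le_compat_l; [lra|auto].
Qed.

Lemma exp_convex s t : 0 <= s <= 1 -> exp (s * t) <= s * exp t + (1 - s).
Proof.
intros hs.
assert (E1 : 1 + (1 - s) * t <= exp ((1 - s) * t)) by apply exp_ineq1_le.
assert (E2 : 1 + - (s * t) <= exp (- (s * t))) by apply exp_ineq1_le.
assert (P := exp_pos (s * t)).
assert (E3 : exp t = exp (s * t) * exp ((1 - s) * t)) by (rewrite <- exp_plus; f_equal; ring).
assert (E4 : 1 = exp (s * t) * exp (- (s * t))) by (rewrite <- exp_plus, Rplus_opp_r, exp_0; ring).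
apply Rle_trans with (s * (exp (s * t) * exp ((1 - s) * t)) + (1 - s) * (exp (s * t) * exp (- (s * t)))).
- apply Rle_trans with (exp (s * t) * (s * (1 + (1 - s) * t) + (1 - s) * (1 + - (s * t)))).
  + right; ring.
  + replace (s * (exp (s * t) * exp ((1 - s) * t)) + (1 - s) * (exp (s * t) * exp (- (s * t))))
     with (exp (s * t) * (s * exp ((1 - s) * t) + (1 - s) * exp (- (s * t)))) by ring.
    apply Rmult_le_compat_l; [lra|]. apply Rplus_le_compat; apply Rmult_le_compat_l; lra.
- rewrite <- E3, <- E4; lra.
Qed.

(** Since [exp (s A r) <= s exp (A r) + (1 - s)], the gap between the constants
    [s A] and [A] leaves room for subtracting a fraction of the minimum. *)
Lemma cone_minus_const A s f c : 0 < A -> 0 <= s < 1 -> log_holder_cone (s * A) f ->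
  0 < c -> (forall x, c <= (1 - s) * f x) -> (forall x, c < f x) -> log_holder_cone A (fun x => f x - c).
Proof.
intros hA hs (P & p & H) hc B B'; repeat split.
- intros x; rewrite P; reflexivity.
- intros x; specialize (B' x); lra.
- intros x x' h; specialize (H x x' h).
  set (r := sqrt (Rabs (x - x'))) in *; assert (r0 : 0 <= r) by apply sqrt_pos.
  assert (C := exp_convex s (A * r) ltac:(lra)).
  rewrite Rmult_assoc in H.
  assert (e1 : 1 <= exp (A * r)) by (rewrite <- exp_0; apply exp_le; nra).
  assert (H' : f x <= f x' * (s * exp (A * r) + (1 - s))).
  { eapply Rle_trans; [exact H|]; apply Rmult_le_compat_l; [left; apply p|exact C]. }
  specialize (B x').
  assert (0 <= ((1 - s) * f x' - c) * (exp (A * r) - 1)) by (apply Rmult_le_pos; lra).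
  lra.
Qed.

(** The branches contract [sqrt |x - x'|] by [theta], and the logarithm of the
    weight [1 / E'] is Lipschitz. *)
Lemma ruelle_cone A B f : 0 <= A -> 0 <= B -> (forall x y, Rabs (dE x - dE y) <= B * Rabs (x - y)) ->
  log_holder_cone A f -> log_holder_cone (theta * A + B) (ruelle f).
Proof.
intros hA hB HB (P & p & H); repeat split.
- apply ruelle_periodic, P.
- intros x; apply Rlt_le_trans with (/ dE (yb 0 x) * f (yb 0 x)).
  + apply Rmult_lt_0_compat; [apply weight_pos|apply p].
  + apply (rsum_term_le (fun j => / dE (yb j x) * f (yb j x)) k 0); [|lia].
    intros j _; apply Rmult_le_pos; [left; apply weight_pos|left; apply p].
- intros x x' h; unfold ruelle; rewrite Rmult_comm, <- rsum_scal; apply rsum_le; intros j _.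
  set (r := sqrt (Rabs (x - x'))); assert (r0 : 0 <= r) by apply sqrt_pos.
  set (y := yb j x); set (y' := yb j x').
  assert (hy : Rabs (y - y') <= Rabs (x - x')) by apply branch_contr1.
  assert (hy1 : Rabs (y - y') <= 1) by lra.
  assert (F : f y <= f y' * exp (theta * A * r)).
  { eapply Rle_trans; [apply H, hy1|]; apply Rmult_le_compat_l; [left; apply p|].
    apply exp_le. assert (K := branch_sqrt j x x'); fold y y' r in K. nra. }
  assert (W : / dE y <= / dE y' * exp (B * r)).
  { assert (dy := dE_pos y); assert (dy' := dE_pos y').
    assert (D : dE y' <= dE y * exp (B * r)).
    { assert (K := HB y' y). apply Rabs_le_between in K.
      assert (K2 : Rabs (y' - y) <= r).
      { rewrite Rabs_minus_sym. eapply Rle_trans; [exact hy|].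
        apply le_sqrt_of; split; [apply Rabs_pos|exact h]. }
      assert (E := exp_ineq1_le (B * r)).
      assert (L := hlam y).
      assert (B * Rabs (y' - y) <= B * r) by (apply Rmult_le_compat_l; assumption).
      assert (0 <= B * r) by (apply Rmult_le_pos; assumption). nra. }
    apply (Rmult_le_reg_l (dE y)); [assumption|]; rewrite Rinv_r by lra.
    apply (Rmult_le_reg_l (dE y')); [assumption|].
    replace (dE y' * (dE y * (/ dE y' * exp (B * r)))) with (dE y * exp (B * r)) by (field; lra).
    lra. }
  replace ((theta * A + B) * r) with (B * r + theta * A * r) by ring. rewrite exp_plus.
  replace (exp (B * r) * exp (theta * A * r) * (/ dE y' * f y'))
    with ((/ dE y' * exp (B * r)) * (f y' * exp (theta * A * r))) by ring.
  apply Rmult_le_compat; auto; [left; apply weight_pos|left; apply p].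
Qed.

Notation M0n n f := (Nat.iter n ruelle f).

Lemma ruelle_iter_swap n f : M0n n (ruelle f) = M0n (S n) f.
Proof. induction n as [|n IH]; [reflexivity|]. simpl; rewrite IH; reflexivity. Qed.

Lemma ruelle_lin a b f f' : ruelle (fun y => a * f y + b * f' y) = fun x => a * ruelle f x + b * ruelle f' x.
Proof.
apply functional_extensionality; intros x.
rewrite (ruelle_plus (fun y => a * f y) (fun y => b * f' y)), !ruelle_scal; reflexivity.
Qed.

Lemma ruelle_iter_lin n a b f f' x :
  M0n n (fun y => a * f y + b * f' y) x = a * M0n n f x + b * M0n n f' x.
Proof.
revert a b f f' x; induction n as [|n IH]; intros; [reflexivity|].
rewrite <- !ruelle_iter_swap, ruelle_lin; apply IH.
Qed.

Lemma ruelle_lim (F : nat -> R -> R) (f : R -> R) x : (forall y, is_lim_seq (fun n => F n y) (f y)) ->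
  is_lim_seq (fun n => ruelle (F n) x) (ruelle f x).
Proof.
intros H; apply (is_lim_seq_rsum (fun n j => / dE (yb j x) * F n (yb j x))); intros j.
apply (is_lim_seq_scal_l _ (/ dE (yb j x)) (Finite _)), H.
Qed.

(** A coupling argument. After one step, densities in the cone exceed a fixed
    multiple [q] of the uniform density; removing it and rescaling leaves
    densities in the cone, so the distance between the images of two densities
    decreases by the factor [1 - q] at each step. *)
Theorem ruelle_perron_frobenius : exists (A c C : R) (h : R -> R),
  0 < A /\ 0 <= c < 1 /\ 0 <= C /\ log_holder_cone A h /\ RInt h 0 1 = 1 /\ (forall x, ruelle h x = h x) /\
  forall f, log_holder_cone A f -> RInt f 0 1 = 1 ->
    forall n x, Rabs (M0n n f x - h x) <= C * c ^ n.
Proof.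
destruct dE_lipschitz as [B [Bp HB]].
assert (th := theta_range).
set (A := 2 * B / (1 - theta)).
assert (Ap : 0 < A) by (apply Rdiv_lt_0_compat; lra).
set (s := (1 + theta) / 2).
assert (hs : 0 <= s < 1) by (unfold s; lra).
assert (sA : theta * A + B = s * A) by (unfold s, A; field; lra).
assert (Hc : forall f, log_holder_cone A f -> log_holder_cone (s * A) (ruelle f)).
{ intros f Hf; rewrite <- sA; apply ruelle_cone; auto; lra. }
assert (sA' : s * A <= A) by nra.
assert (Hc' : forall f, log_holder_cone A f -> log_holder_cone A (ruelle f)).
{ intros f Hf; apply (cone_mono (s * A)); auto. }
(* Densities in the cone are at least [exp (- A)]; the factor [1 - s] is the
   fraction of the minimum that may be subtracted. *)
set (q := (1 - s) * exp (- A) / 2).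
assert (eA := exp_pos (- A)).
assert (eA1 : exp (- A) < 1) by (rewrite <- exp_0; apply exp_increasing; lra).
assert (hq : 0 < q < 1) by (unfold q; nra).
assert (mass : forall f, log_holder_cone A f -> RInt f 0 1 = 1 -> RInt (ruelle f) 0 1 = 1).
{ intros f Hf I; rewrite RInt_ruelle; [exact I|apply Hf|apply (cone_cont A); auto; lra]. }
assert (key : forall n f f', log_holder_cone A f -> RInt f 0 1 = 1 -> log_holder_cone A f' -> RInt f' 0 1 = 1 ->
  forall x, Rabs (M0n (S n) f x - M0n (S n) f' x) <= exp A * (1 - q) ^ n).
{ induction n as [|n IH]; intros f f' Hf If Hf' If' x.
  - assert (B1 := cone_bounds A _ ltac:(lra) (Hc' f Hf) (mass f Hf If) x).
    assert (B2 := cone_bounds A _ ltac:(lra) (Hc' f' Hf') (mass f' Hf' If') x).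
    simpl; apply Rabs_le; lra.
  - assert (dec : forall f, log_holder_cone A f -> RInt f 0 1 = 1 ->
      exists u, log_holder_cone A u /\ RInt u 0 1 = 1 /\ ruelle f = fun x => q * 1 + (1 - q) * u x).
    { clear f f' Hf If Hf' If'; intros f Hf If.
      assert (Hm := mass f Hf If); assert (Bd := cone_bounds A _ ltac:(lra) (Hc' f Hf) Hm).
      assert (Cc := cone_cont A _ ltac:(lra) (Hc' f Hf)).
      exists (fun x => / (1 - q) * (ruelle f x - q)); repeat split.
      - apply (cone_scal A (fun x => ruelle f x - q)); [apply Rinv_0_lt_compat; lra|].
        apply (cone_minus_const A s); auto; [lra| |].
        + intros t; specialize (Bd t); unfold q. nra.
        + intros t; specialize (Bd t); unfold q. nra.
      - intros t; apply Rmult_lt_0_compat; [apply Rinv_0_lt_compat; lra|].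
        specialize (Bd t); unfold q; nra.
      - apply (cone_scal A (fun x => ruelle f x - q)); [apply Rinv_0_lt_compat; lra|].
        apply (cone_minus_const A s); auto; [lra| |].
        + intros t; specialize (Bd t); unfold q. nra.
        + intros t; specialize (Bd t); unfold q. nra.
      - rewrite RInt_scal_r, RInt_minus_r, RInt_const_r, Hm; auto using rcont_const, rcont_minus.
        eqR; field; lra.
      - apply functional_extensionality; intros t; field; lra. }
    destruct (dec f Hf If) as [u [Hu [Iu Eu]]]; destruct (dec f' Hf' If') as [u' [Hu' [Iu' Eu']]].
    rewrite <- !(ruelle_iter_swap (S n)), Eu, Eu'.
    rewrite (ruelle_iter_lin (S n) q (1 - q) (fun _ => 1) u x), (ruelle_iter_lin (S n) q (1 - q) (fun _ => 1) u' x).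
    replace (q * M0n (S n) (fun _ => 1) x + (1 - q) * M0n (S n) u x -
      (q * M0n (S n) (fun _ => 1) x + (1 - q) * M0n (S n) u' x))
      with ((1 - q) * (M0n (S n) u x - M0n (S n) u' x)) by ring.
    rewrite Rabs_mult, Rabs_pos_eq by lra.
    specialize (IH u u' Hu Iu Hu' Iu' x).
    replace (exp A * (1 - q) ^ S n) with ((1 - q) * (exp A * (1 - q) ^ n)) by (simpl; ring).
    apply Rmult_le_compat_l; [lra|exact IH]. }
assert (cone1 : log_holder_cone A (fun _ => 1)).
{ repeat split; [intros; lra|]; intros x x' _; rewrite Rmult_1_l, <- exp_0.
  apply exp_le, Rmult_le_pos; [lra|apply sqrt_pos]. }
assert (I1 : RInt (fun _ => 1) 0 1 = 1) by (rewrite RInt_const_r; eqR; ring).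
assert (it : forall n f, log_holder_cone A f -> RInt f 0 1 = 1 -> log_holder_cone A (M0n n f) /\ RInt (M0n n f) 0 1 = 1).
{ intros n f Hf If; induction n as [|n [IH1 IH2]]; [split; assumption|].
  split; [apply Hc', IH1|apply mass; assumption]. }
assert (q0 : forall n, 0 <= (1 - q) ^ n) by (intros; apply pow_le; lra).
assert (qlim : is_lim_seq (fun n => exp A * (1 - q) ^ n) 0).
{ replace (Finite 0) with (Rbar_mult (exp A) 0) by (simpl; f_equal; ring).
  apply (is_lim_seq_scal_l _ (exp A) (Finite 0)), is_lim_seq_geom. rewrite Rabs_pos_eq; lra. }
assert (cau : forall x, exists l : R, is_lim_seq (fun n => M0n (S n) (fun _ => 1) x) l).
{ intros x; apply ex_lim_seq_cauchy_corr; intros eps.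
  apply is_lim_seq_spec in qlim; destruct (qlim eps) as [N HN].
  assert (G : forall n p, (N <= n)%nat ->
    Rabs (M0n (S (n + p)) (fun _ => 1) x - M0n (S n) (fun _ => 1) x) < eps).
  { intros n p hn; specialize (HN n hn); rewrite Rminus_0_r in HN.
    rewrite Rabs_pos_eq in HN by (apply Rmult_le_pos; [left; apply exp_pos|apply q0]).
    eapply Rle_lt_trans; [|exact HN].
    replace (S (n + p)) with (S n + p)%nat by lia. rewrite Nat.iter_add.
    destruct (it p _ cone1 I1); apply key; assumption. }
  exists N; intros n p hn hp; destruct (Nat.le_ge_cases n p) as [h|h].
  - rewrite Rabs_minus_sym; replace p with (n + (p - n))%nat by lia; apply G, hn.
  - replace n with (p + (n - p))%nat by lia; apply G, hp. }
set (h := fun x => real (Lim_seq (fun n => M0n (S n) (fun _ => 1) x))).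
assert (hlim : forall x, is_lim_seq (fun n => M0n (S n) (fun _ => 1) x) (h x)).
{ intros x; destruct (cau x) as [l Hl]; unfold h; rewrite (is_lim_seq_unique _ _ Hl); exact Hl. }
assert (hM : forall x, ruelle h x = h x).
{ intros x.
  assert (L1 := ruelle_lim (fun n => M0n (S n) (fun _ => 1)) h x hlim).
  assert (L2 := proj1 (is_lim_seq_incr_1 _ _) (hlim x)).
  apply is_lim_seq_unique in L1; apply is_lim_seq_unique in L2.
  change (fun n => ruelle (M0n (S n) (fun _ => 1)) x) with (fun n => M0n (S (S n)) (fun _ => 1) x) in L1.
  rewrite L1 in L2; injection L2; auto. }
assert (hb : forall x, exp (- A) <= h x).
{ intros x; apply (is_lim_seq_le (fun _ => exp (- A)) (fun n => M0n (S n) (fun _ => 1) x) (exp (- A)) (h x)).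
  - intros n; destruct (it (S n) _ cone1 I1) as [c1 c2]; apply (cone_bounds A _ ltac:(lra) c1 c2).
  - apply is_lim_seq_const.
  - apply hlim. }
assert (hcone : log_holder_cone A h).
{ repeat split.
  - intros x; unfold h; f_equal; apply Lim_seq_ext; intros n.
    destruct (it (S n) _ cone1 I1) as [c1 _]; apply c1.
  - intros x; specialize (hb x); lra.
  - intros x x' hx.
    apply (is_lim_seq_le (fun n => M0n (S n) (fun _ => 1) x)
      (fun n => M0n (S n) (fun _ => 1) x' * exp (A * sqrt (Rabs (x - x')))) (h x)
      (h x' * exp (A * sqrt (Rabs (x - x'))))).
    + intros n; destruct (it (S n) _ cone1 I1) as [c1 _]; apply c1, hx.
    + apply hlim.
    + apply (is_lim_seq_scal_r _ _ (Finite _)), hlim. }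
assert (unif : forall n x, Rabs (M0n (S n) (fun _ => 1) x - h x) <= exp A * (1 - q) ^ n).
{ intros n x.
  apply (is_lim_seq_le (fun p => Rabs (M0n (S n) (fun _ => 1) x - M0n (S (p + n)) (fun _ => 1) x))
   (fun _ => exp A * (1 - q) ^ n) (Rabs (M0n (S n) (fun _ => 1) x - h x)) (exp A * (1 - q) ^ n)).
  - intros p; replace (S (p + n)) with (S n + p)%nat by lia. rewrite Nat.iter_add.
    destruct (it p _ cone1 I1); apply key; assumption.
  - apply (is_lim_seq_abs _ (Finite _)). apply is_lim_seq_minus'; [apply is_lim_seq_const|].
    apply (is_lim_seq_incr_n (fun p => M0n (S p) (fun _ => 1) x) n), hlim.
  - apply is_lim_seq_const. }
assert (hI : RInt h 0 1 = 1).
{ assert (hcont := cone_cont A h ltac:(lra) hcone).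
  assert (G : forall n, Rabs (RInt h 0 1 - 1) <= exp A * (1 - q) ^ n).
  { intros n; destruct (it (S n) _ cone1 I1) as [c1 c2].
    assert (cc := cone_cont A _ ltac:(lra) c1).
    replace (RInt h 0 1 - 1) with (RInt (fun t => h t - M0n (S n) (fun _ => 1) t) 0 1)
      by (rewrite RInt_minus_r, c2 by assumption; reflexivity).
    replace (exp A * (1 - q) ^ n) with ((1 - 0) * (exp A * (1 - q) ^ n)) by ring.
    apply abs_RInt_le_const; [lra|apply ex_RInt_rcont, rcont_minus; assumption|].
    intros t _; rewrite Rabs_minus_sym; apply unif. }
  assert (L : Rabs (RInt h 0 1 - 1) <= 0).
  { apply (is_lim_seq_le (fun _ => Rabs (RInt h 0 1 - 1)) _ (Rabs (RInt h 0 1 - 1)) 0 G);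
    [apply is_lim_seq_const|exact qlim]. }
  apply Rabs_le_between in L; lra. }
assert (hn : forall n, M0n n h = h).
{ induction n as [|n IH]; [reflexivity|]; simpl; rewrite IH.
  apply functional_extensionality, hM. }
exists A, (1 - q), (exp A / (1 - q)), h; repeat split; auto; try lra; try (apply hcone).
- left; apply Rdiv_lt_0_compat; [apply exp_pos|lra].
- intros f Hf If n x. destruct n as [|n].
  + simpl. rewrite Rmult_1_r.
    assert (B1 := cone_bounds A f ltac:(lra) Hf If x).
    assert (B2 := cone_bounds A h ltac:(lra) hcone hI x).
    assert (exp A <= exp A / (1 - q)).
    { apply (Rmult_le_reg_r (1 - q)); [lra|].
      replace (exp A / (1 - q) * (1 - q)) with (exp A) by (field; lra).
      generalize (exp_pos A); nra. }
    apply Rabs_le; lra.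
  + replace (exp A / (1 - q) * (1 - q) ^ S n) with (exp A * (1 - q) ^ n) by (simpl; field; lra).
    replace (h x) with (M0n (S n) h x) by (rewrite hn; reflexivity).
    apply key; assumption.
Qed.

End Dynamics.

Arguments ruelle : clear implicits.
Arguments theta : clear implicits.

Section Transfer.

Context {k : nat} {g : circle_diffeo} {lam : R} {Hexp : expanding k g lam}.
Let hk : (2 <= k)%nat := expanding_degree.
Let lam1 : 1 < lam := expanding_gt1.
Let hlam : forall x, lam <= Derive (expand k g) x := expanding_le.

Notation dE := (Derive (expand k g)).
Notation yb := (branch k g).
Notation M0 := (ruelle k g).

(** * Sums over inverse branches of smooth functions *)

Definition branch_sum (q : R -> C) (x : R) : C := csum (fun j => q (yb j x)) k.

Definition inv_expansion (y : R) : C := RtoC (/ dE y).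

Lemma Cmod_inv_expansion y : Cmod (inv_expansion y) = / dE y.
Proof. unfold inv_expansion; rewrite Cmod_R; apply Rabs_pos_eq; left; apply weight_pos. Qed.

Lemma csmooth_inv_expansion : csmooth inv_expansion.
Proof.
split.
- intros y; unfold inv_expansion; rewrite dE_periodic; reflexivity.
- intros n; apply ncd_Rinv; [intros x; apply Rgt_not_eq, dE_pos|apply ncd_RtoC, dE_smooth].
Qed.

Lemma branch_sum_cder q : cdiff q ->
  forall x, is_cder (branch_sum q) x (branch_sum (fun y => Cmult (inv_expansion y) (cD q y)) x).
Proof.
intros H x; apply (is_cder_csum (fun j x => q (yb j x))); intros j _.
apply is_cder_comp; [apply H|apply branch_derive].
Qed.

Lemma branch_sum_ncd n q : ncd n q -> ncd n (branch_sum q).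
Proof.
revert q; induction n as [|n IH]; intros q H; [exact I|].
apply ncd_intro with (branch_sum (fun y => Cmult (inv_expansion y) (cD q y))).
- apply branch_sum_cder, H.
- apply IH, ncd_mult; [apply csmooth_inv_expansion|apply H].
Qed.

Lemma csmooth_branch_sum q : csmooth q -> csmooth (branch_sum q).
Proof.
intros [P H]; split; [apply csum_branch_periodic, P|intros n; apply branch_sum_ncd, H].
Qed.

Lemma branch_sum_cD q : csmooth q -> cD (branch_sum q) = branch_sum (fun y => Cmult (inv_expansion y) (cD q y)).
Proof. intros H; apply cdiff_intro, branch_sum_cder, csmooth_cdiff, H. Qed.

Lemma branch_sum_plus q q' x : branch_sum (fun y => Cplus (q y) (q' y)) x = Cplus (branch_sum q x) (branch_sum q' x).
Proof. apply csum_plus. Qed.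

Lemma branch_sum_cont q : ccont q -> ccont (branch_sum q).
Proof.
intros H; apply (ccont_csum (fun j x => q (yb j x))); intros j _.
apply ccont_comp; [assumption|apply branch_cont].
Qed.

Lemma Cmod_branch_sum q x : Cmod (branch_sum q x) <= rsum (fun j => Cmod (q (yb j x))) k.
Proof. apply csum_mod. Qed.

(** Operators that differentiate fewer than [i] times before summing over
    branches: the remainders in the commutation with derivatives. *)
Inductive lower (i : nat) : ((R -> C) -> R -> C) -> Prop :=
| lower_zero : lower i (fun _ _ => RtoC 0)
| lower_term c j : csmooth c -> (j < i)%nat ->
    lower i (fun f => branch_sum (fun y => Cmult (c y) (cDn j f y)))
| lower_plus O O' : lower i O -> lower i O' -> lower i (fun f x => Cplus (O f x) (O' f x)).

Lemma lower_csm i O : lower i O -> forall f, csmooth f -> csmooth (O f).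
Proof.
induction 1; intros f Hf.
- apply csmooth_const.
- apply csmooth_branch_sum, csmooth_mult; [assumption|apply csmooth_cDn, Hf].
- apply csmooth_plus; auto.
Qed.

Lemma cD_mult f f' : csmooth f -> csmooth f' -> cD (fun x => Cmult (f x) (f' x)) =
  fun x => Cplus (Cmult (cD f x) (f' x)) (Cmult (f x) (cD f' x)).
Proof.
intros H H'; apply cdiff_intro; intros x; apply is_cder_mult; apply csmooth_cdiff; assumption.
Qed.

Lemma branch_sum_term_cD c f : csmooth c -> csmooth f ->
  cD (branch_sum (fun y => Cmult (c y) (f y))) = fun x =>
    Cplus (branch_sum (fun y => Cmult (Cmult (c y) (inv_expansion y)) (cD f y)) x)
          (branch_sum (fun y => Cmult (Cmult (inv_expansion y) (cD c y)) (f y)) x).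
Proof.
intros Hc Hf; rewrite branch_sum_cD by (apply csmooth_mult; assumption).
rewrite cD_mult by assumption.
apply functional_extensionality; intros x; rewrite <- branch_sum_plus.
apply csum_ext; intros; ring.
Qed.

Lemma lower_cD i O : lower i O ->
  exists O', lower (S i) O' /\ forall f, csmooth f -> cD (O f) = O' f.
Proof.
induction 1 as [|c j Hc hj|O1 O2 H1 [O1' [L1 E1]] H2 [O2' [L2 E2]]].
- exists (fun _ _ => RtoC 0); split; [apply lower_zero|]; intros f _.
  apply cdiff_intro; intros x; apply is_cder_const.
- exists (fun f x => Cplus (branch_sum (fun y => Cmult (Cmult (c y) (inv_expansion y)) (cDn (S j) f y)) x)
    (branch_sum (fun y => Cmult (Cmult (inv_expansion y) (cD c y)) (cDn j f y)) x)); split.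
  + apply (lower_plus (S i) (fun f => branch_sum (fun y => Cmult (Cmult (c y) (inv_expansion y)) (cDn (S j) f y)))
      (fun f => branch_sum (fun y => Cmult (Cmult (inv_expansion y) (cD c y)) (cDn j f y)))).
    * apply (lower_term (S i) (fun y => Cmult (c y) (inv_expansion y)) (S j)); [|lia].
      apply csmooth_mult; [assumption|apply csmooth_inv_expansion].
    * apply (lower_term (S i) (fun y => Cmult (inv_expansion y) (cD c y)) j); [|lia].
      apply csmooth_mult; [apply csmooth_inv_expansion|apply csmooth_cD, Hc].
  + intros f Hf; apply branch_sum_term_cD; [assumption|apply csmooth_cDn, Hf].
- exists (fun f x => Cplus (O1' f x) (O2' f x)); split; [apply lower_plus; assumption|].
  intros f Hf; rewrite cD_plus by (eapply lower_csm; eassumption).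
  rewrite E1, E2 by assumption; reflexivity.
Qed.

(** Each derivative of a sum over branches brings out the Jacobian of the branch,
    which is where the smoothing of the operators comes from. *)
Lemma branch_sum_cDn a j : csmooth a -> exists O, lower j O /\ forall f, csmooth f ->
  cDn j (branch_sum (fun y => Cmult (a y) (f y))) =
  fun x => Cplus (branch_sum (fun y => Cmult (Cmult (a y) (Cpow (inv_expansion y) j)) (cDn j f y)) x) (O f x).
Proof.
intros Ha; induction j as [|j [O [L E]]].
- exists (fun _ _ => RtoC 0); split; [apply lower_zero|]; intros f _.
  apply functional_extensionality; intros x; simpl.
  rewrite Cplus_0_r; apply csum_ext; intros; ring.
- assert (Hj : csmooth (fun y => Cmult (a y) (Cpow (inv_expansion y) j))).
  { apply csmooth_mult; [assumption|]. clear - Hexp.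
    induction j as [|j IH]; simpl; [apply csmooth_const|apply csmooth_mult; [apply csmooth_inv_expansion|exact IH]]. }
  destruct (lower_cD j O L) as [O' [L' E']].
  exists (fun f x => Cplus (branch_sum (fun y =>
    Cmult (Cmult (inv_expansion y) (cD (fun y => Cmult (a y) (Cpow (inv_expansion y) j)) y)) (cDn j f y)) x) (O' f x)).
  split.
  + apply (lower_plus (S j) (fun f => branch_sum (fun y =>
      Cmult (Cmult (inv_expansion y) (cD (fun y => Cmult (a y) (Cpow (inv_expansion y) j)) y)) (cDn j f y)))); [|assumption].
    apply (lower_term (S j) (fun y => Cmult (inv_expansion y) (cD (fun y => Cmult (a y) (Cpow (inv_expansion y) j)) y)) j);
      [|lia].
    apply csmooth_mult; [apply csmooth_inv_expansion|apply csmooth_cD, Hj].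
  + intros f Hf. change (cDn (S j) (branch_sum (fun y => Cmult (a y) (f y))))
      with (cD (cDn j (branch_sum (fun y => Cmult (a y) (f y))))).
    rewrite E by assumption.
    assert (Hd := csmooth_cDn j f Hf).
    rewrite cD_plus; [|apply csmooth_branch_sum, csmooth_mult; assumption|eapply lower_csm; eassumption].
    rewrite branch_sum_term_cD, E' by assumption.
    apply functional_extensionality; intros x.
    rewrite <- !Cplus_assoc; f_equal.
    apply csum_ext; intros i _; change (cD (cDn j f)) with (cDn (S j) f); simpl Cpow; ring.
Qed.

(** * Energy estimates *)

Variable h : R -> R.
Hypothesis h_periodic : periodic h.
Hypothesis h_cont : rcont h.
Hypothesis h_pos : forall x, 0 < h x.
Hypothesis h_inv : forall x, M0 h x = h x.

(** The [L^2] energy relative to the invariant density, for which the operators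
    with a weight bounded by [1 / E'] are contractions. *)
Definition wnorm (f : R -> C) : R := RInt (fun x => Cmod (f x) ^ 2 / h x) 0 1.

Lemma wnorm_cont f : ccont f -> rcont (fun x => Cmod (f x) ^ 2 / h x).
Proof.
intros Hf; apply rcont_mult; [apply rcont_Cmod2, Hf|].
apply rcont_inv; [assumption|intros x; apply Rgt_not_eq, h_pos].
Qed.

Lemma wnorm_int_pos f x : 0 <= Cmod (f x) ^ 2 / h x.
Proof.
apply Rmult_le_pos; [apply pow2_ge_0|left; apply Rinv_0_lt_compat, h_pos].
Qed.

Lemma wnorm_pos f : ccont f -> 0 <= wnorm f.
Proof.
intros Hf; apply RInt_nonneg; [lra|apply wnorm_cont, Hf|intros; apply wnorm_int_pos].
Qed.

(** Jensen's inequality with the weights [h / E'] at the preimages of [x], whose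
    sum is [h x] by invariance. *)
Lemma branch_sum_mod_sqr c f be x : (forall y, Cmod (c y) <= be * / dE y) -> 0 <= be ->
  Cmod (branch_sum (fun y => Cmult (c y) (f y)) x) ^ 2 / h x <=
  be ^ 2 * M0 (fun y => Cmod (f y) ^ 2 / h y) x.
Proof.
intros Hc be0.
assert (hx := h_pos x).
assert (S : Cmod (branch_sum (fun y => Cmult (c y) (f y)) x) <=
  be * rsum (fun j => (/ dE (yb j x) * h (yb j x)) * (Cmod (f (yb j x)) / h (yb j x))) k).
{ eapply Rle_trans; [apply Cmod_branch_sum|].
  rewrite <- rsum_scal; apply rsum_le; intros j _.
  rewrite Cmod_mult. specialize (Hc (yb j x)).
  assert (hy := h_pos (yb j x)). assert (dy := dE_pos (yb j x)).
  replace (be * (/ dE (yb j x) * h (yb j x) * (Cmod (f (yb j x)) / h (yb j x))))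
    with (be * / dE (yb j x) * Cmod (f (yb j x))) by (field; lra).
  apply Rmult_le_compat_r; [apply Cmod_ge_0|assumption]. }
assert (J := rsum_sqr_le (fun j => / dE (yb j x) * h (yb j x))
   (fun j => Cmod (f (yb j x)) / h (yb j x)) k).
assert (J' := J (fun i _ => Rmult_le_pos _ _ (Rlt_le _ _ (weight_pos _)) (Rlt_le _ _ (h_pos _)))).
clear J.
change (rsum (fun j => / dE (yb j x) * h (yb j x)) k) with (M0 h x) in J'.
rewrite h_inv in J'.
rewrite (rsum_ext (fun i => / dE (yb i x) * h (yb i x) * (Cmod (f (yb i x)) / h (yb i x)) ^ 2)
  (fun i => / dE (yb i x) * (Cmod (f (yb i x)) ^ 2 / h (yb i x)))) in J'.
2:{ intros j _; assert (hy := h_pos (yb j x)); field; split; [lra|].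
    apply Rgt_not_eq, dE_pos. }
change (rsum (fun i => / dE (yb i x) * (Cmod (f (yb i x)) ^ 2 / h (yb i x))) k)
  with (M0 (fun y => Cmod (f y) ^ 2 / h y) x) in J'.
apply (Rmult_le_reg_r (h x)); [assumption|].
unfold Rdiv at 1; rewrite Rmult_assoc, Rinv_l, Rmult_1_r by lra.
eapply Rle_trans; [apply pow_incr; split; [apply Cmod_ge_0|exact S]|].
rewrite Rpow_mult_distr, Rmult_assoc; apply Rmult_le_compat_l; [apply pow2_ge_0|].
rewrite (Rmult_comm _ (h x)); exact J'.
Qed.

Lemma wnorm_branch_sum c f be : ccont c -> ccont f -> periodic f ->
  (forall y, Cmod (c y) <= be * / dE y) -> 0 <= be ->
  wnorm (branch_sum (fun y => Cmult (c y) (f y))) <= be ^ 2 * wnorm f.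
Proof.
intros Hcc Hf Pf Hc be0.
assert (Fc := wnorm_cont f Hf).
assert (FP : periodic (fun y => Cmod (f y) ^ 2 / h y)).
{ intros x; rewrite Pf, h_periodic; reflexivity. }
unfold wnorm at 2; rewrite <- (RInt_ruelle (fun y => Cmod (f y) ^ 2 / h y)) by assumption.
rewrite <- RInt_scal_r by (apply ruelle_cont; assumption).
apply RInt_le_r; [lra| | |].
- apply wnorm_cont, branch_sum_cont, ccont_mult; assumption.
- apply (rcont_mult (fun _ => be ^ 2)); [apply rcont_const|apply ruelle_cont, Fc].
- intros x; apply branch_sum_mod_sqr; assumption.
Qed.

Lemma wnorm_plus L f f' : 1 < L -> ccont f -> ccont f' ->
  wnorm (fun x => Cplus (f x) (f' x)) <= L * wnorm f + L / (L - 1) * wnorm f'.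
Proof.
intros hL Hf Hf'; unfold wnorm.
assert (C1 := wnorm_cont f Hf); assert (C2 := wnorm_cont f' Hf').
assert (C3 : rcont (fun x => L * (Cmod (f x) ^ 2 / h x))) by
  (apply (rcont_mult (fun _ => L)); [apply rcont_const|assumption]).
assert (C4 : rcont (fun x => L / (L - 1) * (Cmod (f' x) ^ 2 / h x))) by
  (apply (rcont_mult (fun _ => L / (L - 1))); [apply rcont_const|assumption]).
rewrite <- !RInt_scal_r, <- RInt_plus_r by assumption.
apply RInt_le_r; [lra|apply wnorm_cont, ccont_plus; assumption|apply rcont_plus; assumption|].
intros x; assert (K := Cmod_plus_sqr L (f x) (f' x) hL).
assert (hx := h_pos x). apply (Rmult_le_reg_r (h x)); [assumption|].
unfold Rdiv at 1; rewrite Rmult_assoc, Rinv_l, Rmult_1_r by lra.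
replace ((L * (Cmod (f x) ^ 2 / h x) + L / (L - 1) * (Cmod (f' x) ^ 2 / h x)) * h x)
  with (L * Cmod (f x) ^ 2 + L / (L - 1) * Cmod (f' x) ^ 2) by (field; lra).
exact K.
Qed.

Definition wenergy (i : nat) (f : R -> C) : R := rsum (fun j => wnorm (cDn j f)) i.

Lemma wnorm_cDn_pos j f : csmooth f -> 0 <= wnorm (cDn j f).
Proof. intros H; apply wnorm_pos, csmooth_cont, csmooth_cDn, H. Qed.

Lemma wenergy_pos i f : csmooth f -> 0 <= wenergy i f.
Proof. intros H; apply rsum_ge0; intros; apply wnorm_cDn_pos, H. Qed.

Lemma csmooth_weight_bound c : csmooth c -> exists be, 0 <= be /\ forall y, Cmod (c y) <= be * / dE y.
Proof.
intros H; destruct (periodic_cbounded c (proj1 H) (csmooth_cont c H)) as [M [Mp HM]].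
destruct dE_bounded as [L [L1 HL]].
exists (M * L); split; [nra|]; intros y; eapply Rle_trans; [apply HM|].
rewrite Rmult_assoc; rewrite <- (Rmult_1_r M) at 1; apply Rmult_le_compat_l; [lra|].
assert (dy := dE_pos y). apply (Rmult_le_reg_r (dE y)); [assumption|].
rewrite Rmult_assoc, Rinv_l by lra; generalize (HL y); lra.
Qed.

Lemma wnorm_lower i O : lower i O -> exists C, 0 <= C /\ forall f, csmooth f -> wnorm (O f) <= C * wenergy i f.
Proof.
induction 1 as [|c j Hc hj|O1 O2 H1 [C1 [P1 E1]] H2 [C2 [P2 E2]]].
- exists 0; split; [lra|]; intros f _; unfold wnorm.
  rewrite (RInt_ext _ (fun _ => 0)).
  + rewrite RInt_const_r; lra.
  + intros x _; rewrite Cmod_0; unfold Rdiv; eqR; ring.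
- destruct (csmooth_weight_bound c Hc) as [be [be0 Hb]].
  exists (be ^ 2); split; [apply pow2_ge_0|]; intros f Hf.
  assert (Hd := csmooth_cDn j f Hf).
  eapply Rle_trans; [apply (wnorm_branch_sum c _ be); auto; [apply csmooth_cont, Hc|apply csmooth_cont, Hd|apply Hd]|].
  apply Rmult_le_compat_l; [apply pow2_ge_0|].
  apply (rsum_term_le (fun j => wnorm (cDn j f)) i j); [intros; apply wnorm_cDn_pos, Hf|assumption].
- exists (2 * C1 + 2 * C2); split; [lra|]; intros f Hf.
  eapply Rle_trans; [apply (wnorm_plus 2); [lra| |]; eapply csmooth_cont, lower_csm; eassumption|].
  replace (2 / (2 - 1)) with 2 by field.
  specialize (E1 f Hf); specialize (E2 f Hf); lra.
Qed.

Variable a : R -> C.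
Hypothesis a_csm : csmooth a.
Hypothesis a_le : forall y, Cmod (a y) <= / dE y.

Definition weighted_op (f : R -> C) : R -> C := branch_sum (fun y => Cmult (a y) (f y)).

Lemma csmooth_weighted_op f : csmooth f -> csmooth (weighted_op f).
Proof. intros H; apply csmooth_branch_sum, csmooth_mult; assumption. Qed.

Lemma wnorm_weighted_op f : ccont f -> periodic f -> wnorm (weighted_op f) <= wnorm f.
Proof.
intros Hf Pf; eapply Rle_trans; [apply (wnorm_branch_sum a f 1); auto; [apply csmooth_cont, a_csm| |lra]|lra].
intros y; rewrite Rmult_1_l; apply a_le.
Qed.

(** Jacobians contract the principal part by [lam^-2]; the factor [lam] given
    back is the price of Young's inequality for the remainder. *)
Lemma wnorm_weighted_op_step j : exists C, 0 <= C /\ forall f, csmooth f ->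
  wnorm (cDn (S j) (weighted_op f)) <= / lam * wnorm (cDn (S j) f) + C * wenergy (S j) f.
Proof.
destruct (branch_sum_cDn a (S j) a_csm) as [O [L E]].
destruct (wnorm_lower _ O L) as [C [C0 HC]].
exists (lam / (lam - 1) * C); split.
{ apply Rmult_le_pos; [left; apply Rdiv_lt_0_compat; lra|assumption]. }
intros f Hf; unfold weighted_op; rewrite E by assumption.
assert (Hd := csmooth_cDn (S j) f Hf).
assert (Hj : csmooth (fun y => Cmult (a y) (Cpow (inv_expansion y) (S j)))).
{ apply csmooth_mult; [assumption|]. clear - Hexp.
  induction (S j) as [|i IH]; simpl; [apply csmooth_const|apply csmooth_mult; [apply csmooth_inv_expansion|exact IH]]. }
eapply Rle_trans; [apply (wnorm_plus lam); [assumption| |]|].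
{ apply csmooth_cont, csmooth_branch_sum, csmooth_mult; assumption. }
{ eapply csmooth_cont, lower_csm; eassumption. }
assert (B : wnorm (branch_sum (fun y => Cmult (Cmult (a y) (Cpow (inv_expansion y) (S j))) (cDn (S j) f y))) <=
  (/ lam) ^ 2 * wnorm (cDn (S j) f)).
{ assert (il : 0 < / lam) by (apply Rinv_0_lt_compat; lra).
  apply wnorm_branch_sum; [apply csmooth_cont, Hj|apply csmooth_cont, Hd|apply Hd| |lra].
  intros y; rewrite Cmod_mult, Cmod_pow, Cmod_inv_expansion, Rmult_comm.
  assert (w := weight_pos y).
  assert (wl : / dE y <= / lam) by (apply Rinv_le_contravar; [lra|apply hlam]).
  assert (il1 : / lam <= 1) by (rewrite <- Rinv_1; apply Rinv_le_contravar; lra).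
  assert (p : 0 <= (/ dE y) ^ j <= 1).
  { split; [apply pow_le; lra|]. rewrite <- (pow1 j); apply pow_incr; lra. }
  simpl pow. apply Rmult_le_compat; [nra|apply Cmod_ge_0|nra|apply a_le]. }
apply Rplus_le_compat.
- replace (/ lam * wnorm (cDn (S j) f)) with (lam * ((/ lam) ^ 2 * wnorm (cDn (S j) f))) by (field; lra).
  apply Rmult_le_compat_l; [lra|exact B].
- rewrite Rmult_assoc; apply Rmult_le_compat_l; [left; apply Rdiv_lt_0_compat; lra|].
  apply HC, Hf.
Qed.

Notation TTn n f := (Nat.iter n weighted_op f).

Lemma csmooth_weighted_op_iter n f : csmooth f -> csmooth (TTn n f).
Proof. intros H; induction n as [|n IH]; [assumption|apply csmooth_weighted_op, IH]. Qed.

Lemma affine_recursion (b : nat -> R) rho q D : 0 <= rho < q -> 0 <= D -> 0 <= b O ->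
  (forall n, b (S n) <= rho * b n + D * q ^ n) ->
  forall n, b n <= (b O + D / (q - rho)) * q ^ n.
Proof.
intros hq hD b0 H.
assert (d0 : 0 <= D / (q - rho)).
{ apply Rmult_le_pos; [assumption|left; apply Rinv_0_lt_compat; lra]. }
induction n as [|n IH]; [simpl; lra|].
eapply Rle_trans; [apply H|].
apply Rle_trans with (rho * ((b O + D / (q - rho)) * q ^ n) + D * q ^ n).
- apply Rplus_le_compat_r, Rmult_le_compat_l; lra.
- assert (p : 0 <= q ^ n) by (apply pow_le; lra).
  replace ((b 0%nat + D / (q - rho)) * q ^ S n)
    with (rho * ((b O + D / (q - rho)) * q ^ n) + D * q ^ n + (q - rho) * (b O * q ^ n))
    by (simpl; field; lra).
  assert (0 <= (q - rho) * (b O * q ^ n)) by (apply Rmult_le_pos; [lra|apply Rmult_le_pos; assumption]).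
  lra.
Qed.

(** A decay rate slower than [1 / lam] passes from the lowest energy to the higher
    ones, because each of these contracts up to lower ones. *)
Lemma wenergy_growth i q : / lam < q -> exists C, 0 <= C /\ forall f K, csmooth f ->
  (forall n, wnorm (TTn n f) <= K * q ^ n) ->
  forall n, wenergy (S i) (TTn n f) <= C * (K + wenergy (S i) f) * q ^ n.
Proof.
intros hq; assert (il : 0 < / lam) by (apply Rinv_0_lt_compat; lra).
assert (qn : forall n, 0 <= q ^ n) by (intros; apply pow_le; lra).
induction i as [|i [C [C0 IH]]].
- exists 1; split; [lra|]; intros f K Hf HK n.
  assert (wenergy 1 f = wnorm f) by (unfold wenergy; simpl; ring).
  assert (E : wenergy 1 (TTn n f) = wnorm (TTn n f)) by (unfold wenergy; simpl; ring).
  rewrite E, H; eapply Rle_trans; [apply HK|].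
  apply Rmult_le_compat_r; [apply qn|]. assert (0 <= wnorm f) by (apply wnorm_pos, csmooth_cont, Hf); lra.
- destruct (wnorm_weighted_op_step i) as [D [D0 HD]].
  set (c := D * C / (q - / lam)).
  assert (c0 : 0 <= c).
  { apply Rmult_le_pos; [nra|left; apply Rinv_0_lt_compat; lra]. }
  exists (C + 1 + c); split; [lra|]; intros f K Hf HK n.
  assert (IHf := IH f K Hf HK).
  assert (K0 : 0 <= K).
  { specialize (HK O); simpl in HK; assert (0 <= wnorm f) by (apply wnorm_pos, csmooth_cont, Hf); lra. }
  assert (S0 := wenergy_pos (S i) f Hf). assert (S1 := wnorm_cDn_pos (S i) f Hf).
  assert (R := affine_recursion (fun n => wnorm (cDn (S i) (TTn n f))) (/ lam) q
     (D * C * (K + wenergy (S i) f))).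
  assert (R' : forall n, wnorm (cDn (S i) (TTn n f)) <=
     (wnorm (cDn (S i) f) + c * (K + wenergy (S i) f)) * q ^ n).
  { intros p. replace (c * (K + wenergy (S i) f)) with (D * C * (K + wenergy (S i) f) / (q - / lam))
      by (unfold c, Rdiv; ring).
    apply R; [lra| |exact S1|].
    - apply Rmult_le_pos; [nra|lra].
    - intros r. eapply Rle_trans; [apply (HD (TTn r f)), csmooth_weighted_op_iter, Hf|].
      apply Rplus_le_compat_l. specialize (IHf r).
      replace (D * C * (K + wenergy (S i) f) * q ^ r) with (D * (C * (K + wenergy (S i) f) * q ^ r)) by ring.
      apply Rmult_le_compat_l; assumption. }
  change (wenergy (S (S i)) (TTn n f)) with (wenergy (S i) (TTn n f) + wnorm (cDn (S i) (TTn n f))).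
  change (wenergy (S (S i)) f) with (wenergy (S i) f + wnorm (cDn (S i) f)).
  specialize (IHf n); specialize (R' n).
  set (X := wenergy (S i) f) in *; set (Y := wnorm (cDn (S i) f)) in *.
  apply Rle_trans with (C * (K + X) * q ^ n + (Y + c * (K + X)) * q ^ n); [lra|].
  rewrite <- Rmult_plus_distr_r; apply Rmult_le_compat_r; [apply qn|].
  assert (0 <= C * Y) by (apply Rmult_le_pos; assumption).
  assert (0 <= c * Y) by (apply Rmult_le_pos; assumption). nra.
Qed.

Lemma h_bounds : exists l u, 0 < l /\ 0 < u /\ forall x, l <= h x <= u.
Proof.
destruct (periodic_bounded h h_periodic h_cont) as [u [u0 Hu]].
destruct (periodic_bounded (fun x => / h x)) as [v [v0 Hv]].
- intros x; rewrite h_periodic; reflexivity.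
- apply rcont_inv; [assumption|intros x; apply Rgt_not_eq, h_pos].
- exists (/ v), u; repeat split; auto; [apply Rinv_0_lt_compat, v0| |].
  + specialize (Hv x); rewrite Rabs_pos_eq in Hv by (left; apply Rinv_0_lt_compat, h_pos).
    rewrite <- (Rinv_inv (h x)). apply Rinv_le_contravar; [apply Rinv_0_lt_compat, h_pos|exact Hv].
  + specialize (Hu x); rewrite Rabs_pos_eq in Hu by (left; apply h_pos); exact Hu.
Qed.

Lemma wnorm_sqnorm : exists l u, 0 < l /\ 0 < u /\ forall f, ccont f -> wnorm f <= u * sqnorm f /\ sqnorm f <= l * wnorm f.
Proof.
destruct h_bounds as [l [u [l0 [u0 B]]]].
exists u, (/ l); repeat split; auto; [apply Rinv_0_lt_compat, l0| |].
- unfold wnorm, sqnorm; rewrite <- RInt_scal_r by (apply rcont_Cmod2; assumption).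
  apply RInt_le_r; [lra|apply wnorm_cont; assumption| |].
  + apply (rcont_mult (fun _ => / l)); [apply rcont_const|apply rcont_Cmod2; assumption].
  + intros x; unfold Rdiv; rewrite Rmult_comm; apply Rmult_le_compat_r; [apply pow2_ge_0|].
    apply Rinv_le_contravar; [assumption|apply B].
- unfold wnorm, sqnorm; rewrite <- RInt_scal_r by (apply wnorm_cont; assumption).
  apply RInt_le_r; [lra|apply rcont_Cmod2; assumption| |].
  + apply (rcont_mult (fun _ => u)); [apply rcont_const|apply wnorm_cont; assumption].
  + intros x; assert (hx := h_pos x); destruct (B x) as [_ B2].
    replace (u * (Cmod (f x) ^ 2 / h x)) with (Cmod (f x) ^ 2 * (u / h x)) by (field; lra).
    rewrite <- (Rmult_1_r (Cmod (f x) ^ 2)) at 1; apply Rmult_le_compat_l; [apply pow2_ge_0|].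
    apply (Rmult_le_reg_r (h x)); [assumption|].
    unfold Rdiv; rewrite Rmult_assoc, Rinv_l; lra.
Qed.

Theorem energy_growth m q : / lam < q -> exists C, 0 <= C /\ forall f K, csmooth f ->
  (forall n, sqnorm (TTn n f) <= K * q ^ n) ->
  forall n, energy m (TTn n f) <= C * (K + energy m f) * q ^ n.
Proof.
intros hq; destruct (wenergy_growth m q hq) as [C [C0 H]].
destruct wnorm_sqnorm as [l [u [l0 [u0 QU]]]].
exists (l * C * u); split; [apply Rmult_le_pos; [apply Rmult_le_pos|]; lra|].
intros f K Hf HK n.
assert (E1 : wenergy (S m) f <= u * energy m f).
{ unfold wenergy, energy; rewrite <- rsum_scal; apply rsum_le; intros j _.
  apply (proj1 (QU _ (csmooth_cont _ (csmooth_cDn j f Hf)))). }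
assert (E2 : energy m (TTn n f) <= l * wenergy (S m) (TTn n f)).
{ unfold wenergy, energy; rewrite <- rsum_scal; apply rsum_le; intros j _.
  apply (proj2 (QU _ (csmooth_cont _ (csmooth_cDn j _ (csmooth_weighted_op_iter n f Hf))))). }
eapply Rle_trans; [exact E2|].
rewrite !Rmult_assoc; apply Rmult_le_compat_l; [lra|].
eapply Rle_trans; [apply (H f (u * K) Hf)|].
- intros p; rewrite Rmult_assoc.
  eapply Rle_trans; [apply (proj1 (QU _ (csmooth_cont _ (csmooth_weighted_op_iter p f Hf))))|].
  apply Rmult_le_compat_l; [lra|apply HK].
- rewrite !Rmult_assoc; apply Rmult_le_compat_l; [assumption|].
  rewrite <- Rmult_assoc; apply Rmult_le_compat_r; [|lra].
  apply pow_le; assert (0 < / lam) by (apply Rinv_0_lt_compat; lra); lra.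
Qed.

(** The lowest weighted energy does not increase, which is the case [q = 1] of
    the previous principle. *)
Lemma energy_bounded m : exists C, 0 <= C /\ forall f, csmooth f ->
  forall n, energy m (TTn n f) <= C * energy m f.
Proof.
destruct (energy_growth m 1) as [C [C0 H]].
{ rewrite <- Rinv_1; apply Rinv_lt_contravar; lra. }
destruct wnorm_sqnorm as [l [u [l0 [u0 QU]]]].
exists (C * (l * u + 1)); split; [apply Rmult_le_pos; [assumption|nra]|].
intros f Hf n.
assert (Qn : forall n, wnorm (TTn n f) <= wnorm f).
{ induction n0 as [|p IH]; [apply Rle_refl|]. simpl; eapply Rle_trans; [|exact IH].
  assert (Hp := csmooth_weighted_op_iter p f Hf). apply wnorm_weighted_op; [apply csmooth_cont, Hp|apply Hp]. }
assert (U0 : sqnorm f <= energy m f).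
{ apply (rsum_term_le (fun j => sqnorm (cDn j f)) (S m) 0); [|lia].
  intros; apply sqnorm_pos, csmooth_cont, csmooth_cDn, Hf. }
eapply Rle_trans; [apply (H f (l * u * sqnorm f) Hf)|].
- intros p; rewrite pow1, Rmult_1_r.
  eapply Rle_trans; [apply (proj2 (QU _ (csmooth_cont _ (csmooth_weighted_op_iter p f Hf))))|].
  rewrite Rmult_assoc; apply Rmult_le_compat_l; [lra|].
  eapply Rle_trans; [apply Qn|apply (proj1 (QU _ (csmooth_cont f Hf)))].
- rewrite pow1, Rmult_1_r, (Rmult_assoc C); apply Rmult_le_compat_l; [assumption|].
  assert (0 <= l * u) by nra. nra.
Qed.

End Transfer.

Arguments branch_sum : clear implicits.
Arguments inv_expansion : clear implicits.
Arguments weighted_op : clear implicits.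

Lemma pow_small q eps : 0 <= q < 1 -> 0 < eps -> exists N, forall n, (N <= n)%nat -> q ^ n <= eps.
Proof.
intros hq he; destruct (pow_lt_1_zero q) with (y := eps) as [N HN]; [rewrite Rabs_pos_eq; lra|assumption|].
exists N; intros n hn; specialize (HN n hn).
rewrite Rabs_pos_eq in HN by (apply pow_le; lra); lra.
Qed.

Section Words.

Context {k : nat} {g : circle_diffeo} {lam : R} {Hexp : expanding k g lam}.
Let hk : (2 <= k)%nat := expanding_degree.
Let lam1 : 1 < lam := expanding_gt1.
Let hlam : forall x, lam <= Derive (expand k g) x := expanding_le.

Notation dE := (Derive (expand k g)).
Notation yb := (branch k g).

Variable tau : R -> R.
Hypothesis tau_smooth : smooth tau.
Hypothesis tau_periodic : periodic tau.

Notation dtau := (Derive tau).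

(** * Words of inverse branches *)

Definition word_point (w : list nat) (x : R) : R := fold_left (fun y j => yb j y) w x.

(** The Birkhoff sum of [tau] along the backward orbit chosen by the word. *)
Fixpoint word_phase (w : list nat) (x : R) : R :=
  match w with nil => 0 | j :: w' => tau (yb j x) + word_phase w' (yb j x) end.

(** The derivative of [word_phase]. *)
Fixpoint word_slope (w : list nat) (x : R) : R :=
  match w with nil => 0 | j :: w' => / dE (yb j x) * (dtau (yb j x) + word_slope w' (yb j x)) end.

Fixpoint word_expansion (w : list nat) (x : R) : R :=
  match w with nil => 1 | j :: w' => dE (yb j x) * word_expansion w' (yb j x) end.

(** The second component of the composition of the maps [F_j], along a backward
    orbit that is not reduced modulo 1 and hence depends smoothly on [x]. *)
Fixpoint word_fibre (w : list nat) (x eta : R) : R :=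
  match w with nil => eta | j :: w' => word_fibre w' (yb j x) (dE (yb j x) * eta + dtau (yb j x)) end.

Lemma word_phase_derive w x : is_derive (word_phase w) x (word_slope w x).
Proof.
revert x; induction w as [|j w IH]; intros x; simpl; [apply (is_derive_const (V := R_NormedModule))|].
evar_last.
- apply (is_derive_plus (fun x => tau (yb j x)) (fun x => word_phase w (yb j x))).
  + apply (is_derive_comp tau (yb j)); [apply Derive_correct, smooth_ex_derive, tau_smooth|apply branch_derive].
  + apply (is_derive_comp (word_phase w) (yb j)); [apply IH|apply branch_derive].
- unfold scal, plus; simpl; unfold mult; simpl; ring.
Qed.

(** A covector stays bounded along a word exactly when it is exponentially close
    to minus the slope of the word. *)
Lemma word_fibre_eq w x eta : word_fibre w x eta = word_expansion w x * (eta + word_slope w x).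
Proof.
revert x eta; induction w as [|j w IH]; intros x eta; simpl; [ring|].
rewrite IH; field; apply Rgt_not_eq, dE_pos.
Qed.

Lemma word_expansion_pos w x : 0 < word_expansion w x.
Proof.
revert x; induction w as [|j w IH]; intros x; simpl; [lra|].
apply Rmult_lt_0_compat; [apply dE_pos|apply IH].
Qed.

Lemma word_expansion_le L w x : (forall y, dE y <= L) -> word_expansion w x <= L ^ length w.
Proof.
intros HL; revert x; induction w as [|j w IH]; intros x; simpl; [lra|].
apply Rmult_le_compat; [left; apply dE_pos|left; apply word_expansion_pos|apply HL|apply IH].
Qed.

Lemma word_slope_app w v x : word_slope (w ++ v) x = word_slope w x + word_slope v (word_point w x) / word_expansion w x.
Proof.
revert x; induction w as [|j w IH]; intros x; simpl; [field|].
rewrite IH; change (word_point (j :: w) x) with (word_point w (yb j x)).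
field; split; [apply Rgt_not_eq, word_expansion_pos|apply Rgt_not_eq, dE_pos].
Qed.

Lemma word_slope_bound T w x : (forall y, Rabs (dtau y) <= T) -> Rabs (word_slope w x) <= T / (lam - 1).
Proof.
intros HT; assert (T0 : 0 <= T) by (eapply Rle_trans; [apply Rabs_pos|apply (HT 0)]).
assert (P : 0 <= T / (lam - 1)) by (apply Rmult_le_pos; [assumption|left; apply Rinv_0_lt_compat; lra]).
revert x; induction w as [|j w IH]; intros x; simpl; [rewrite Rabs_R0; assumption|].
rewrite Rabs_mult, Rabs_pos_eq by (left; apply weight_pos).
apply Rle_trans with (/ lam * (T + T / (lam - 1))).
- apply Rmult_le_compat; [left; apply weight_pos|apply Rabs_pos| |].
  + apply Rinv_le_contravar; [lra|apply hlam].
  + eapply Rle_trans; [apply Rabs_triang|]; apply Rplus_le_compat; [apply HT|apply IH].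
- right; field; lra.
Qed.

Lemma dtau_periodic : periodic dtau.
Proof. apply Derive_periodic; [assumption|apply smooth_ex_derive, tau_smooth]. Qed.

Lemma dtau_bounded : exists T, 0 < T /\ forall y, Rabs (dtau y) <= T.
Proof. apply periodic_bounded; [apply dtau_periodic|apply smooth_rcont, smooth_Derive, tau_smooth]. Qed.

Lemma weight_lipschitz : exists B, 0 < B /\ forall x y, Rabs (/ dE x - / dE y) <= B * Rabs (x - y).
Proof.
destruct (dE_lipschitz (k := k) (g := g)) as [B [B0 HB]]; exists B; split; [assumption|]; intros x y.
assert (dx := hlam x); assert (dy := hlam y).
replace (/ dE x - / dE y) with (/ (dE x * dE y) * (dE y - dE x)) by (field; lra).
rewrite Rabs_mult, Rabs_pos_eq by (left; apply Rinv_0_lt_compat; nra).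
apply Rle_trans with (1 * Rabs (dE y - dE x)).
- apply Rmult_le_compat_r; [apply Rabs_pos|]. rewrite <- Rinv_1; apply Rinv_le_contravar; nra.
- rewrite Rmult_1_l, (Rabs_minus_sym x); apply HB.
Qed.

(** Slopes are sums of derivatives of contracted branches; uniformity in the
    length of the word is what makes gaps between slopes persist on an interval
    of fixed size. *)
Lemma word_slope_lipschitz : exists D, 0 < D /\
  forall w x y, Rabs (word_slope w x - word_slope w y) <= D * Rabs (x - y).
Proof.
destruct dtau_bounded as [T [T0 HT]].
destruct weight_lipschitz as [B [B0 HB]].
destruct (smooth_lipschitz dtau (smooth_Derive _ tau_smooth)) as [G [G0 HG]].
{ apply Derive_periodic; [apply dtau_periodic|apply smooth_ex_derive, smooth_Derive, tau_smooth]. }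
set (T' := T + T / (lam - 1)).
assert (T'0 : 0 < T') by (unfold T'; assert (0 < T / (lam - 1)) by (apply Rdiv_lt_0_compat; lra); lra).
assert (il : 0 < / lam < 1).
{ split; [apply Rinv_0_lt_compat; lra|rewrite <- Rinv_1; apply Rinv_lt_contravar; lra]. }
set (D := (B * T' + G) / (1 - / lam)).
assert (D0 : 0 < D) by (apply Rdiv_lt_0_compat; [nra|lra]).
assert (ED : B * T' + G + D * / lam = D) by (unfold D; field; lra).
exists D; split; [assumption|].
induction w as [|j w IH]; intros x y; cbn [word_slope].
- rewrite Rminus_diag, Rabs_R0; apply Rmult_le_pos; [lra|apply Rabs_pos].
- set (p := yb j x); set (q := yb j y).
  assert (c := branch_contr j x y); fold p q in c.
  assert (c1 := branch_contr1 j x y); fold p q in c1.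
  replace (/ dE p * (dtau p + word_slope w p) - / dE q * (dtau q + word_slope w q))
    with ((/ dE p - / dE q) * (dtau p + word_slope w p) +
          / dE q * ((dtau p - dtau q) + (word_slope w p - word_slope w q))) by ring.
  eapply Rle_trans; [apply Rabs_triang|]; rewrite !Rabs_mult.
  assert (E1 : Rabs (/ dE p - / dE q) * Rabs (dtau p + word_slope w p) <= B * Rabs (x - y) * T').
  { apply Rmult_le_compat; try apply Rabs_pos.
    - eapply Rle_trans; [apply HB|]; apply Rmult_le_compat_l; lra.
    - eapply Rle_trans; [apply Rabs_triang|]; unfold T'.
      assert (K := word_slope_bound T w p HT); specialize (HT p); lra. }
  assert (E2 : Rabs (/ dE q) * Rabs (dtau p - dtau q + (word_slope w p - word_slope w q)) <=
     1 * (G * Rabs (x - y) + D * (/ lam * Rabs (x - y)))).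
  { apply Rmult_le_compat; try apply Rabs_pos.
    - rewrite Rabs_pos_eq by (left; apply weight_pos).
      rewrite <- Rinv_1; apply Rinv_le_contravar; [lra|generalize (hlam q); lra].
    - eapply Rle_trans; [apply Rabs_triang|]; apply Rplus_le_compat.
      + eapply Rle_trans; [apply HG|]; apply Rmult_le_compat_l; lra.
      + eapply Rle_trans; [apply IH|]; apply Rmult_le_compat_l; lra. }
  rewrite <- ED. nra.
Qed.

Lemma word_point_sqrt w x y : sqrt (Rabs (word_point w x - word_point w y)) <= theta lam ^ length w * sqrt (Rabs (x - y)).
Proof.
revert x y; induction w as [|j w IH]; intros x y; simpl; [lra|].
eapply Rle_trans; [apply IH|]. rewrite (Rmult_comm (theta lam)), Rmult_assoc.
apply Rmult_le_compat_l; [apply pow_le; left; apply theta_range|apply branch_sqrt].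
Qed.

(** ** Captivity in terms of the slopes *)

Lemma words_spec n w : In w (words k n) -> length w = n /\ List.Forall (fun j => (j < k)%nat) w.
Proof.
revert w; induction n as [|n IH]; intros w; simpl.
- intros [<-|[]]; split; [reflexivity|constructor].
- rewrite in_flat_map; intros [v [hv H]]; apply in_map_iff in H; destruct H as [j [<- hj]].
  apply in_seq in hj; destruct (IH v hv) as [l F]; split; [simpl; congruence|].
  constructor; [lia|assumption].
Qed.

Lemma words_length n : length (words k n) = (k ^ n)%nat.
Proof.
induction n as [|n IH]; simpl; [reflexivity|]. rewrite <- IH. clear.
induction (words k n) as [|v l IHl]; cbn [flat_map length]; [lia|].
rewrite length_app, length_map, length_seq, IHl, Nat.mul_succ_r; lia.
Qed.

Lemma filter_short {T} (p : T -> bool) l : (length (filter p l) < length l)%nat ->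
  exists x, In x l /\ p x = false.
Proof.
induction l as [|x l IH]; simpl; [lia|]; destruct (p x) eqn:E.
- simpl; intros h; destruct IH as [y [hy Hy]]; [lia|]; exists y; split; [right|]; assumption.
- intros _; exists x; split; [left; reflexivity|assumption].
Qed.

(** Reducing the base point modulo 1 shifts the index of the next branch, so it
    replaces a word by another one of the same length. *)
Lemma follow_word_fibre w : List.Forall (fun j => (j < k)%nat) w -> forall x (p : Z) eta,
  exists v, length v = length w /\ List.Forall (fun j => (j < k)%nat) v /\
    snd (follow k g tau w (x + IZR p, eta)) = word_fibre v x eta.
Proof.
induction 1 as [|j w hj Hw IH]; intros x p eta.
- exists nil; repeat split; constructor.
- change (follow k g tau (j :: w) (x + IZR p, eta))
    with (follow k g tau w (cotangent_branch k g tau j (x + IZR p, eta))).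
  unfold cotangent_branch; cbn [fst snd].
  set (x1 := yb j (frac_part (x + IZR p))).
  assert (E : exists n : Z, expand k g x1 = x + IZR n).
  { exists (p - Int_part (x + IZR p) + Z.of_nat j)%Z.
    unfold x1; rewrite expand_branch; unfold frac_part.
    rewrite plus_IZR, minus_IZR, <- INR_IZR_INZ; ring. }
  apply branch_preimage in E; [|lia]. destruct E as (j' & q & hj' & E).
  assert (E1 : dE x1 = dE (yb j' x)) by (rewrite E; apply periodic_Z, dE_periodic).
  assert (E2 : dtau x1 = dtau (yb j' x)) by (rewrite E; apply periodic_Z, dtau_periodic).
  rewrite E1, E2, E.
  destruct (IH (yb j' x) q (dE (yb j' x) * eta + dtau (yb j' x))) as (v & l & F & Ev).
  exists (j' :: v); repeat split; [simpl; congruence|constructor; assumption|exact Ev].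
Qed.

(** If every length had a covector that all words keep in the box, the count
    would be at least [k^n], and its exponential rate at least [ln 2]. *)
Lemma captive_escape Rk : partially_captive k g tau Rk -> exists n,
  forall eta, Rabs eta <= Rk -> exists w, length w = n /\ List.Forall (fun j => (j < k)%nat) w /\
    Rk < Rabs (word_expansion w 0 * (eta + word_slope w 0)).
Proof.
intros [N [HN L]].
apply is_lim_seq_spec in L.
assert (l2 : 0 < ln 2) by (rewrite <- ln_1; apply ln_increasing; lra).
destruct (L (mkposreal _ l2)) as [n0 H0]; specialize (H0 (S n0) ltac:(lia)).
set (n := S n0) in *; cbn [pos] in H0.
assert (lt : (N n < k ^ n)%nat).
{ apply Nat.nle_gt; intros h.
  assert (np : 0 < INR n) by (apply lt_0_INR; unfold n; lia).
  assert (B : INR n * ln 2 <= ln (INR (N n))).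
  { rewrite <- ln_pow by lra. apply ln_le; [apply pow_lt; lra|].
    apply Rle_trans with (INR (k ^ n)); [|apply le_INR, h].
    rewrite pow_INR; apply pow_incr; split; [lra|]. apply (le_INR 2), hk. }
  assert (ln 2 <= / INR n * ln (INR (N n))).
  { apply (Rmult_le_reg_l (INR n)); [assumption|].
    rewrite <- Rmult_assoc, Rinv_r, Rmult_1_l by lra; exact B. }
  rewrite Rminus_0_r in H0; apply Rabs_def2 in H0; destruct H0; lra. }
exists n; intros eta heta.
destruct (HN n) as [_ Hn]; specialize (Hn (0, eta)); cbn [fst snd] in Hn.
specialize (Hn ltac:(lra) heta).
unfold staying_count in Hn.
destruct (filter_short (fun w => if Rle_dec (Rabs (snd (follow k g tau w (0, eta)))) Rk
              then true else false) (words k n)) as [w [hw Ew]].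
{ rewrite words_length; lia. }
destruct (words_spec n w hw) as [lw Fw].
destruct (Rle_dec (Rabs (snd (follow k g tau w (0, eta)))) Rk) as [|h]; [discriminate|].
destruct (follow_word_fibre w Fw 0 0 eta) as (v & lv & Fv & Ev).
rewrite Rplus_0_l in Ev. rewrite Ev, word_fibre_eq in h.
exists v; repeat split; [congruence|assumption|lra].
Qed.

(** The covector minus the slope of the constant word must escape along some word
    of a fixed length, whose slope is therefore different. Extending this word
    to length [L] changes its slope by less than the gap, thanks to the strict
    inequality between [Rk] and the bound [T / (lam - 1)] on all slopes. *)
Lemma slope_gap Rk T : (forall y, Rabs (dtau y) <= T) -> T / (lam - 1) < Rk ->
  partially_captive k g tau Rk -> exists c0 n, 0 < c0 /\ forall L, (n <= L)%nat ->
  exists v w, length v = L /\ length w = L /\ List.Forall (fun j => (j < k)%nat) v /\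
    List.Forall (fun j => (j < k)%nat) w /\ c0 <= Rabs (word_slope v 0 - word_slope w 0).
Proof.
intros HT hR Hc.
destruct (captive_escape Rk Hc) as [n Hn].
destruct dE_bounded as [La [La1 HLa]].
set (R0 := T / (lam - 1)) in *.
assert (Lp : 0 < La ^ n) by (apply pow_lt; lra).
exists ((Rk - R0) / La ^ n), n; split; [apply Rdiv_lt_0_compat; lra|].
intros L hL.
assert (F0 : forall i, List.Forall (fun j => (j < k)%nat) (repeat 0%nat i)).
{ intros i; apply Forall_forall; intros j hj; apply repeat_spec in hj; lia. }
set (w := repeat 0%nat L).
assert (B := fun v x => word_slope_bound T v x HT). fold R0 in B.
destruct (Hn (- word_slope w 0)) as (v & lv & Fv & Hv).
{ rewrite Rabs_Ropp; specialize (B w 0); lra. }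
exists (v ++ repeat 0%nat (L - n)), w; repeat split.
- rewrite length_app, repeat_length; lia.
- apply repeat_length.
- apply Forall_app; split; [assumption|apply F0].
- apply F0.
- rewrite word_slope_app.
  assert (ep := word_expansion_pos v 0); assert (el := word_expansion_le La v 0 HLa); rewrite lv in el.
  set (e := word_expansion v 0) in *; set (s := word_slope v 0 - word_slope w 0).
  set (t := word_slope _ (word_point v 0)).
  assert (tb : Rabs t <= R0) by apply B.
  replace (word_slope v 0 + t / e - word_slope w 0) with ((e * s + t) / e) by (unfold s; field; lra).
  replace (- word_slope w 0 + word_slope v 0) with s in Hv by (unfold s; ring).
  unfold Rdiv; rewrite Rabs_mult, (Rabs_pos_eq (/ e)) by (left; apply Rinv_0_lt_compat, ep).
  apply Rmult_le_compat; [lra|left; apply Rinv_0_lt_compat, Lp| |apply Rinv_le_contravar; assumption].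
  assert (Q := Rabs_triang (e * s + t) (- t)).
  replace (e * s + t + - t) with (e * s) in Q by ring. rewrite Rabs_Ropp in Q; lra.
Qed.

(** ** Density of preimages *)

Lemma word_point_app w j x : word_point (w ++ j :: nil) x = yb j (word_point w x).
Proof. unfold word_point; rewrite fold_left_app; reflexivity. Qed.

Lemma expand_incr_dist x y : lam * Rabs (x - y) <= Rabs (expand k g x - expand k g y).
Proof.
destruct (MVT_gen (expand k g) y x (fun t => INR k * Derive g t)) as [c [_ E]].
- intros t _; apply expand_derive.
- intros t _; apply continuity_pt_filterlim, (ex_derive_continuous (V := R_NormedModule)).
  eexists; apply expand_derive.
- rewrite E, <- dE_eq, Rabs_mult, (Rabs_pos_eq (dE c)) by (left; apply dE_pos).
  apply Rmult_le_compat_r; [apply Rabs_pos|apply hlam].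
Qed.

(** Any target [z] has an orbit; the preimage of [x] found by following it
    backwards is at a distance that contracts at each step. *)
Lemma preimages_dense n : forall x z, exists w (p : Z), length w = n /\
  List.Forall (fun j => (j < k)%nat) w /\ Rabs (word_point w x + IZR p - z) <= (/ lam) ^ n.
Proof.
induction n as [|n IH]; intros x z.
- exists nil, (- Int_part (x - z))%Z; repeat split; [constructor|].
  simpl; rewrite opp_IZR; generalize (base_Int_part (x - z)); intros; apply Rabs_le; lra.
- destruct (IH x (expand k g z)) as (w & p & lw & Fw & Hw).
  set (y := lift_inv g ((word_point w x + IZR p) / INR k)).
  assert (kp := k_pos (k := k) (g := g)).
  assert (Ey : expand k g y = word_point w x + IZR p).
  { unfold expand, y; rewrite lift_K; field; lra. }
  destruct (proj1 (branch_preimage k g (word_point w x) y ltac:(lia)) (ex_intro _ p Ey)) as (j & q & hj & E).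
  exists (w ++ j :: nil), q; repeat split.
  + rewrite length_app; simpl; lia.
  + apply Forall_app; split; [assumption|constructor; [assumption|constructor]].
  + rewrite word_point_app, <- E.
    assert (K := expand_incr_dist y z). rewrite Ey in K.
    simpl; apply (Rmult_le_reg_l lam); [lra|].
    rewrite <- Rmult_assoc, Rinv_r, Rmult_1_l by lra. lra.
Qed.

Lemma preimages_dense_sqrt n x z : exists w (p : Z), length w = n /\
  List.Forall (fun j => (j < k)%nat) w /\ Rabs (word_point w x + IZR p - z) <= 1 /\
  sqrt (Rabs (word_point w x + IZR p - z)) <= theta lam ^ n.
Proof.
destruct (preimages_dense n x z) as (w & p & lw & Fw & H).
assert (il : 0 < / lam) by (apply Rinv_0_lt_compat; lra).
exists w, p; repeat split; auto.
- eapply Rle_trans; [exact H|]. rewrite <- (pow1 n); apply pow_incr; split; [lra|].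
  rewrite <- Rinv_1; apply Rinv_le_contravar; lra.
- eapply Rle_trans; [apply sqrt_le_1_alt, H|].
  right; unfold theta; clear - il; induction n as [|n IH]; simpl; [apply sqrt_1|].
  rewrite sqrt_mult, IH; [reflexivity|lra|apply pow_le; lra].
Qed.

End Words.

Arguments word_point : clear implicits.
Arguments word_phase : clear implicits.
Arguments word_slope : clear implicits.
Arguments word_expansion : clear implicits.

Section Cancellation.

Context {k : nat} {g : circle_diffeo} {lam : R} {Hexp : expanding k g lam}.
Let hk : (2 <= k)%nat := expanding_degree.
Let lam1 : 1 < lam := expanding_gt1.
Let hlam : forall x, lam <= Derive (expand k g) x := expanding_le.

Notation dE := (Derive (expand k g)).
Notation yb := (branch k g).
Notation M0 := (ruelle k g).
Notation wpt := (word_point k g).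

Variable tau : R -> R.
Hypothesis tau_smooth : smooth tau.
Hypothesis tau_periodic : periodic tau.
Variable nu : R.

Notation wphase := (word_phase k g tau).
Notation wslope := (word_slope k g tau).

(** * The twisted operator *)

Definition twist (y : R) : C := cis (- (nu * tau y)).

Definition weight (y : R) : C := Cmult (twist y) (inv_expansion k g y).

Lemma twist_smooth : smooth (fun y => - (nu * tau y)).
Proof.
intros n x. apply ex_derive_n_ext with (fun y => (- nu) * tau y); [intros; ring|].
apply ex_derive_n_scal_l, tau_smooth.
Qed.

Lemma csmooth_twist : csmooth twist.
Proof.
split; [intros x; unfold twist; rewrite tau_periodic; reflexivity|].
intros n; apply ncd_cis, twist_smooth.
Qed.

Lemma csmooth_weight : csmooth weight.
Proof. apply csmooth_mult; [apply csmooth_twist|apply csmooth_inv_expansion]. Qed.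

Lemma Cmod_twist y : Cmod (twist y) = 1.
Proof. apply Cmod_cis. Qed.

Lemma Cmod_weight y : Cmod (weight y) = / dE y.
Proof. unfold weight; rewrite Cmod_mult, Cmod_twist, Cmod_inv_expansion; ring. Qed.

Notation L := (weighted_op k g weight).
Notation Ln n f := (Nat.iter n L f).

Lemma L_mod f x : Cmod (L f x) <= M0 (fun y => Cmod (f y)) x.
Proof.
unfold weighted_op; eapply Rle_trans; [apply Cmod_branch_sum|]; right; apply rsum_ext; intros j _.
rewrite Cmod_mult, Cmod_weight; reflexivity.
Qed.

Lemma L_scal c f : L (fun y => Cmult c (f y)) = fun x => Cmult c (L f x).
Proof.
apply functional_extensionality; intros x; unfold weighted_op, branch_sum; rewrite <- csum_scal.
apply csum_ext; intros; ring.
Qed.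

Lemma Ln_scal n c f : Ln n (fun y => Cmult c (f y)) = fun x => Cmult c (Ln n f x).
Proof. induction n as [|n IH]; [reflexivity|]; simpl; rewrite IH; apply L_scal. Qed.

(** ** Bounds relative to the invariant density *)

Variable A : R.
Hypothesis A_pos : 0 < A.
Variable h : R -> R.
Hypothesis h_cone : log_holder_cone A h.
Hypothesis h_inv : forall x, M0 h x = h x.

Lemma h_posi x : 0 < h x.
Proof. apply h_cone. Qed.

Lemma L_sup K f : (forall x, Cmod (f x) <= K * h x) -> forall x, Cmod (L f x) <= K * h x.
Proof.
intros H x; eapply Rle_trans; [apply L_mod|].
eapply Rle_trans; [apply ruelle_le, H|]. rewrite ruelle_scal, h_inv; lra.
Qed.

Lemma Ln_sup n K f : (forall x, Cmod (f x) <= K * h x) -> forall x, Cmod (Ln n f x) <= K * h x.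
Proof. intros H; induction n as [|n IH]; [assumption|apply L_sup, IH]. Qed.

Lemma h_minmax : exists l u, 0 < l /\ 0 < u /\ forall x, l <= h x <= u.
Proof.
apply h_bounds; [apply h_cone|apply (cone_cont A); [lra|assumption]|apply h_cone].
Qed.

Lemma h_holder : exists B, 0 < B /\ forall x x', Rabs (x - x') <= 1 ->
  Rabs (h x - h x') <= B * sqrt (Rabs (x - x')).
Proof.
destruct h_minmax as [l [u [l0 [u0 B]]]].
exists (u * (A * exp A)); split.
{ apply Rmult_lt_0_compat; [assumption|apply Rmult_lt_0_compat; [assumption|apply exp_pos]]. }
assert (G : forall x x', Rabs (x - x') <= 1 -> h x - h x' <= u * (A * exp A) * sqrt (Rabs (x - x'))).
{ intros x x' d. assert (K := proj2 (proj2 h_cone) x x' d).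
  set (r := sqrt (Rabs (x - x'))) in *.
  assert (r0 : 0 <= r) by apply sqrt_pos. assert (r1 : r <= 1) by (apply sqrt_le_1_of, d).
  assert (e1 : exp (A * r) - 1 <= A * r * exp (A * r)).
  { assert (E := exp_ineq1_le (- (A * r))). rewrite exp_Ropp in E.
    assert (P := exp_pos (A * r)).
    apply (Rmult_le_compat_r (exp (A * r))) in E; [|lra]. rewrite Rinv_l in E by lra. lra. }
  assert (e2 : exp (A * r) <= exp A) by (apply exp_le; nra).
  assert (hx := h_posi x'). destruct (B x') as [_ hu].
  assert (e3 : A * r * exp (A * r) <= A * r * exp A) by (apply Rmult_le_compat_l; [nra|assumption]).
  assert (P := exp_pos A).
  apply Rle_trans with (h x' * (A * r * exp A)); [nra|].
  replace (u * (A * exp A) * r) with (u * (A * r * exp A)) by ring.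
  apply Rmult_le_compat_r; [|assumption]. apply Rmult_le_pos; [nra|lra]. }
intros x x' d; apply Rabs_le; split; [|apply G, d].
rewrite Rabs_minus_sym in *; specialize (G x' x d); lra.
Qed.

(** Both bounds are relative to the invariant density [h], so that an operator
    preserves the first one and, up to a multiple of it, contracts the second. *)
Definition holder_class (K B : R) (f : R -> C) : Prop :=
  (forall x, Cmod (f x) <= K * h x) /\
  forall x x', Rabs (x - x') <= 1 -> Cmod (Cminus (f x) (f x')) <= B * h x * sqrt (Rabs (x - x')).

(** A Lasota-Yorke inequality between the Hoelder constant and the uniform norm. *)
Lemma L_holder_class : exists C1, 0 < C1 /\ forall K B f, 0 <= K -> 0 <= B -> holder_class K B f ->
  holder_class K (theta lam * B + C1 * K) (L f).
Proof.
destruct h_minmax as [l [u [l0 [u0 Bd]]]].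
destruct (csmooth_lipschitz weight csmooth_weight) as [W [W0 HW]].
assert (kp : 0 < INR k) by (apply lt_0_INR; lia).
exists (INR k * (W * u) / l); split.
{ apply Rdiv_lt_0_compat; [|assumption]. repeat apply Rmult_lt_0_compat; assumption. }
intros K B f K0 B0 [H1 H2]; split; [apply L_sup, H1|].
intros x x' d; set (r := sqrt (Rabs (x - x'))).
assert (r0 : 0 <= r) by apply sqrt_pos.
assert (dr : Rabs (x - x') <= r) by (apply le_sqrt_of; split; [apply Rabs_pos|exact d]).
unfold weighted_op, branch_sum.
replace (Cminus (csum (fun j => Cmult (weight (yb j x)) (f (yb j x))) k)
  (csum (fun j => Cmult (weight (yb j x')) (f (yb j x'))) k)) with
  (Cplus (csum (fun j => Cmult (weight (yb j x)) (Cminus (f (yb j x)) (f (yb j x')))) k)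
         (csum (fun j => Cmult (Cminus (weight (yb j x)) (weight (yb j x'))) (f (yb j x'))) k)).
2:{ rewrite <- csum_plus. unfold Cminus.
    replace (Copp (csum (fun j => Cmult (weight (yb j x')) (f (yb j x'))) k)) with
     (Cmult (RtoC (-1)) (csum (fun j => Cmult (weight (yb j x')) (f (yb j x'))) k)) by (ring).
    rewrite <- csum_scal, <- csum_plus; apply csum_ext; intros; ring. }
eapply Rle_trans; [apply Cmod_triangle|].
replace ((theta lam * B + INR k * (W * u) / l * K) * h x * r) with
  (theta lam * B * r * h x + INR k * (W * r * (K * u)) * (h x / l)) by (field; lra).
apply Rplus_le_compat.
- eapply Rle_trans; [apply csum_mod|].
  rewrite <- (h_inv x) at 1; unfold ruelle; rewrite <- rsum_scal.
  apply rsum_le; intros j _. rewrite Cmod_mult, Cmod_weight.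
  replace (theta lam * B * r * (/ dE (yb j x) * h (yb j x)))
    with (/ dE (yb j x) * (theta lam * B * r * h (yb j x))) by ring.
  apply Rmult_le_compat_l; [left; apply weight_pos|].
  eapply Rle_trans; [apply H2; eapply Rle_trans; [apply branch_contr1|exact d]|].
  replace (theta lam * B * r * h (yb j x)) with (B * h (yb j x) * (theta lam * r)) by ring.
  apply Rmult_le_compat_l; [apply Rmult_le_pos; [assumption|left; apply h_posi]|apply branch_sqrt].
- eapply Rle_trans; [apply csum_mod|].
  assert (hl : 1 <= h x / l).
  { apply (Rmult_le_reg_r l); [assumption|]. unfold Rdiv; rewrite Rmult_assoc, Rinv_l by lra.
    generalize (Bd x); lra. }
  assert (P : 0 <= INR k * (W * r * (K * u))).
  { apply Rmult_le_pos; [lra|]. apply Rmult_le_pos; apply Rmult_le_pos; lra. }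
  apply Rle_trans with (INR k * (W * r * (K * u))); [|nra].
  rewrite <- rsum_const; apply rsum_le; intros j _; rewrite Cmod_mult.
  apply Rmult_le_compat; try apply Cmod_ge_0.
  + eapply Rle_trans; [apply HW|]; apply Rmult_le_compat_l; [lra|].
    eapply Rle_trans; [apply branch_contr1|exact dr].
  + eapply Rle_trans; [apply H1|]; apply Rmult_le_compat_l; [assumption|apply Bd].
Qed.

Lemma holder_class_mono K K' B B' f : K <= K' -> B <= B' -> holder_class K B f -> holder_class K' B' f.
Proof.
intros hK hB [H1 H2]; split.
- intros x; eapply Rle_trans; [apply H1|]; apply Rmult_le_compat_r; [left; apply h_posi|assumption].
- intros x x' d; eapply Rle_trans; [apply H2, d|].
  apply Rmult_le_compat_r; [apply sqrt_pos|]; apply Rmult_le_compat_r; [left; apply h_posi|assumption].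
Qed.

Lemma holder_class_scal c K B f : 0 <= c -> holder_class K B f -> holder_class (c * K) (c * B) (fun x => Cmult (RtoC c) (f x)).
Proof.
intros hc [H1 H2].
assert (E : Cmod (RtoC c) = c) by (rewrite Cmod_R; apply Rabs_pos_eq, hc).
split.
- intros x; rewrite Cmod_mult, E, Rmult_assoc; apply Rmult_le_compat_l; auto.
- intros x x' d.
  replace (Cminus (Cmult (RtoC c) (f x)) (Cmult (RtoC c) (f x')))
    with (Cmult (RtoC c) (Cminus (f x) (f x'))) by ring.
  rewrite Cmod_mult, E, !Rmult_assoc; apply Rmult_le_compat_l; [assumption|].
  rewrite <- Rmult_assoc; auto.
Qed.

(** ** Near-equality in the triangle inequality *)

(** If a sum of terms of moduli at most [h / E'], with total [h x], nearly attains
    this total, then each term is nearly maximal and has nearly the common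
    phase. *)
Lemma near_step u psi x d j : Cmod u = 1 -> (forall y, Cmod (psi y) <= h y) -> (j < k)%nat ->
  h x - d <= fst (Cmult u (L psi x)) ->
  h (yb j x) - d * dE (yb j x) <= fst (Cmult (Cmult u (twist (yb j x))) (psi (yb j x))).
Proof.
intros hu hp hj H.
set (t := fun j => / dE (yb j x) * (h (yb j x) - fst (Cmult (Cmult u (twist (yb j x))) (psi (yb j x))))).
assert (S : rsum t k <= d).
{ replace (rsum t k) with (M0 h x - fst (Cmult u (L psi x))).
  - rewrite h_inv; lra.
  - unfold weighted_op, branch_sum; rewrite <- csum_scal, csum_fst. unfold ruelle, Rminus.
    replace (- rsum (fun i => fst (Cmult u (Cmult (weight (yb i x)) (psi (yb i x))))) k) with
      (-1 * rsum (fun i => fst (Cmult u (Cmult (weight (yb i x)) (psi (yb i x))))) k) by ring.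
    rewrite <- rsum_scal, <- rsum_plus; apply rsum_ext; intros i _; unfold t, weight, inv_expansion.
    destruct u, (twist (yb i x)), (psi (yb i x)); simpl; ring. }
assert (T0 : forall i, (i < k)%nat -> 0 <= t i).
{ intros i _; apply Rmult_le_pos; [left; apply weight_pos|].
  assert (K : fst (Cmult (Cmult u (twist (yb i x))) (psi (yb i x))) <= h (yb i x)).
  { eapply Rle_trans; [apply Rle_abs|]. eapply Rle_trans; [apply fst_le_Cmod|].
    rewrite !Cmod_mult, hu, Cmod_twist, !Rmult_1_l; apply hp. }
  lra. }
assert (Tj := rsum_term_le t k j T0 hj). unfold t at 1 in Tj.
assert (dy := dE_pos (yb j x)).
assert (Q : h (yb j x) - fst (Cmult (Cmult u (twist (yb j x))) (psi (yb j x))) <= d * dE (yb j x)).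
{ apply (Rmult_le_reg_l (/ dE (yb j x))); [apply weight_pos|].
  replace (/ dE (yb j x) * (d * dE (yb j x))) with d by (field; lra). lra. }
lra.
Qed.

(** The iterated form. The defect is amplified at most by the expansion along the
    word, a bounded factor for words of bounded length. *)
Lemma near_word La w : (forall y, dE y <= La) -> List.Forall (fun j => (j < k)%nat) w ->
  forall u psi x d, Cmod u = 1 -> 0 <= d -> (forall y, Cmod (psi y) <= h y) ->
  h x - d <= fst (Cmult u (Ln (length w) psi x)) ->
  h (wpt w x) - d * La ^ length w <=
    fst (Cmult (Cmult u (cis (- (nu * wphase w x)))) (psi (wpt w x))).
Proof.
intros HL; induction 1 as [|j w hj Hw IH]; intros u psi x d hu hd hp H.
- cbn [length Nat.iter word_phase] in *. rewrite Rmult_0_r, Ropp_0, cis_0.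
  change (wpt nil x) with x. replace (Cmult u (RtoC 1)) with u by ring. cbn [pow]; change (Ln 0 psi) with psi in H; lra.
- cbn [length Nat.iter] in H.
  assert (hL : forall y, Cmod (Ln (length w) psi y) <= h y).
  { intros y; rewrite <- (Rmult_1_l (h y)); apply Ln_sup; intros t; rewrite Rmult_1_l; apply hp. }
  assert (S := near_step u (Ln (length w) psi) x d j hu hL hj H).
  assert (dy := dE_pos (yb j x)).
  assert (S' := IH (Cmult u (twist (yb j x))) psi (yb j x) (d * dE (yb j x))).
  rewrite Cmod_mult, hu, Cmod_twist in S'.
  specialize (S' ltac:(ring) ltac:(nra) hp S).
  change (wpt (j :: w) x) with (wpt w (yb j x)).
  cbn [length word_phase pow].
  replace (- (nu * (tau (yb j x) + wphase w (yb j x)))) with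
    (- (nu * tau (yb j x)) + - (nu * wphase w (yb j x))) by ring.
  rewrite cis_plus; unfold twist in S'. rewrite Cmult_assoc.
  eapply Rle_trans; [|exact S'].
  assert (p : 0 <= La ^ length w) by (apply pow_le; specialize (HL 0); generalize (dE_pos 0); lra).
  assert (d * dE (yb j x) * La ^ length w <= d * (La * La ^ length w)); [|lra].
  rewrite Rmult_assoc; apply Rmult_le_compat_l; [assumption|].
  apply Rmult_le_compat_r; [assumption|apply HL].
Qed.

Lemma unit_align (z : C) : exists u, Cmod u = 1 /\ fst (Cmult u z) = Cmod z.
Proof.
destruct (Req_dec (Cmod z) 0) as [E|E].
- exists (RtoC 1); split; [apply Cmod_1|]. rewrite (Cmod_eq_0 z E), Cmod_0; simpl; ring.
- assert (P := Cmod_ge_0 z).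
  exists (Cmult (RtoC (/ Cmod z)) (Cconj z)); split.
  + rewrite Cmod_mult, Cmod_conj, Cmod_R, Rabs_pos_eq; [field; exact E|].
    left; apply Rinv_0_lt_compat; lra.
  + rewrite <- Cmult_assoc.
    replace (fst (Cmult (RtoC (/ Cmod z)) (Cmult (Cconj z) z))) with (/ Cmod z * Cmod z ^ 2).
    * field; exact E.
    * rewrite Cmod_sqr; destruct z; simpl; ring.
Qed.

(** Because [|z - H|^2 = |z|^2 + H^2 - 2 H Re z]. *)
Lemma near_real z H e : Cmod z <= H -> H - e <= fst z -> Cmod (Cminus z (RtoC H)) <= sqrt (2 * H * e).
Proof.
intros h1 h2; apply sqr_le_sqrt; [apply Cmod_ge_0|].
assert (P := Cmod_ge_0 z).
assert (Q : Cmod z ^ 2 <= H ^ 2) by (apply pow_incr; lra).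
rewrite Cmod_sqr in *; destruct z as [a b]; simpl in *. nra.
Qed.

Lemma rotation_gap a c : 0 <= c <= Rabs a -> Rabs a <= 1 -> sin c <= Cmod (Cminus (cis a) (RtoC 1)).
Proof.
intros [c0 ca] a1.
assert (pi : 3 < PI) by (generalize PI2_3_2; unfold PI2; lra).
apply Rle_trans with (Rabs (sin a)).
- apply Rle_trans with (sin (Rabs a)).
  + apply sin_incr_1; lra.
  + unfold Rabs at 1; destruct (Rcase_abs a); [rewrite sin_neg; rewrite <- Rabs_Ropp|]; apply Rle_abs.
- eapply Rle_trans; [|apply snd_le_Cmod]. right; f_equal; unfold cis, Cminus, Cplus, Copp, RtoC; simpl; ring.
Qed.

(** Suppose the operator nearly attained its bound [h] at both 0 and [x1]. Then,
    along every word, the phases acquired between these points would nearly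
    agree, since the values of [f] at the two ends of a long word are nearly
    equal. But two words with different slopes turn by different angles between
    0 and [x1]. *)
Lemma two_point_loss Rk T B : nu <> 0 -> 0 < B -> (forall y, Rabs (Derive tau y) <= T) ->
  T / (lam - 1) < Rk -> partially_captive k g tau Rk ->
  exists N d x1, (0 < N)%nat /\ 0 < d /\ forall f, holder_class 1 B f ->
    Cmod (Ln N f 0) < h 0 - d \/ Cmod (Ln N f x1) < h x1 - d.
Proof.
intros nu0 B0 HT hR Hc.
destruct (slope_gap tau tau_smooth tau_periodic Rk T HT hR Hc) as (c0 & n & c0p & Hgap).
destruct (word_slope_lipschitz (k := k) (g := g) tau tau_smooth tau_periodic) as [D [D0 HD]].
destruct (dE_bounded (k := k) (g := g)) as [La [La1 HLa]].
destruct h_minmax as [hl [hu [hl0 [hu0 Hb]]]].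
destruct h_holder as [Bh [Bh0 HBh]].
assert (T0 : 0 <= T) by (eapply Rle_trans; [apply Rabs_pos|apply (HT 0)]).
set (R0 := T / (lam - 1)) in *.
assert (R00 : 0 <= R0) by (apply Rmult_le_pos; [assumption|left; apply Rinv_0_lt_compat; lra]).
assert (nup : 0 < Rabs nu) by (apply Rabs_pos_lt, nu0).
(* On [0, r] the slopes of the two words stay apart by [c0 / 2], and their phases
   turn by an angle of at most 1 relative to each other. *)
set (r := Rmin 1 (Rmin (c0 / (4 * D)) (/ (Rabs nu * (2 * R0 + 1))))).
assert (r0 : 0 < r).
{ repeat apply Rmin_pos; [lra|apply Rdiv_lt_0_compat; lra|apply Rinv_0_lt_compat; nra]. }
assert (r1 : r <= 1) by apply Rmin_l.
assert (r2 : 2 * D * r <= c0 / 2).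
{ assert (r <= c0 / (4 * D)) by (eapply Rle_trans; [apply Rmin_r|apply Rmin_l]).
  apply Rle_trans with (2 * D * (c0 / (4 * D))); [apply Rmult_le_compat_l; lra|right; field; lra]. }
assert (r3 : Rabs nu * (2 * R0) * r <= 1).
{ assert (K : r <= / (Rabs nu * (2 * R0 + 1))) by (eapply Rle_trans; [apply Rmin_r|apply Rmin_r]).
  apply Rle_trans with (Rabs nu * (2 * R0 + 1) * / (Rabs nu * (2 * R0 + 1))).
  - apply Rmult_le_compat; [nra|lra| |exact K]. apply Rmult_le_compat_l; lra.
  - right; apply Rinv_r; nra. }
set (c1 := Rabs nu * (c0 / 2) * r).
assert (c1p : 0 < c1) by (unfold c1; repeat apply Rmult_lt_0_compat; lra).
assert (SB : forall w y, Rabs (wslope w y) <= R0) by (intros; apply word_slope_bound, HT).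
assert (c02 : c0 <= 2 * R0).
{ destruct (Hgap n (le_n n)) as (v & w & _ & _ & _ & _ & G).
  assert (K1 := SB v 0); assert (K2 := SB w 0).
  eapply Rle_trans; [exact G|]; eapply Rle_trans; [apply Rabs_triang|]; rewrite Rabs_Ropp; lra. }
assert (c11 : c1 <= 1).
{ eapply Rle_trans; [|exact r3]; unfold c1.
  apply Rmult_le_compat_r; [lra|]; apply Rmult_le_compat_l; lra. }
set (c2 := sin c1).
assert (c2p : 0 < c2 <= 1).
{ split; [|apply SIN_bound]. apply sin_gt_0; [assumption|]. generalize PI2_3_2; unfold PI2; lra. }
assert (th := theta_range (k := k) (g := g) (lam := lam)).
(* Each of the two words contributes an error 6 e0 / hl to the comparison of
   the angles, so the total stays below the gap [c2]. *)
set (e0 := hl * c2 / 32).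
assert (e0p : 0 < e0) by (unfold e0; nra).
assert (BB : 0 < B * hu + Bh) by nra.
destruct (pow_small (theta lam) (e0 / (B * hu + Bh))) as [n' Hn'];
  [lra|apply Rdiv_lt_0_compat; assumption|].
set (N := S (n + n')).
assert (LN : 0 < La ^ N) by (apply pow_lt; lra).
set (d := e0 ^ 2 / (2 * hu * La ^ N)).
assert (dp : 0 < d) by (apply Rdiv_lt_0_compat; [apply pow_lt, e0p|nra]).
assert (thN : (B * hu + Bh) * theta lam ^ N <= e0).
{ apply Rle_trans with ((B * hu + Bh) * (e0 / (B * hu + Bh))).
  - apply Rmult_le_compat_l; [lra|apply Hn'; unfold N; lia].
  - right; field; lra. }
exists N, d, r; repeat split; [unfold N; lia|assumption|].
intros f Hf.
destruct (Rlt_le_dec (Cmod (Ln N f 0)) (h 0 - d)) as [|H0]; [left; assumption|].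
destruct (Rlt_le_dec (Cmod (Ln N f r)) (h r - d)) as [|H1]; [right; assumption|exfalso].
assert (fh : forall y, Cmod (f y) <= h y) by (intros y; rewrite <- (Rmult_1_l (h y)); apply Hf).
destruct (unit_align (Ln N f 0)) as [u0 [U0 E0]].
destruct (unit_align (Ln N f r)) as [u1 [U1 E1]].
assert (near : forall w u x, List.Forall (fun j => (j < k)%nat) w -> length w = N -> Cmod u = 1 ->
  h x - d <= fst (Cmult u (Ln N f x)) ->
  Cmod (Cminus (Cmult (Cmult u (cis (- (nu * wphase w x)))) (f (wpt w x))) (RtoC (h (wpt w x)))) <= e0).
{ intros w u x Fw lw hu1 Hx.
  rewrite <- lw in Hx.
  assert (K := near_word La w HLa Fw u f x d hu1 (Rlt_le _ _ dp) fh Hx).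
  eapply Rle_trans; [apply near_real; [|exact K]|].
  - rewrite !Cmod_mult, hu1, Cmod_cis, !Rmult_1_l; apply fh.
  - rewrite lw, <- (sqrt_pow2 e0) by lra. apply sqrt_le_1_alt.
    apply Rle_trans with (2 * hu * (d * La ^ N)).
    + apply Rmult_le_compat_r; [nra|]. apply Rmult_le_compat_l; [lra|apply Hb].
    + right; unfold d; field; lra. }
assert (key : forall w, List.Forall (fun j => (j < k)%nat) w -> length w = N ->
  Cmod (Cminus (Cmult u1 (cis (- (nu * (wphase w r - wphase w 0))))) u0) <= 6 * e0 / hl).
{ intros w Fw lw.
  assert (N0 := near w u0 0 Fw lw U0 ltac:(rewrite E0; exact H0)).
  assert (N1 := near w u1 r Fw lw U1 ltac:(rewrite E1; exact H1)).
  set (y0 := wpt w 0) in *; set (y1 := wpt w r) in *.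
  assert (sq : sqrt (Rabs (y0 - y1)) <= theta lam ^ N).
  { assert (K := word_point_sqrt (k := k) (g := g) w 0 r). rewrite lw in K; fold y0 y1 in K.
    eapply Rle_trans; [exact K|].
    assert (sqrt (Rabs (0 - r)) <= 1).
    { apply sqrt_le_1_of; rewrite Rabs_minus_sym, Rminus_0_r, Rabs_pos_eq; lra. }
    assert (0 <= theta lam ^ N) by (apply pow_le; lra). nra. }
  assert (y01 : Rabs (y0 - y1) <= 1).
  { assert (K : theta lam ^ N <= 1) by (rewrite <- (pow1 N); apply pow_incr; lra).
    rewrite <- (sqrt_sqrt (Rabs (y0 - y1))) by apply Rabs_pos.
    assert (P := sqrt_pos (Rabs (y0 - y1))); nra. }
  assert (F01 : Cmod (Cminus (f y0) (f y1)) <= B * hu * theta lam ^ N).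
  { eapply Rle_trans; [apply (proj2 Hf), y01|].
    apply Rmult_le_compat; [|apply sqrt_pos| |exact sq].
    - apply Rmult_le_pos; [lra|left; apply h_posi].
    - apply Rmult_le_compat_l; [lra|apply Hb]. }
  assert (H01 : Rabs (h y0 - h y1) <= Bh * theta lam ^ N).
  { eapply Rle_trans; [apply HBh, y01|]. apply Rmult_le_compat_l; lra. }
  set (a0 := cis (- (nu * wphase w 0))) in *; set (a1 := cis (- (nu * wphase w r))) in *.
  assert (A0 : Cmod a0 = 1) by apply Cmod_cis. assert (A1 : Cmod a1 = 1) by apply Cmod_cis.
  assert (pb : hl / 2 <= Cmod (f y0)).
  { assert (K := Cmod_triangle_minus (RtoC (h y0)) (Cmult (Cmult u0 a0) (f y0))).
    rewrite Cmod_minus_sym, !Cmod_mult, U0, A0, !Rmult_1_l, Cmod_R, Rabs_pos_eq in K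
      by (left; apply h_posi).
    generalize (Hb y0); unfold e0 in *; nra. }
  assert (Q : Cmod (Cmult (f y0) (Cminus (Cmult u1 a1) (Cmult u0 a0))) <= 3 * e0).
  { replace (Cmult (f y0) (Cminus (Cmult u1 a1) (Cmult u0 a0))) with
     (Cplus (Cplus (Cminus (Cmult (Cmult u1 a1) (f y1)) (RtoC (h y1)))
                   (Cmult (Cmult u1 a1) (Cminus (f y0) (f y1))))
            (Cplus (Cminus (RtoC (h y1)) (RtoC (h y0)))
                   (Cminus (RtoC (h y0)) (Cmult (Cmult u0 a0) (f y0))))) by ring.
    assert (K1 := Cmod_triangle (Cplus (Cminus (Cmult (Cmult u1 a1) (f y1)) (RtoC (h y1)))
                   (Cmult (Cmult u1 a1) (Cminus (f y0) (f y1))))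
                   (Cplus (Cminus (RtoC (h y1)) (RtoC (h y0)))
                   (Cminus (RtoC (h y0)) (Cmult (Cmult u0 a0) (f y0))))).
    assert (K2 := Cmod_triangle (Cminus (Cmult (Cmult u1 a1) (f y1)) (RtoC (h y1)))
                   (Cmult (Cmult u1 a1) (Cminus (f y0) (f y1)))).
    assert (K3 := Cmod_triangle (Cminus (RtoC (h y1)) (RtoC (h y0)))
                   (Cminus (RtoC (h y0)) (Cmult (Cmult u0 a0) (f y0)))).
    rewrite (Cmod_minus_sym (RtoC (h y0)) (Cmult (Cmult u0 a0) (f y0))) in K3.
    assert (K4 : Cmod (Cminus (RtoC (h y1)) (RtoC (h y0))) = Rabs (h y0 - h y1)).
    { rewrite <- RtoC_minus, Cmod_R; apply Rabs_minus_sym. }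
    assert (K5 : Cmod (Cmult (Cmult u1 a1) (Cminus (f y0) (f y1))) = Cmod (Cminus (f y0) (f y1))).
    { rewrite !Cmod_mult, U1, A1; ring. }
    lra. }
  rewrite Cmod_mult in Q.
  assert (Ed : Cminus (Cmult u1 (cis (- (nu * (wphase w r - wphase w 0))))) u0 =
    Cmult (cis (nu * wphase w 0)) (Cminus (Cmult u1 a1) (Cmult u0 a0))).
  { replace (- (nu * (wphase w r - wphase w 0))) with (nu * wphase w 0 + - (nu * wphase w r)) by ring.
    rewrite cis_plus; fold a1.
    assert (I : Cmult (cis (nu * wphase w 0)) a0 = RtoC 1).
    { unfold a0; rewrite <- cis_plus, Rplus_opp_r; apply cis_0. }
    replace (Cmult (cis (nu * wphase w 0)) (Cminus (Cmult u1 a1) (Cmult u0 a0))) with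
      (Cminus (Cmult u1 (Cmult (cis (nu * wphase w 0)) a1)) (Cmult u0 (Cmult (cis (nu * wphase w 0)) a0)))
      by ring.
    rewrite I; ring. }
  rewrite Ed, Cmod_mult, Cmod_cis, Rmult_1_l.
  set (q := Cmod (Cminus (Cmult u1 a1) (Cmult u0 a0))) in *.
  assert (q0 : 0 <= q) by apply Cmod_ge_0.
  apply (Rmult_le_reg_l hl); [assumption|].
  replace (hl * (6 * e0 / hl)) with (6 * e0) by (field; lra). nra. }
destruct (Hgap N ltac:(unfold N; lia)) as (v & w & lv & lw & Fv & Fw & G).
assert (Kv := key v Fv lv); assert (Kw := key w Fw lw).
set (av := - (nu * (wphase v r - wphase v 0))) in *.
set (aw := - (nu * (wphase w r - wphase w 0))) in *.
assert (dd : forall x, is_derive (fun x => wphase v x - wphase w x) x (wslope v x - wslope w x)).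
{ intros x; assert (dv := word_phase_derive tau tau_smooth v x).
  assert (dw := word_phase_derive tau tau_smooth w x).
  exact (is_derive_minus _ _ _ _ _ dv dw). }
destruct (MVT_gen (fun x => wphase v x - wphase w x) 0 r (fun x => wslope v x - wslope w x)) as [xi [hxi Exi]].
{ intros x _; apply dd. }
{ intros x _; apply continuity_pt_filterlim.
  exact (ex_derive_continuous (V := R_NormedModule) (fun x => wphase v x - wphase w x) x
    (ex_intro _ _ (dd x))). }
rewrite Rmin_left, Rmax_right in hxi by lra.
set (s := wslope v xi - wslope w xi) in *.
assert (s1 : c0 / 2 <= Rabs s).
{ assert (D1 := HD v 0 xi); assert (D2 := HD w 0 xi).
  assert (X : Rabs (0 - xi) <= r) by (rewrite Rabs_minus_sym, Rminus_0_r, Rabs_pos_eq; lra).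
  assert (D * Rabs (0 - xi) <= D * r) by (apply Rmult_le_compat_l; lra).
  assert (T1 := Rabs_triang s ((wslope v 0 - wslope v xi) - (wslope w 0 - wslope w xi))).
  replace (s + (wslope v 0 - wslope v xi - (wslope w 0 - wslope w xi)))
    with (wslope v 0 - wslope w 0) in T1 by (unfold s; ring).
  assert (T2 := Rabs_triang (wslope v 0 - wslope v xi) (- (wslope w 0 - wslope w xi))).
  rewrite Rabs_Ropp in T2. unfold Rminus in *; lra. }
assert (s2 : Rabs s <= 2 * R0).
{ assert (K1 := SB v xi); assert (K2 := SB w xi).
  unfold s; eapply Rle_trans; [apply Rabs_triang|]; rewrite Rabs_Ropp; lra. }
assert (Ea : av - aw = - (nu * (s * r))).
{ unfold av, aw. rewrite Rminus_0_r in Exi. rewrite <- Exi; ring. }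
assert (Ra : Rabs (av - aw) = Rabs nu * Rabs s * r).
{ rewrite Ea, Rabs_Ropp, !Rabs_mult, (Rabs_pos_eq r) by lra; ring. }
assert (gap := rotation_gap (av - aw) c1).
fold c2 in gap.
assert (gap' : c2 <= Cmod (Cminus (cis (av - aw)) (RtoC 1))).
{ apply gap; rewrite Ra; [split; [lra|unfold c1]|].
  - apply Rmult_le_compat_r; [lra|]; apply Rmult_le_compat_l; lra.
  - eapply Rle_trans; [|exact r3]. apply Rmult_le_compat_r; [lra|]; apply Rmult_le_compat_l; lra. }
assert (Efin : Cmod (Cminus (cis (av - aw)) (RtoC 1)) =
  Cmod (Cminus (Cmult u1 (cis av)) (Cmult u1 (cis aw)))).
{ rewrite <- (Rmult_1_l (Cmod (Cminus (cis (av - aw)) (RtoC 1)))).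
  rewrite <- (Rmult_1_l 1) at 1. rewrite <- U1 at 1; rewrite <- (Cmod_cis aw) at 1.
  rewrite <- !Cmod_mult; f_equal.
  replace (cis av) with (Cmult (cis aw) (cis (av - aw))) by (rewrite <- cis_plus; f_equal; ring).
  ring. }
assert (Sp := Cmod_split (Cmult u1 (cis av)) u0 (Cmult u1 (cis aw))).
rewrite (Cmod_minus_sym u0) in Sp.
assert (6 * e0 / hl = 6 * c2 / 32) by (unfold e0; field; lra).
lra.
Qed.

(** By density every point has a preimage close to [z]; near equality at the
    point would propagate to this preimage and, by Hoelder continuity, to [z]. *)
Lemma loss_spreads B d : 0 < B -> 0 < d -> exists n d1, 0 < d1 /\
  forall f z, periodic f -> holder_class 1 B f -> Cmod (f z) < h z - d ->
  forall x, Cmod (Ln n f x) < h x - d1.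
Proof.
intros B0 d0.
destruct (dE_bounded (k := k) (g := g)) as [La [La1 HLa]].
destruct h_minmax as [hl [hu [hl0 [hu0 Hb]]]].
destruct h_holder as [Bh [Bh0 HBh]].
assert (BB : 0 < B * hu + Bh) by nra.
assert (th := theta_range (k := k) (g := g) (lam := lam)).
destruct (pow_small (theta lam) (d / 2 / (B * hu + Bh))) as [n Hn];
  [lra|apply Rdiv_lt_0_compat; lra|].
specialize (Hn n (le_n n)).
assert (LN : 0 < La ^ n) by (apply pow_lt; lra).
exists n, (d / (2 * La ^ n)); split; [apply Rdiv_lt_0_compat; lra|].
intros f z P Hf Hz x.
assert (fh : forall y, Cmod (f y) <= h y) by (intros y; rewrite <- (Rmult_1_l (h y)); apply Hf).
apply Rnot_le_lt; intros H.
destruct (preimages_dense_sqrt (k := k) (g := g) (lam := lam) n x z) as (w & p & lw & Fw & d1 & d2).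
set (y := wpt w x + IZR p) in *.
destruct (unit_align (Ln n f x)) as [u [Hu E]].
rewrite <- E, <- lw in H.
assert (dL : 0 <= d / (2 * La ^ n)) by (left; apply Rdiv_lt_0_compat; lra).
rewrite <- lw in dL.
assert (K := near_word La w HLa Fw u f x _ Hu dL fh H).
rewrite lw in K.
replace (d / (2 * La ^ n) * La ^ n) with (d / 2) in K by (field; lra).
assert (K' : h y - d / 2 <= Cmod (f y)).
{ unfold y; rewrite (periodic_Z f P), (periodic_Z h (proj1 h_cone)).
  eapply Rle_trans; [exact K|]. eapply Rle_trans; [apply Rle_abs|].
  eapply Rle_trans; [apply fst_le_Cmod|]. rewrite !Cmod_mult, Hu, Cmod_cis; lra. }
assert (F1 : Cmod (Cminus (f y) (f z)) <= B * hu * theta lam ^ n).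
{ eapply Rle_trans; [apply (proj2 Hf), d1|].
  apply Rmult_le_compat; [|apply sqrt_pos| |exact d2].
  - apply Rmult_le_pos; [lra|left; apply h_posi].
  - apply Rmult_le_compat_l; [lra|apply Hb]. }
assert (H1 : Rabs (h y - h z) <= Bh * theta lam ^ n).
{ eapply Rle_trans; [apply HBh, d1|]. apply Rmult_le_compat_l; lra. }
apply Rabs_le_between in H1.
assert (T := Cmod_triangle_minus (f y) (f z)).
assert (S : (B * hu + Bh) * theta lam ^ n <= d / 2).
{ apply Rle_trans with ((B * hu + Bh) * (d / 2 / (B * hu + Bh))).
  - apply Rmult_le_compat_l; lra.
  - right; field; lra. }
lra.
Qed.

Lemma L_periodic f : periodic f -> periodic (L f).
Proof.
intros P; apply (csum_branch_periodic (fun y => Cmult (weight y) (f y))).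
intros x; rewrite P, (proj1 csmooth_weight); reflexivity.
Qed.

Lemma Ln_periodic n f : periodic f -> periodic (Ln n f).
Proof. intros P; induction n as [|n IH]; [assumption|apply L_periodic, IH]. Qed.

Lemma bernoulli x n : 0 <= x <= 1 -> 1 - INR n * x <= (1 - x) ^ n.
Proof.
intros hx; induction n as [|n IH]; [simpl; lra|].
rewrite S_INR; simpl pow. assert (0 <= INR n) by apply pos_INR.
assert ((1 - x) * (1 - INR n * x) <= (1 - x) * (1 - x) ^ n) by (apply Rmult_le_compat_l; lra).
nra.
Qed.

(** A bounded number of steps reduces the bounds of a function in the Hoelder
    class by a fixed factor, and the argument can be repeated after rescaling. *)
Theorem twisted_decay Rk T : nu <> 0 -> (forall y, Rabs (Derive tau y) <= T) ->
  T / (lam - 1) < Rk -> partially_captive k g tau Rk ->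
  exists C r, 0 <= C /\ 0 < r < 1 /\ forall f K, 0 <= K -> periodic f ->
    (forall x, Cmod (f x) <= K) ->
    (forall x x', Rabs (x - x') <= 1 -> Cmod (Cminus (f x) (f x')) <= K * sqrt (Rabs (x - x'))) ->
    forall n x, Cmod (Ln n f x) <= C * K * r ^ n.
Proof.
intros nu0 HT hR Hc.
assert (th := theta_range (k := k) (g := g) (lam := lam)).
destruct L_holder_class as [C1 [C10 HL]].
destruct h_minmax as [hl [hu [hl0 [hu0 Hb]]]].
(* With this constant the Lasota-Yorke inequality maps the class with bounds
   (1, B) into the one with bounds (1, s B). *)
set (B := 1 + 2 * C1 / (1 - theta lam)).
set (s := (1 + theta lam) / 2).
assert (B1 : 0 < 2 * C1 / (1 - theta lam)) by (apply Rdiv_lt_0_compat; lra).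
assert (B0 : 0 < B) by (unfold B; lra).
assert (sB : theta lam * B + C1 * 1 <= s * B).
{ unfold s. assert (2 * C1 = (B - 1) * (1 - theta lam)) by (unfold B; field; lra). nra. }
assert (s1 : 0 < s < 1) by (unfold s; lra).
destruct (two_point_loss Rk T B nu0 B0 HT hR Hc) as (N1 & d & x1 & N1p & d0 & H1).
destruct (loss_spreads B d B0 d0) as (n2 & d1 & d10 & H2).
set (N := (n2 + N1)%nat).
assert (stepH : forall f, holder_class 1 B f -> holder_class 1 (s * B) (L f)).
{ intros f Hf; eapply holder_class_mono; [apply Rle_refl|exact sB|]. apply HL; auto; lra. }
assert (itH : forall n f, holder_class 1 B f -> holder_class 1 B (Ln n f)).
{ induction n as [|n IH]; intros f Hf; [assumption|].
  eapply holder_class_mono; [apply Rle_refl| |apply (stepH (Ln n f)), IH, Hf]. nra. }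
set (q := Rmax s (1 - d1 / hu)).
assert (dh : 0 < d1 / hu) by (apply Rdiv_lt_0_compat; assumption).
assert (q1 : 0 < q < 1).
{ unfold q; split; [eapply Rlt_le_trans; [|apply Rmax_l]; lra|apply Rmax_lub_lt; lra]. }
assert (contr : forall f, periodic f -> holder_class 1 B f -> holder_class q (q * B) (Ln N f)).
{ intros f P Hf; split.
  - intros x. assert (X : Cmod (Ln N f x) < h x - d1).
    { unfold N; rewrite Nat.iter_add.
      destruct (H1 f Hf) as [Z|Z]; eapply H2; try exact Z; auto; apply Ln_periodic, P. }
    apply Rle_trans with ((1 - d1 / hu) * h x).
    + assert (d1 / hu * h x <= d1); [|lra].
      apply Rle_trans with (d1 / hu * hu); [apply Rmult_le_compat_l; [lra|apply Hb]|right; field; lra].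
    + apply Rmult_le_compat_r; [left; apply h_posi|apply Rmax_r].
  - assert (E : exists M, N = S M) by (exists (pred N); unfold N; lia).
    destruct E as [M ->].
    assert (K : holder_class 1 (s * B) (Ln (S M) f)) by (apply (stepH (Ln M f)), itH, Hf).
    eapply holder_class_mono; [apply Rle_refl| |exact K].
    apply Rmult_le_compat_r; [lra|apply Rmax_l]. }
assert (descale : forall c f, 0 < c -> holder_class c (c * B) f -> exists f', holder_class 1 B f' /\
   f = fun x => Cmult (RtoC c) (f' x)).
{ intros c f hc Hf; exists (fun x => Cmult (RtoC (/ c)) (f x)); split.
  - replace 1 with (/ c * c) by (field; lra). replace B with (/ c * (c * B)) by (field; lra).
    apply holder_class_scal; [left; apply Rinv_0_lt_compat, hc|exact Hf].
  - apply functional_extensionality; intros x.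
    rewrite Cmult_assoc, <- RtoC_mult, Rinv_r by lra; ring. }
assert (iter : forall j c f, 0 < c -> periodic f -> holder_class c (c * B) f ->
  holder_class (q ^ j * c) (q ^ j * c * B) (Ln (N * j) f)).
{ induction j as [|j IH]; intros c f hc P Hf.
  - rewrite Nat.mul_0_r; simpl; rewrite Rmult_1_l; exact Hf.
  - replace (N * S j)%nat with (N + N * j)%nat by lia. rewrite Nat.iter_add.
    assert (qj : 0 < q ^ j) by (apply pow_lt; lra).
    assert (qc : 0 < q ^ j * c) by (apply Rmult_lt_0_compat; assumption).
    destruct (descale _ _ qc (IH c f hc P Hf)) as [f' [Hf' E]].
    assert (P' : periodic f').
    { intros x. assert (Q := Ln_periodic (N * j) f P x); rewrite E in Q.
      apply (f_equal (Cmult (RtoC (/ (q ^ j * c))))) in Q.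
      rewrite !Cmult_assoc, <- RtoC_mult, Rinv_l, !Cmult_1_l in Q by lra; exact Q. }
    rewrite E, Ln_scal.
    replace (q ^ S j * c) with (q ^ j * c * q) by (simpl; ring).
    replace (q ^ j * c * q * B) with (q ^ j * c * (q * B)) by ring.
    apply holder_class_scal; [lra|apply contr; assumption]. }
assert (Np : (0 < N)%nat) by (unfold N; lia).
assert (NR : 1 <= INR N) by (apply (le_INR 1); lia).
set (r := 1 - (1 - q) / INR N).
assert (Nq : 0 < (1 - q) / INR N <= 1 - q).
{ split; [apply Rdiv_lt_0_compat; lra|].
  unfold Rdiv; rewrite <- (Rmult_1_r (1 - q)) at 2; apply Rmult_le_compat_l; [lra|].
  rewrite <- Rinv_1; apply Rinv_le_contravar; lra. }
assert (r1 : 0 < r < 1) by (unfold r; lra).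
(* A substitute for the [N]-th root of [q], by Bernoulli's inequality. *)
assert (rN : q <= r ^ N).
{ eapply Rle_trans; [|apply bernoulli; lra]. right; field; lra. }
assert (rNp : 0 < r ^ N) by (apply pow_lt; lra).
exists (hu / hl / r ^ N), r; split.
{ left; repeat apply Rdiv_lt_0_compat; assumption. }
split; [assumption|].
intros f K K0 P F1 F2 n x.
assert (rn : 0 < r ^ n) by (apply pow_lt; lra).
destruct (Rle_lt_or_eq_dec 0 K K0) as [Kp|<-].
2:{ rewrite Rmult_0_r, Rmult_0_l, <- (Rmult_0_l (h x)); apply Ln_sup.
    intros y; rewrite Rmult_0_l; apply F1. }
set (c := K / hl).
assert (cp : 0 < c) by (apply Rdiv_lt_0_compat; assumption).
assert (Kc : forall y, K <= c * h y).
{ intros y; apply Rle_trans with (c * hl); [right; unfold c; field; lra|].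
  apply Rmult_le_compat_l; [lra|apply Hb]. }
assert (Hf : holder_class c (c * B) f).
{ split.
  - intros y; eapply Rle_trans; [apply F1|apply Kc].
  - intros y y' dd; eapply Rle_trans; [apply F2, dd|].
    apply Rmult_le_compat_r; [apply sqrt_pos|]. eapply Rle_trans; [apply (Kc y)|].
    apply Rmult_le_compat_r; [left; apply h_posi|].
    rewrite <- (Rmult_1_r c) at 1; apply Rmult_le_compat_l; [lra|unfold B; lra]. }
set (j := (n / N)%nat); set (i := (n mod N)%nat).
assert (En : n = (i + N * j)%nat) by (unfold i, j; rewrite (Nat.div_mod_eq n N) at 1; lia).
assert (iN : (i < N)%nat) by (apply Nat.mod_upper_bound; lia).
assert (X : Cmod (Ln n f x) <= q ^ j * c * h x).
{ rewrite En, Nat.iter_add; apply Ln_sup, (iter j c f cp P Hf). }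
assert (Q : q ^ j * r ^ N <= r ^ n).
{ rewrite En, pow_add, Rmult_comm; apply Rmult_le_compat; try (apply pow_le; lra).
  - replace N with (i + (N - i))%nat by lia. rewrite pow_add.
    rewrite <- (Rmult_1_r (r ^ i)) at 2; apply Rmult_le_compat_l; [apply pow_le; lra|].
    rewrite <- (pow1 (N - i)); apply pow_incr; lra.
  - rewrite pow_mult; apply pow_incr; lra. }
eapply Rle_trans; [exact X|].
apply Rle_trans with (r ^ n / r ^ N * c * hu).
- apply Rmult_le_compat; [| |apply Rmult_le_compat_r; [lra|]|apply Hb].
  + apply Rmult_le_pos; [apply pow_le; lra|lra].
  + left; apply h_posi.
  + apply (Rmult_le_reg_r (r ^ N)); [assumption|].
    unfold Rdiv; rewrite (Rmult_assoc (r ^ n)), Rinv_l by lra; lra.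
- right; unfold c; field; repeat split; lra.
Qed.

End Cancellation.

Arguments twist : clear implicits.
Arguments weight : clear implicits.

(** * The Neumann series *)

Lemma ulim_unique F f f' : ulim F f -> ulim F f' -> forall x, f x = f' x.
Proof.
intros H H' x.
assert (E : Cminus (f x) (f' x) = RtoC 0).
{ apply Cmod_small_eq0; intros eps he.
  destruct (H (eps / 2) ltac:(lra)) as [N HN]; destruct (H' (eps / 2) ltac:(lra)) as [N' HN'].
  assert (K := HN (max N N') (Nat.le_max_l _ _) x).
  assert (K' := HN' (max N N') (Nat.le_max_r _ _) x).
  eapply Rle_trans; [apply (Cmod_split _ (F (max N N') x))|].
  rewrite (Cmod_minus_sym (f x)); lra. }
replace (f x) with (Cplus (f' x) (Cminus (f x) (f' x))) by ring. rewrite E; ring.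
Qed.

Lemma ulim_plus F f G f' : ulim F f -> ulim G f' ->
  ulim (fun n x => Cplus (F n x) (G n x)) (fun x => Cplus (f x) (f' x)).
Proof.
intros H H' eps he.
destruct (H (eps / 2) ltac:(lra)) as [N HN]; destruct (H' (eps / 2) ltac:(lra)) as [N' HN'].
exists (max N N'); intros n hn x.
assert (K := HN n ltac:(lia) x); assert (K' := HN' n ltac:(lia) x).
replace (Cminus (Cplus (F n x) (G n x)) (Cplus (f x) (f' x))) with
  (Cplus (Cminus (F n x) (f x)) (Cminus (G n x) (f' x))) by ring.
eapply Rle_trans; [apply Cmod_triangle|lra].
Qed.

Lemma ulim_scal c F f : ulim F f -> ulim (fun n x => Cmult c (F n x)) (fun x => Cmult c (f x)).
Proof.
intros H eps he.
assert (p := Cmod_ge_0 c).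
destruct (H (eps / (Cmod c + 1))) as [N HN]; [apply Rdiv_lt_0_compat; lra|].
exists N; intros n hn x; specialize (HN n hn x).
replace (Cminus (Cmult c (F n x)) (Cmult c (f x))) with (Cmult c (Cminus (F n x) (f x))) by ring.
rewrite Cmod_mult.
apply Rle_trans with (Cmod c * (eps / (Cmod c + 1))); [apply Rmult_le_compat_l; assumption|].
apply Rle_trans with ((Cmod c + 1) * (eps / (Cmod c + 1))); [|right; field; lra].
apply Rmult_le_compat_r; [left; apply Rdiv_lt_0_compat; lra|lra].
Qed.

Lemma ulim_geom (F : nat -> R -> C) C q : 0 <= q < 1 -> 0 <= C ->
  (forall n x, Cmod (F n x) <= C * q ^ n) -> ulim F (fun _ => RtoC 0).
Proof.
intros hq hC H eps he.
destruct (pow_small q (eps / (C + 1)) hq) as [N HN]; [apply Rdiv_lt_0_compat; lra|].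
exists N; intros n hn x; specialize (HN n hn).
replace (Cminus (F n x) (RtoC 0)) with (F n x) by ring.
eapply Rle_trans; [apply H|].
apply Rle_trans with (C * (eps / (C + 1))); [apply Rmult_le_compat_l; assumption|].
apply Rle_trans with ((C + 1) * (eps / (C + 1))); [|right; field; lra].
apply Rmult_le_compat_r; [left; apply Rdiv_lt_0_compat; lra|lra].
Qed.

Lemma rsum_geom q n : 0 <= q < 1 -> rsum (fun i => q ^ i) n <= / (1 - q).
Proof.
intros hq.
assert (E : rsum (fun i => q ^ i) n * (1 - q) = 1 - q ^ n).
{ induction n as [|n IH]; [simpl; ring|]. cbn [rsum]; rewrite Rmult_plus_distr_r, IH; simpl; ring. }
apply (Rmult_le_reg_r (1 - q)); [lra|]. rewrite E, Rinv_l by lra.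
assert (0 <= q ^ n) by (apply pow_le; lra); lra.
Qed.

Lemma ex_series_geom_scal C q : 0 <= q < 1 -> ex_series (fun n => C * q ^ n).
Proof.
intros hq; apply (ex_series_scal_l (V := R_NormedModule) C (fun n => q ^ n)), ex_series_geom.
rewrite Rabs_pos_eq; lra.
Qed.

Lemma rsum_exchange (f : nat -> nat -> R) n p :
  rsum (fun i => rsum (fun j => f i j) p) n = rsum (fun j => rsum (fun i => f i j) n) p.
Proof.
induction n as [|n IH]; cbn [rsum].
- rewrite rsum_const; ring.
- rewrite IH, <- rsum_plus; reflexivity.
Qed.

Lemma fourier_csum (F : nat -> R -> C) N p : (forall n, ccont (F n)) ->
  fourier (fun x => csum (fun n => F n x) N) p = csum (fun n => fourier (F n) p) N.
Proof.
intros H; induction N as [|N IH]; cbn [csum].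
- rewrite fourier_cint by apply ccont_const.
  rewrite (cint_ext _ (fun _ => Cmult (RtoC 0) (RtoC 0))) by (intros; ring).
  rewrite cint_scal by apply ccont_const; ring.
- rewrite fourier_plus, IH; [reflexivity| |apply H].
  apply (ccont_csum F); intros; apply H.
Qed.

Section Neumann.

Variables (m : nat) (T : (R -> C) -> R -> C) (D q : R).
Hypothesis hm : (1 <= m)%nat.
Hypothesis T_plus : forall f f', T (fun x => Cplus (f x) (f' x)) = fun x => Cplus (T f x) (T f' x).
Hypothesis T_scal : forall c f, T (fun x => Cmult c (f x)) = fun x => Cmult c (T f x).
Hypothesis T_ulim : forall F f, ulim F f -> ulim (fun n => T (F n)) (T f).
Hypothesis D_pos : 0 <= D.
Hypothesis q_range : 0 < q < 1.
Hypothesis T_decay : forall n f, sobolev m f ->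
  sobolev m (Nat.iter n T f) /\ sobolev_norm m (Nat.iter n T f) ^ 2 <= D * q ^ n * sobolev_norm m f ^ 2.

Notation Tn n f := (Nat.iter n T f).

Variable z : C.
Hypothesis z_gt : q < Cmod z ^ 2.

Lemma z_neq0 : z <> RtoC 0.
Proof. intros E; rewrite E, Cmod_0 in z_gt; simpl in z_gt; lra. Qed.

Lemma z_mod_pos : 0 < Cmod z.
Proof. apply Cmod_gt_0, z_neq0. Qed.

(** Ratio of the geometric series that dominates the Neumann series. *)
Definition ratio : R := / Cmod z * sqrt q.

Lemma ratio_range : 0 < ratio < 1.
Proof.
assert (p := z_mod_pos); assert (s := sqrt_lt_R0 q (proj1 q_range)).
unfold ratio; split; [apply Rmult_lt_0_compat; [apply Rinv_0_lt_compat, p|exact s]|].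
apply (Rmult_lt_reg_l (Cmod z)); [assumption|].
rewrite <- Rmult_assoc, Rinv_r, Rmult_1_l, Rmult_1_r by lra.
rewrite <- (sqrt_pow2 (Cmod z)) by lra. apply sqrt_lt_1_alt; lra.
Qed.

Definition term (f : R -> C) (n : nat) (x : R) : C := Cmult (Cpow (Cinv z) (S n)) (Tn n f x).

Definition partial (f : R -> C) (N : nat) (x : R) : C := csum (fun n => term f n x) N.

(** The inverse of [T - z] is minus this sum of [z^-(n+1) T^n]. *)
Definition neumann (f : R -> C) (x : R) : C := CSeries (fun n => term f n x).

Lemma Cmod_zinv n : Cmod (Cpow (Cinv z) n) = (/ Cmod z) ^ n.
Proof. rewrite Cmod_pow, Cmod_inv by apply z_neq0; reflexivity. Qed.

Lemma Tn_sup f : sobolev m f -> exists C, 0 <= C /\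
  forall n x, Cmod (Tn n f x) <= C * sqrt q ^ n.
Proof.
intros H; set (B := sqrt (4 * 64 ^ m)).
assert (B0 : 0 <= B) by apply sqrt_pos.
exists (B * sqrt (D * sobolev_norm m f ^ 2)); split.
{ apply Rmult_le_pos; [assumption|apply sqrt_pos]. }
intros n x; destruct (T_decay n f H) as [S N].
eapply Rle_trans; [apply (sobolev_sup m); assumption|]; fold B.
rewrite Rmult_assoc; apply Rmult_le_compat_l; [assumption|].
assert (E : sqrt q ^ n = sqrt (q ^ n)).
{ clear - q_range; induction n as [|n IH]; simpl; [symmetry; apply sqrt_1|].
  rewrite sqrt_mult, IH; [reflexivity|lra|apply pow_le; lra]. }
assert (0 <= q ^ n) by (apply pow_le; lra).
assert (0 <= D * sobolev_norm m f ^ 2) by (apply Rmult_le_pos; [assumption|apply pow2_ge_0]).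
rewrite E, <- sqrt_mult by assumption.
apply sqr_le_sqrt; [apply sobolev_norm_pos|]. lra.
Qed.

Lemma term_bound f : sobolev m f -> exists C, 0 <= C /\
  forall n x, Cmod (term f n x) <= C * ratio ^ n.
Proof.
intros H; destruct (Tn_sup f H) as [C [C0 HC]].
assert (p := z_mod_pos); assert (ip := Rinv_0_lt_compat _ p).
exists (/ Cmod z * C); split; [apply Rmult_le_pos; lra|].
intros n x; unfold term; rewrite Cmod_mult, Cmod_zinv; simpl pow.
unfold ratio; rewrite Rpow_mult_distr.
replace (/ Cmod z * C * ((/ Cmod z) ^ n * sqrt q ^ n))
  with (/ Cmod z * (/ Cmod z) ^ n * (C * sqrt q ^ n)) by ring.
apply Rmult_le_compat_l; [|apply HC].
apply Rmult_le_pos; [lra|apply pow_le; lra].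
Qed.

Lemma partial_ulim f : sobolev m f -> ulim (partial f) (neumann f).
Proof.
intros H; destruct (term_bound f H) as [C [C0 HC]].
assert (r := ratio_range).
apply (ulim_series (term f) (fun n => C * ratio ^ n)); [intros; apply HC|].
apply ex_series_geom_scal; lra.
Qed.

Lemma T_iter_plus n f f' : Tn n (fun x => Cplus (f x) (f' x)) = fun x => Cplus (Tn n f x) (Tn n f' x).
Proof. induction n as [|n IH]; [reflexivity|]; simpl; rewrite IH; apply T_plus. Qed.

Lemma T_iter_scal n c f : Tn n (fun x => Cmult c (f x)) = fun x => Cmult c (Tn n f x).
Proof. induction n as [|n IH]; [reflexivity|]; simpl; rewrite IH; apply T_scal. Qed.

Lemma Tn_swap n f : Tn n (T f) = Tn (S n) f.
Proof. induction n as [|n IH]; [reflexivity|]; simpl; rewrite IH; reflexivity. Qed.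

Lemma T_zero : T (fun _ => RtoC 0) = fun _ => RtoC 0.
Proof.
assert (E := T_scal (RtoC 0) (fun _ => RtoC 0)).

etransitivity; [|etransitivity; [exact E|]]; [f_equal|]; apply functional_extensionality; intros; ring.
Qed.

Lemma T_partial f N : T (partial f N) = fun x => csum (fun n => Cmult (Cpow (Cinv z) (S n)) (Tn (S n) f x)) N.
Proof.
induction N as [|N IH].
- apply T_zero.
- etransitivity; [exact (T_plus (partial f N) (term f N))|]; rewrite IH; cbn [csum].
  apply functional_extensionality; intros x; f_equal.
  unfold term; rewrite T_scal; reflexivity.
Qed.

(** Both one-sided inverse properties are limits of this identity. *)
Lemma partial_telescope f N x :
  Cminus (T (partial f N) x) (Cmult z (partial f N x)) =
  Cplus (Cmult (RtoC (-1)) (f x)) (Cmult (Cpow (Cinv z) N) (Tn N f x)).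
Proof.
rewrite T_partial; unfold partial, term; induction N as [|N IH]; cbn [csum].
- simpl; ring.
- set (A := csum _ N) in *.
  set (B := csum (fun n => Cmult (Cpow (Cinv z) (S n)) (Tn n f x)) N) in *.
  transitivity (Cplus (Cminus A (Cmult z B))
    (Cminus (Cmult (Cpow (Cinv z) (S N)) (Tn (S N) f x))
            (Cmult z (Cmult (Cpow (Cinv z) (S N)) (Tn N f x))))); [ring|].
  rewrite IH; cbn [Cpow Nat.iter]; field; apply z_neq0.
Qed.

Lemma remainder_ulim f : sobolev m f ->
  ulim (fun N x => Cmult (Cpow (Cinv z) N) (Tn N f x)) (fun _ => RtoC 0).
Proof.
intros H; destruct (Tn_sup f H) as [C [C0 HC]].
assert (r := ratio_range). assert (p := z_mod_pos).
apply (ulim_geom _ C ratio); [lra|assumption|].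
intros n x; rewrite Cmod_mult, Cmod_zinv; unfold ratio; rewrite Rpow_mult_distr.
replace (C * ((/ Cmod z) ^ n * sqrt q ^ n)) with ((/ Cmod z) ^ n * (C * sqrt q ^ n)) by ring.
apply Rmult_le_compat_l; [|apply HC]. apply pow_le; left; apply Rinv_0_lt_compat, p.
Qed.

Lemma telescope_ulim f : sobolev m f ->
  ulim (fun N x => Cplus (Cmult (RtoC (-1)) (f x)) (Cmult (Cpow (Cinv z) N) (Tn N f x)))
       (fun x => Cmult (RtoC (-1)) (f x)).
Proof.
intros H.
assert (K := ulim_plus (fun _ x => Cmult (RtoC (-1)) (f x)) (fun x => Cmult (RtoC (-1)) (f x)) _ _
   ltac:(intros eps he; exists O; intros; replace (Cminus _ _) with (RtoC 0) by ring; rewrite Cmod_0; lra)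
   (remainder_ulim f H)).
replace (fun x => Cmult (RtoC (-1)) (f x)) with
  (fun x => Cplus (Cmult (RtoC (-1)) (f x)) (RtoC 0)); [exact K|].
apply functional_extensionality; intros; ring.
Qed.

Lemma neumann_right f x : sobolev m f ->
  Cminus (T (neumann f) x) (Cmult z (neumann f x)) = Cmult (RtoC (-1)) (f x).
Proof.
intros H; assert (L := partial_ulim f H).
assert (L1 := ulim_plus _ _ _ _ (T_ulim _ _ L) (ulim_scal (Copp z) _ _ L)).
assert (L2 := telescope_ulim f H).
apply (ulim_ext _ (fun n x => Cplus (T (partial f n) x) (Cmult (Copp z) (partial f n x)))) in L2.
- assert (E := ulim_unique _ _ _ L1 L2 x). rewrite <- E; ring.
- intros n t; rewrite <- partial_telescope; ring.
Qed.

Lemma partial_op_minus f N x :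
  partial (op_minus T z f) N x = Cminus (T (partial f N) x) (Cmult z (partial f N x)).
Proof.
rewrite T_partial; unfold partial.
replace (op_minus T z f) with (fun x => Cplus (T f x) (Cmult (Copp z) (f x)))
  by (apply functional_extensionality; intros t; unfold op_minus; ring).
induction N as [|N IH]; cbn [csum]; [ring|].
rewrite IH; unfold term.
rewrite T_iter_plus, T_iter_scal, Tn_swap; ring.
Qed.

Lemma sobolev_T f : sobolev m f -> sobolev m (T f).
Proof. intros H; exact (proj1 (T_decay 1 f H)). Qed.

Lemma sobolev_op_minus w f : sobolev m f -> sobolev m (op_minus T w f).
Proof.
intros H.
replace (op_minus T w f) with (fun x => Cplus (T f x) (Cmult (Copp w) (f x)))
  by (apply functional_extensionality; intros t; unfold op_minus; ring).
apply sobolev_plus; [apply sobolev_T, H|apply sobolev_scal, H].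
Qed.

Lemma neumann_left f x : sobolev m f ->
  neumann (op_minus T z f) x = Cmult (RtoC (-1)) (f x).
Proof.
intros H; assert (L := partial_ulim _ (sobolev_op_minus z f H)).
assert (L2 := telescope_ulim f H).
apply (ulim_ext _ (partial (op_minus T z f))) in L2.
- exact (ulim_unique _ _ _ L L2 x).
- intros n t; rewrite partial_op_minus; symmetry; apply partial_telescope.
Qed.

Lemma term_cont f n : sobolev m f -> ccont (term f n).
Proof.
intros H; apply (ccont_mult (fun _ => Cpow (Cinv z) (S n))); [apply ccont_const|].
apply (sobolev_ccont m), T_decay, H.
Qed.

Lemma partial_cont f N : sobolev m f -> ccont (partial f N).
Proof. intros H; apply (ccont_csum (term f)); intros; apply term_cont, H. Qed.

(** The Cauchy-Schwarz inequality with weights [ratio^n] makes the bound uniform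
    in the number of terms. *)
Lemma partial_sobolev_sum f N p : sobolev m f ->
  sobolev_sum m (partial f N) p <= (/ Cmod z * / (1 - ratio)) ^ 2 * D * sobolev_norm m f ^ 2.
Proof.
intros H; assert (r := ratio_range).
assert (ip := Rinv_0_lt_compat _ z_mod_pos).
assert (sq := sqrt_lt_R0 q (proj1 q_range)).
assert (iq : 0 < / (1 - ratio)) by (apply Rinv_0_lt_compat; lra).
set (G := / (1 - ratio)) in *. set (zi := / Cmod z) in *.
assert (X : forall i, Cmod (fourier (partial f N) i) ^ 2 <=
  G * rsum (fun n => ratio ^ n * (zi ^ 2 * (Cmod (fourier (Tn n f) i) ^ 2 / q ^ n))) N).
{ intros i; unfold partial; rewrite fourier_csum by (intros; apply term_cont, H).
  eapply Rle_trans; [apply pow_incr; split; [apply Cmod_ge_0|apply csum_mod]|].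
  rewrite (rsum_ext _ (fun n => ratio ^ n * (zi * Cmod (fourier (Tn n f) i) / sqrt q ^ n))).
  2:{ intros n _; unfold term.
      rewrite fourier_scal by (apply (sobolev_ccont m), T_decay, H).
      rewrite Cmod_mult, Cmod_zinv; fold zi; unfold ratio; fold zi.
      rewrite Rpow_mult_distr; simpl; field; apply pow_nonzero; lra. }
  eapply Rle_trans; [apply rsum_sqr_le; intros; apply pow_le; lra|].
  apply Rmult_le_compat.
  - apply rsum_ge0; intros; apply pow_le; lra.
  - apply rsum_ge0; intros; apply Rmult_le_pos; [apply pow_le; lra|apply pow2_ge_0].
  - apply rsum_geom; lra.
  - right; apply rsum_ext; intros n _; f_equal.
    assert (E : q ^ n = (sqrt q ^ n) ^ 2).
    { rewrite <- pow_mult, Nat.mul_comm, pow_mult, pow2_sqrt by lra; reflexivity. }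
    rewrite E; field; apply pow_nonzero; lra. }
unfold sobolev_sum, sobolev_term.
apply Rle_trans with (rsum (fun i => rsum (fun n => G * zi ^ 2 * (ratio ^ n / q ^ n *
   sobolev_term m (Tn n f) (zenum i))) N) p).
- apply rsum_le; intros i _.
  assert (w0 : 0 <= (1 + IZR (zenum i) ^ 2) ^ m) by (apply pow_le; generalize (sq1_pos (zenum i)); lra).
  eapply Rle_trans; [apply Rmult_le_compat_l; [exact w0|apply X]|].
  right; rewrite <- !rsum_scal; apply rsum_ext; intros n _; unfold sobolev_term.
  field; apply pow_nonzero; lra.
- rewrite rsum_exchange.
  apply Rle_trans with (rsum (fun n => (G * zi ^ 2 * (D * sobolev_norm m f ^ 2)) * ratio ^ n) N).
  + apply rsum_le; intros n _.
    rewrite rsum_scal, (Rmult_assoc (G * zi ^ 2) (D * sobolev_norm m f ^ 2)).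
    apply Rmult_le_compat_l; [left; apply Rmult_lt_0_compat; [assumption|apply pow_lt, ip]|].
    rewrite rsum_scal. change (rsum (fun i => sobolev_term m (Tn n f) (zenum i)) p) with (sobolev_sum m (Tn n f) p).
    destruct (T_decay n f H) as [S1 S2]. assert (S3 := sobolev_sum_le_norm m _ p S1).
    assert (qn : 0 < q ^ n) by (apply pow_lt; lra). assert (rn : 0 < ratio ^ n) by (apply pow_lt; lra).
    replace (D * sobolev_norm m f ^ 2 * ratio ^ n)
      with (ratio ^ n / q ^ n * (D * q ^ n * sobolev_norm m f ^ 2)) by (field; lra).
    apply Rmult_le_compat_l; [left; apply Rdiv_lt_0_compat; assumption|lra].
  + rewrite rsum_scal. assert (Q := rsum_geom ratio N ltac:(lra)). fold G in Q.
    replace ((zi * G) ^ 2 * D * sobolev_norm m f ^ 2)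
      with (G * zi ^ 2 * (D * sobolev_norm m f ^ 2) * G) by ring.
    apply Rmult_le_compat_l; [|exact Q].
    apply Rmult_le_pos; [|apply Rmult_le_pos; [assumption|apply pow2_ge_0]].
    left; apply Rmult_lt_0_compat; [assumption|apply pow_lt, ip].
Qed.

Lemma neumann_sobolev f : sobolev m f -> sobolev m (neumann f) /\
  sobolev_norm m (neumann f) ^ 2 <= (/ Cmod z * / (1 - ratio)) ^ 2 * D * sobolev_norm m f ^ 2.
Proof.
intros H; assert (L := partial_ulim f H).
apply sobolev_sum_sobolev.
- apply (ulim_periodic (partial f)); [|exact L].
  intros N x; unfold partial; apply csum_ext; intros n _; unfold term.
  rewrite (sobolev_periodic m _ (proj1 (T_decay n f H))); reflexivity.
- apply (ulim_cont (partial f)); [intros; apply partial_cont, H|exact L].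
- intros p; apply (ulim_sobolev_sum m (partial f)); [intros; apply partial_cont, H|exact L|].
  intros N; apply partial_sobolev_sum, H.
Qed.

Lemma neumann_plus f f' x : sobolev m f -> sobolev m f' ->
  neumann (fun y => Cplus (f y) (f' y)) x = Cplus (neumann f x) (neumann f' x).
Proof.
intros H H'; assert (L := partial_ulim _ (sobolev_plus m f f' H H')).
assert (L' := ulim_plus _ _ _ _ (partial_ulim f H) (partial_ulim f' H')).
apply (ulim_ext _ (partial (fun y => Cplus (f y) (f' y)))) in L'.
- exact (ulim_unique _ _ _ L L' x).
- intros n t; unfold partial; rewrite <- csum_plus; apply csum_ext; intros i _; unfold term.
  rewrite T_iter_plus; ring.
Qed.

Lemma neumann_scal c f x : sobolev m f ->
  neumann (fun y => Cmult c (f y)) x = Cmult c (neumann f x).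
Proof.
intros H; assert (L := partial_ulim _ (sobolev_scal m c f H)).
assert (L' := ulim_scal c _ _ (partial_ulim f H)).
apply (ulim_ext _ (partial (fun y => Cmult c (f y)))) in L'.
- exact (ulim_unique _ _ _ L L' x).
- intros n t; unfold partial; rewrite <- csum_scal; apply csum_ext; intros i _; unfold term.
  rewrite T_iter_scal; ring.
Qed.

Lemma norm_le_of_sqr a b K : 0 <= a -> 0 <= b -> 0 <= K -> a ^ 2 <= K * b ^ 2 -> a <= sqrt K * b.
Proof.
intros a0 b0 K0 h.
rewrite <- (sqrt_pow2 b) by assumption. rewrite <- sqrt_mult by (auto using pow2_ge_0).
apply sqr_le_sqrt; assumption.
Qed.

Theorem neumann_resolvent : resolvent_point m T z.
Proof.
set (K := (/ Cmod z * / (1 - ratio)) ^ 2 * D).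
assert (K0 : 0 <= K) by (apply Rmult_le_pos; [apply pow2_ge_0|assumption]).
exists (fun f x => Cmult (RtoC (-1)) (neumann f x)); split; [|split].
- split; [|split; [|split]].
  + intros f Hf; apply sobolev_scal, neumann_sobolev, Hf.
  + intros f f' Hf Hf' x; rewrite neumann_plus by assumption; ring.
  + intros c f Hf x; rewrite neumann_scal by assumption; ring.
  + exists (sqrt K); intros f Hf.
    destruct (neumann_sobolev f Hf) as [S1 S2].
    apply norm_le_of_sqr; try apply sobolev_norm_pos; [assumption|].
    apply (proj2 (sobolev_sum_sobolev m _ (K * sobolev_norm m f ^ 2)
      (sobolev_periodic m _ (sobolev_scal m (RtoC (-1)) _ S1))
      (sobolev_ccont m _ (sobolev_scal m (RtoC (-1)) _ S1))
      ltac:(intros N; rewrite sobolev_sum_scal by (apply (sobolev_ccont m), S1);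
            rewrite Cmod_R, pow2_abs;
            generalize (sobolev_sum_le_norm m _ N S1); unfold K; intros; lra))).
- intros f Hf x; rewrite neumann_left by assumption.
  rewrite Cmult_assoc, <- RtoC_mult; replace (-1 * -1) with 1 by ring; ring.
- intros f Hf x; unfold op_minus; rewrite T_scal.
  transitivity (Cmult (RtoC (-1)) (Cminus (T (neumann f) x) (Cmult z (neumann f x)))); [ring|].
  rewrite neumann_right by assumption.
  rewrite Cmult_assoc, <- RtoC_mult; replace (-1 * -1) with 1 by ring; ring.
Qed.

End Neumann.

(** Points outside the disc of radius [sqrt q] have a Neumann series as resolvent. *)
Theorem spectral_radius_lt_1 m T D q : (1 <= m)%nat ->
  (forall f f', T (fun x => Cplus (f x) (f' x)) = fun x => Cplus (T f x) (T f' x)) ->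
  (forall c f, T (fun x => Cmult c (f x)) = fun x => Cmult c (T f x)) ->
  (forall F f, ulim F f -> ulim (fun n => T (F n)) (T f)) ->
  0 <= D -> 0 < q < 1 ->
  (forall n f, sobolev m f ->
    sobolev m (Nat.iter n T f) /\ sobolev_norm m (Nat.iter n T f) ^ 2 <= D * q ^ n * sobolev_norm m f ^ 2) ->
  Rbar_lt (spectral_radius m T) 1.
Proof.
intros hm Tp Ts Tu D0 hq HT.
assert (s1 : sqrt q < 1) by (rewrite <- sqrt_1; apply sqrt_lt_1_alt; lra).
apply Rbar_le_lt_trans with (Finite (sqrt q)); [|exact s1].
apply (proj2 (Lub_Rbar_correct _)).
intros r [z [Hz ->]]; simpl.
apply Rnot_lt_le; intros h; apply Hz.
apply (neumann_resolvent m T D q); auto.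
rewrite <- (pow2_sqrt q) by lra.
assert (P := sqrt_pos q); simpl; nra.
Qed.

Section Final.

Context {k : nat} {g : circle_diffeo} {lam : R} {Hexp : expanding k g lam}.
Let hk : (2 <= k)%nat := expanding_degree.
Let lam1 : 1 < lam := expanding_gt1.
Let hlam : forall x, lam <= Derive (expand k g) x := expanding_le.

Notation dE := (Derive (expand k g)).
Notation yb := (branch k g).
Notation M0 := (ruelle k g).

Variable tau : R -> R.
Hypothesis tau_smooth : smooth tau.
Hypothesis tau_periodic : periodic tau.

Variables (A c C0 : R) (h : R -> R).
Hypothesis A_pos : 0 < A.
Hypothesis c_range : 0 <= c < 1.
Hypothesis C0_pos : 0 <= C0.
Hypothesis h_cone : log_holder_cone A h.
Hypothesis h_mass : RInt h 0 1 = 1.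
Hypothesis h_inv : forall x, M0 h x = h x.
Hypothesis h_limit : forall f, log_holder_cone A f -> RInt f 0 1 = 1 ->
  forall n x, Rabs (Nat.iter n M0 f x - h x) <= C0 * c ^ n.

(** * The operators of the theorem on Sobolev spaces *)

Notation L nu := (weighted_op k g (weight k g tau nu)).

Lemma transfer_weighted_op nu : transfer k g tau nu = L (IZR nu).
Proof.
apply functional_extensionality; intros f; apply functional_extensionality; intros x.
unfold transfer, weighted_op, branch_sum; rewrite sum_n_csum.
replace (S (k - 1)) with k by lia.
apply csum_ext; intros j _. unfold weight, twist, inv_expansion; cbv zeta.
rewrite RtoC_inv by (apply Rgt_not_eq, dE_pos). reflexivity.
Qed.

Lemma L_plus nu f f' : L nu (fun x => Cplus (f x) (f' x)) = fun x => Cplus (L nu f x) (L nu f' x).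
Proof.
apply functional_extensionality; intros x; unfold weighted_op, branch_sum; rewrite <- csum_plus.
apply csum_ext; intros; ring.
Qed.

Lemma ruelle_bound f B x : (forall y, f y <= B) -> 0 <= B -> M0 f x <= INR k * B.
Proof.
intros H B0; unfold ruelle; rewrite <- rsum_const; apply rsum_le; intros j _.
assert (w := weight_pos (yb j x)). assert (d := hlam (yb j x)).
assert (w1 : / dE (yb j x) <= 1) by (rewrite <- Rinv_1; apply Rinv_le_contravar; lra).
apply Rle_trans with (/ dE (yb j x) * B); [apply Rmult_le_compat_l; [lra|apply H]|nra].
Qed.

Lemma L_ulim nu F f : ulim F f -> ulim (fun n => L nu (F n)) (L nu f).
Proof.
intros H eps he. assert (kp := k_pos (k := k) (g := g)).
destruct (H (eps / INR k)) as [N HN]; [apply Rdiv_lt_0_compat; assumption|].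
exists N; intros n hn x; specialize (HN n hn).
replace (Cminus (L nu (F n) x) (L nu f x)) with (L nu (fun y => Cplus (F n y) (Cmult (RtoC (-1)) (f y))) x).
- eapply Rle_trans; [apply L_mod|].
  eapply Rle_trans; [apply (ruelle_bound _ (eps / INR k))|right; field; lra].
  + intros y; replace (Cplus (F n y) (Cmult (RtoC (-1)) (f y))) with (Cminus (F n y) (f y)) by ring.
    apply HN.
  + left; apply Rdiv_lt_0_compat; assumption.
- rewrite L_plus, L_scal; ring.
Qed.

Lemma Ln_ulim nu n F f : ulim F f -> ulim (fun i => Nat.iter n (L nu) (F i)) (Nat.iter n (L nu) f).
Proof. intros H; induction n as [|n IH]; [exact H|]; simpl; apply L_ulim, IH. Qed.

Lemma weight_le nu y : Cmod (weight k g tau nu y) <= / dE y.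
Proof. rewrite Cmod_weight; lra. Qed.

Lemma h_rcont : rcont h.
Proof. apply (cone_cont A); [lra|assumption]. Qed.

Lemma sobolev_iter nu n m B : (1 <= m)%nat -> 0 <= B ->
  (forall f, csmooth f -> energy m (Nat.iter n (L nu) f) <= B * energy m f) ->
  forall f, sobolev m f -> sobolev m (Nat.iter n (L nu) f) /\
    sobolev_norm m (Nat.iter n (L nu) f) ^ 2 <=
      (2 ^ m * 2 * INR (S m) * 64 ^ m) * B * sobolev_norm m f ^ 2.
Proof.
intros hm B0 HB; apply (sobolev_extension m (Nat.iter n (L nu))); auto.
- intros F f _; apply Ln_ulim.
- intros f Hf; apply csmooth_weighted_op_iter; [apply csmooth_weight; assumption|exact Hf].
Qed.

Lemma sobolev_const_pos m : 0 <= 2 ^ m * 2 * INR (S m) * 64 ^ m.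
Proof.
assert (0 <= 2 ^ m) by (apply pow_le; lra). assert (0 <= 64 ^ m) by (apply pow_le; lra).
assert (0 <= INR (S m)) by apply pos_INR.
repeat apply Rmult_le_pos; lra.
Qed.

Lemma L_bounded m nu : (1 <= m)%nat -> bounded_operator m (L nu).
Proof.
intros hm.
destruct (energy_bounded h (proj1 h_cone) h_rcont (proj1 (proj2 h_cone)) h_inv
  (weight k g tau nu) (csmooth_weight tau tau_smooth tau_periodic nu) (weight_le nu) m) as [B [B0 HB]].
assert (S := sobolev_iter nu 1 m B hm B0 (fun f Hf => HB f Hf 1%nat)).
split; [|split; [|split]].
- intros f Hf; exact (proj1 (S f Hf)).
- intros f f' _ _ x; rewrite L_plus; reflexivity.
- intros a f _ x; rewrite L_scal; reflexivity.
- exists (sqrt (2 ^ m * 2 * INR (Datatypes.S m) * 64 ^ m * B)); intros f Hf.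
  apply norm_le_of_sqr; try apply sobolev_norm_pos; [|exact (proj2 (S f Hf))].
  apply Rmult_le_pos; [apply sobolev_const_pos|assumption].
Qed.

(** ** The twisted operators *)

Lemma sqnorm_le_energy j m f : csmooth f -> (j <= m)%nat -> sqnorm (cDn j f) <= energy m f.
Proof.
intros Hf hj; apply (rsum_term_le (fun j => sqnorm (cDn j f)) (S m) j); [|lia].
intros; apply sqnorm_pos, csmooth_cont, csmooth_cDn, Hf.
Qed.

Theorem twisted_spectral_radius m Rk T nu : (1 <= m)%nat -> nu <> 0 ->
  (forall y, Rabs (Derive tau y) <= T) -> T / (lam - 1) < Rk -> partially_captive k g tau Rk ->
  Rbar_lt (spectral_radius m (L nu)) 1.
Proof.
intros hm nu0 HT hR Hc.
destruct (twisted_decay tau tau_smooth tau_periodic nu A A_pos h h_cone h_inv Rk T nu0 HT hR Hc)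
  as (C & r & Cp & r1 & dec).
assert (il : 0 < / lam < 1).
{ split; [apply Rinv_0_lt_compat; lra|rewrite <- Rinv_1; apply Rinv_lt_contravar; lra]. }
(* The rate has to exceed [1 / lam] to propagate to the higher energies. *)
set (q := Rmax r ((1 + / lam) / 2)).
assert (q1 : / lam < q).
{ eapply Rlt_le_trans; [|apply Rmax_r]; lra. }
assert (q2 : 0 < q < 1).
{ split; [lra|apply Rmax_lub_lt; lra]. }
assert (rq : r <= q) by apply Rmax_l.
destruct (energy_growth h (proj1 h_cone) h_rcont (proj1 (proj2 h_cone)) h_inv
  (weight k g tau nu) (csmooth_weight tau tau_smooth tau_periodic nu) (weight_le nu) m q q1) as [B [B0 HB]].
set (B' := B * (4 * C ^ 2 + 1)).
assert (B'0 : 0 <= B') by (apply Rmult_le_pos; [assumption|generalize (pow2_ge_0 C); lra]).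
assert (qn : forall n, 0 < q ^ n) by (intros; apply pow_lt; lra).
assert (HE : forall n f, csmooth f -> energy m (Nat.iter n (L nu) f) <= B' * q ^ n * energy m f).
{ intros n f Hf.
  assert (E0 := energy_pos m f Hf).
  set (K := sqrt (4 * energy m f)).
  assert (K2 : K ^ 2 = 4 * energy m f) by (apply pow2_sqrt; lra).
  assert (U0 := sqnorm_le_energy 0 m f Hf ltac:(lia)). assert (U1 := sqnorm_le_energy 1 m f Hf hm).
  change (sqnorm (cDn 0 f)) with (sqnorm f) in U0. change (sqnorm (cDn 1 f)) with (sqnorm (cD f)) in U1.
  assert (D : forall n x, Cmod (Nat.iter n (L nu) f x) <= C * K * r ^ n).
  { apply dec; [apply sqrt_pos|apply Hf| |].
    - intros x; apply sqr_le_sqrt; [apply Cmod_ge_0|].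
      eapply Rle_trans; [apply csmooth_sup, Hf|lra].
    - intros x x' d; unfold K; rewrite <- sqrt_mult; [|lra|apply Rabs_pos].
      apply sqr_le_sqrt; [apply Cmod_ge_0|].
      eapply Rle_trans; [apply (csmooth_holder f x x' Hf d)|].
      rewrite Rmult_comm; apply Rmult_le_compat_r; [apply Rabs_pos|lra]. }
  eapply Rle_trans; [apply (HB f (4 * C ^ 2 * energy m f) Hf)|right; unfold B'; ring].
  intros p; unfold sqnorm.
  assert (Hp := csmooth_cont _ (csmooth_weighted_op_iter (weight k g tau nu) (csmooth_weight tau tau_smooth tau_periodic nu) p f Hf)).
  apply Rle_trans with (RInt (fun _ => (C * K * r ^ p) ^ 2) 0 1).
  - apply RInt_le_r; [lra|apply rcont_Cmod2, Hp|apply rcont_const|].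
    intros x; apply pow_incr; split; [apply Cmod_ge_0|apply D].
  - rewrite RInt_const_r, !Rpow_mult_distr, K2, <- (pow_mult r), Nat.mul_comm, pow_mult.
    assert (X : (r ^ 2) ^ p <= q ^ p) by (apply pow_incr; nra).
    assert (0 <= C ^ 2 * (4 * energy m f)).
    { apply Rmult_le_pos; [apply pow2_ge_0|lra]. }
    nra. }
apply (spectral_radius_lt_1 m (L nu) ((2 ^ m * 2 * INR (S m) * 64 ^ m) * B') q hm).
- apply L_plus.
- apply L_scal.
- apply L_ulim.
- apply Rmult_le_pos; [apply sobolev_const_pos|assumption].
- exact q2.
- intros n f Hf. rewrite (Rmult_assoc (2 ^ m * 2 * INR (S m) * 64 ^ m) B').
  apply sobolev_iter; auto.
  apply Rmult_le_pos; [assumption|left; apply qn].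
Qed.

(** ** The untwisted operator *)

Notation L0 := (L 0).

Lemma L0_fst f x : fst (L0 f x) = M0 (fun y => fst (f y)) x.
Proof.
unfold weighted_op, branch_sum; rewrite csum_fst; apply rsum_ext; intros j _.
unfold weight, twist, inv_expansion; rewrite Rmult_0_l, Ropp_0, cis_0; simpl; ring.
Qed.

Lemma L0_snd f x : snd (L0 f x) = M0 (fun y => snd (f y)) x.
Proof.
unfold weighted_op, branch_sum; rewrite csum_snd; apply rsum_ext; intros j _.
unfold weight, twist, inv_expansion; rewrite Rmult_0_l, Ropp_0, cis_0; simpl; ring.
Qed.

Lemma L0n_fst n f x : fst (Nat.iter n L0 f x) = Nat.iter n M0 (fun y => fst (f y)) x.
Proof.
revert x; induction n as [|n IH]; intros x; [reflexivity|]; simpl.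
rewrite L0_fst; apply ruelle_ext; exact IH.
Qed.

Lemma L0n_snd n f x : snd (Nat.iter n L0 f x) = Nat.iter n M0 (fun y => snd (f y)) x.
Proof.
revert x; induction n as [|n IH]; intros x; [reflexivity|]; simpl.
rewrite L0_snd; apply ruelle_ext; exact IH.
Qed.

Lemma cint_L0 f : periodic f -> ccont f -> cint (L0 f) = cint f.
Proof.
intros P H; unfold cint; f_equal.
- rewrite <- (RInt_ruelle (fun y => fst (f y))).
  + apply RInt_ext; intros x _; apply L0_fst.
  + intros x; rewrite P; reflexivity.
  + apply ccont_fst, H.
- rewrite <- (RInt_ruelle (fun y => snd (f y))).
  + apply RInt_ext; intros x _; apply L0_snd.
  + intros x; rewrite P; reflexivity.
  + apply ccont_snd, H.
Qed.

Lemma RInt_one : RInt (fun _ => 1) 0 1 = 1.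
Proof. rewrite RInt_const_r; eqR; ring. Qed.

Lemma cone_one : log_holder_cone A (fun _ => 1).
Proof.
repeat split; [intros; lra|]; intros x x' _; rewrite Rmult_1_l, <- exp_0.
apply exp_le, Rmult_le_pos; [lra|apply sqrt_pos].
Qed.

(** A Hoelder function becomes an element of the cone when a large constant is
    added to it, and the constant has the same limit as its mass. *)
Lemma ruelle_iter_limit f K : 0 <= K -> periodic f -> rcont f -> (forall x, Rabs (f x) <= K) ->
  (forall x x', Rabs (x - x') <= 1 -> Rabs (f x - f x') <= K * sqrt (Rabs (x - x'))) ->
  forall x, is_lim_seq (fun n => Nat.iter n M0 f x) (RInt f 0 1 * h x).
Proof.
intros K0 P Hc F1 F2 x.
assert (KA : 0 <= K / A) by (apply Rmult_le_pos; [assumption|left; apply Rinv_0_lt_compat, A_pos]).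
(* Then [(f + kap) A >= K], and [1 + A r <= exp (A r)]. *)
set (kap := K + K / A + 1).
set (mu := RInt (fun y => f y + kap) 0 1).
assert (Emu : mu = RInt f 0 1 + kap).
{ unfold mu; rewrite RInt_plus_r, RInt_const_r; [eqR; ring|assumption|apply rcont_const]. }
assert (mup : 0 < mu).
{ apply Rlt_le_trans with (RInt (fun _ => 1) 0 1); [rewrite RInt_one; lra|].
  apply RInt_le_r; [lra|apply rcont_const|apply rcont_plus; [assumption|apply rcont_const]|].
  intros y; specialize (F1 y); apply Rabs_le_between in F1; unfold kap; lra. }
assert (H1 : log_holder_cone A (fun y => f y + kap)).
{ repeat split.
  - intros y; rewrite P; reflexivity.
  - intros y; specialize (F1 y); apply Rabs_le_between in F1; unfold kap; lra.
  - intros y y' d; specialize (F2 y y' d); apply Rabs_le_between in F2.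
    set (r := sqrt (Rabs (y - y'))) in *; assert (r0 : 0 <= r) by apply sqrt_pos.
    assert (E := exp_ineq1_le (A * r)).
    assert (B := F1 y'); apply Rabs_le_between in B.
    assert (G : K <= (f y' + kap) * A).
    { apply Rle_trans with (K / A * A); [right; field; lra|].
      apply Rmult_le_compat_r; [lra|unfold kap; lra]. }
    assert (p : 0 <= f y' + kap) by (unfold kap; lra).
    apply Rle_trans with ((f y' + kap) * (1 + A * r)); [|apply Rmult_le_compat_l; assumption].
    assert (K * r <= (f y' + kap) * A * r) by (apply Rmult_le_compat_r; assumption). lra. }
set (u := fun y => / mu * (f y + kap)).
assert (Hu : log_holder_cone A u) by (apply cone_scal; [apply Rinv_0_lt_compat, mup|exact H1]).
assert (Iu : RInt u 0 1 = 1).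
{ unfold u; rewrite RInt_scal_r; [|apply rcont_plus; [assumption|apply rcont_const]].
  fold mu; eqR; field; lra. }
assert (lim : forall v, log_holder_cone A v -> RInt v 0 1 = 1 -> is_lim_seq (fun n => Nat.iter n M0 v x) (h x)).
{ intros v Hv Iv; apply is_lim_seq_spec; intros eps.
  destruct (pow_small c (eps / (C0 + 1)) c_range) as [N HN].
  { apply Rdiv_lt_0_compat; [apply cond_pos|lra]. }
  exists N; intros n hn; specialize (HN n hn).
  eapply Rle_lt_trans; [apply h_limit; assumption|].
  apply Rle_lt_trans with (C0 * (eps / (C0 + 1))); [apply Rmult_le_compat_l; assumption|].
  apply Rlt_le_trans with ((C0 + 1) * (eps / (C0 + 1))); [|right; field; lra].
  apply Rmult_lt_compat_r; [apply Rdiv_lt_0_compat; [apply cond_pos|lra]|lra]. }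
apply is_lim_seq_ext with
  (fun n => mu * Nat.iter n M0 u x + (- kap) * Nat.iter n M0 (fun _ => 1) x).
- intros n; rewrite <- (ruelle_iter_lin n mu (- kap) u (fun _ => 1) x).
  f_equal; f_equal; apply functional_extensionality; intros y; unfold u; field; lra.
- replace (RInt f 0 1 * h x) with (mu * h x + - kap * h x) by (rewrite Emu; ring).
  apply is_lim_seq_plus'.
  + apply (is_lim_seq_scal_l _ mu (Finite _)), lim; assumption.
  + apply (is_lim_seq_scal_l _ (- kap) (Finite _)), lim; [apply cone_one|apply RInt_one].
Qed.

Lemma L0n_limit m f x : (1 <= m)%nat -> sobolev m f ->
  is_lim_seq (fun n => Cmod (Cminus (Nat.iter n L0 f x) (Cmult (cint f) (RtoC (h x))))) 0.
Proof.
intros hm H.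
set (K1 := sqrt (4 * 64 ^ m) * sobolev_norm m f).
set (K2 := sqrt (64 ^ m) * sobolev_norm m f).
assert (K10 : 0 <= K1) by (apply Rmult_le_pos; [apply sqrt_pos|apply sobolev_norm_pos]).
assert (K20 : 0 <= K2) by (apply Rmult_le_pos; [apply sqrt_pos|apply sobolev_norm_pos]).
assert (P := sobolev_periodic m f H). assert (Hc := sobolev_ccont m f H).
assert (F1 : forall y, Cmod (f y) <= K1 + K2).
{ intros y; assert (X := sobolev_sup m f y hm H); fold K1 in X; lra. }
assert (F2 : forall y y', Rabs (y - y') <= 1 -> Cmod (Cminus (f y) (f y')) <= (K1 + K2) * sqrt (Rabs (y - y'))).
{ intros y y' d; assert (X := sobolev_holder m f y y' hm H d); fold K2 in X.
  assert (r := sqrt_pos (Rabs (y - y'))); nra. }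
assert (L1 := ruelle_iter_limit (fun y => fst (f y)) (K1 + K2) ltac:(lra)
  (fun y => f_equal fst (P y)) (ccont_fst f Hc)
  (fun y => Rle_trans _ _ _ (fst_le_Cmod _) (F1 y))
  (fun y y' d => Rle_trans _ _ _ (fst_le_Cmod (Cminus (f y) (f y'))) (F2 y y' d)) x).
assert (L2 := ruelle_iter_limit (fun y => snd (f y)) (K1 + K2) ltac:(lra)
  (fun y => f_equal snd (P y)) (ccont_snd f Hc)
  (fun y => Rle_trans _ _ _ (snd_le_Cmod _) (F1 y))
  (fun y y' d => Rle_trans _ _ _ (snd_le_Cmod (Cminus (f y) (f y'))) (F2 y y' d)) x).
assert (Z : forall (a : nat -> R) l, is_lim_seq a (Finite l) -> is_lim_seq (fun n => Rabs (a n - l)) 0).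
{ intros a l Ha. rewrite <- Rabs_R0.
  apply (is_lim_seq_abs _ (Finite 0)). replace 0 with (l - l) by ring.
  apply is_lim_seq_minus'; [exact Ha|apply is_lim_seq_const]. }
apply (is_lim_seq_le_le (fun _ => 0) _
  (fun n => Rabs (Nat.iter n M0 (fun y => fst (f y)) x - RInt (fun y => fst (f y)) 0 1 * h x) +
            Rabs (Nat.iter n M0 (fun y => snd (f y)) x - RInt (fun y => snd (f y)) 0 1 * h x))).
- intros n; split; [apply Cmod_ge_0|].
  eapply Rle_trans; [apply Cmod_le_sum|]; right.
  rewrite <- L0n_fst, <- L0n_snd.
  unfold cint, Cminus, Cplus, Copp, Cmult, RtoC; simpl; f_equal; f_equal; ring.
- apply is_lim_seq_const.
- replace (Finite 0) with (Finite (0 + 0)) by (f_equal; ring).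
  apply is_lim_seq_plus'; apply Z; assumption.
Qed.

Definition hC (x : R) : C := RtoC (h x).

Lemma hC_fixed x : L0 hC x = hC x.
Proof.
unfold hC, RtoC; apply injective_projections.
- rewrite L0_fst; simpl; apply h_inv.
- rewrite L0_snd; simpl. unfold ruelle.
  rewrite (rsum_ext _ (fun _ => 0)) by (intros; ring). rewrite rsum_const; ring.
Qed.

Lemma cint_hC : cint hC = RtoC 1.
Proof.
unfold cint, hC, RtoC; cbn [fst snd]; f_equal.
- exact h_mass.
- rewrite RInt_const_r; eqR; ring.
Qed.

Lemma hC_neq0 x : hC x <> RtoC 0.
Proof.
intros E; apply (f_equal fst) in E; simpl in E.
assert (K := proj1 (proj2 h_cone) x); lra.
Qed.

(** The iterates of the constant 1 are bounded in every Sobolev norm and converge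
    uniformly to the density. *)
Lemma hC_sobolev m : sobolev m hC.
Proof.
destruct (energy_bounded h (proj1 h_cone) h_rcont (proj1 (proj2 h_cone)) h_inv
  (weight k g tau 0) (csmooth_weight tau tau_smooth tau_periodic 0) (weight_le 0) m) as [B [B0 HB]].
set (one := fun _ : R => RtoC 1).
assert (H1 : csmooth one) by apply csmooth_const.
assert (Hn : forall n, csmooth (Nat.iter n L0 one)).
{ intros n; apply csmooth_weighted_op_iter; [apply csmooth_weight; assumption|exact H1]. }
assert (Lu : ulim (fun n => Nat.iter n L0 one) hC).
{ intros eps he.
  destruct (pow_small c (eps / (C0 + 1)) c_range) as [N HN]; [apply Rdiv_lt_0_compat; lra|].
  exists N; intros n hn x; specialize (HN n hn).
  assert (E : Cminus (Nat.iter n L0 one x) (hC x) = RtoC (Nat.iter n M0 (fun _ => 1) x - h x)).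
  { apply injective_projections.
    - change (fst (Nat.iter n L0 one x) - h x = Nat.iter n M0 (fun _ => 1) x - h x).
      rewrite L0n_fst; reflexivity.
    - change (snd (Nat.iter n L0 one x) - 0 = 0). rewrite L0n_snd.
      change (Nat.iter n M0 (fun _ => 0) x - 0 = 0).
      replace (Nat.iter n M0 (fun _ => 0) x) with 0; [ring|].
      clear; revert x; induction n as [|n IH]; intros x; [reflexivity|]; simpl.
      unfold ruelle at 1; rewrite (rsum_ext _ (fun _ => 0)).
      + rewrite rsum_const; ring.
      + intros j _; rewrite <- IH; ring. }
  rewrite E, Cmod_R.
  eapply Rle_trans; [apply (h_limit (fun _ => 1) cone_one RInt_one)|].
  apply Rle_trans with (C0 * (eps / (C0 + 1))); [apply Rmult_le_compat_l; assumption|].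
  apply Rle_trans with ((C0 + 1) * (eps / (C0 + 1))); [|right; field; lra].
  apply Rmult_le_compat_r; [left; apply Rdiv_lt_0_compat; lra|lra]. }
refine (proj1 (sobolev_sum_sobolev m hC (2 ^ m * (2 * (B * energy m one))) _ _ _)).
- intros x; unfold hC; rewrite (proj1 h_cone); reflexivity.
- apply ccont_RtoC, h_rcont.
- intros N; apply (ulim_sobolev_sum m (fun n => Nat.iter n L0 one)); [intros; apply csmooth_cont, Hn|exact Lu|].
  intros n; eapply Rle_trans; [apply sobolev_sum_le_sqnorm, Hn|].
  apply Rmult_le_compat_l; [apply pow_le; lra|].
  assert (U0 := sqnorm_le_energy 0 m _ (Hn n) ltac:(lia)). assert (Um := sqnorm_le_energy m m _ (Hn n) (le_n m)).
  change (sqnorm (cDn 0 (Nat.iter n L0 one))) with (sqnorm (Nat.iter n L0 one)) in U0.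
  assert (E := HB one H1 n). lra.
Qed.

Lemma is_lim_seq_const_0 a : is_lim_seq (fun _ => Cmod a) 0 -> a = RtoC 0.
Proof.
intros H; apply is_lim_seq_unique in H; rewrite Lim_seq_const in H.
apply Cmod_eq_0; injection H; auto.
Qed.

(** The iterates of a fixed point are constant, and converge to the multiple of
    the density given by its integral. *)
Lemma L0_fixed m f : (1 <= m)%nat -> sobolev m f -> (forall x, L0 f x = f x) ->
  forall x, f x = Cmult (cint f) (hC x).
Proof.
intros hm H E x.
assert (En : forall n, Nat.iter n L0 f = f).
{ induction n as [|n IH]; [reflexivity|]; simpl; rewrite IH; apply functional_extensionality, E. }
assert (Z := L0n_limit m f x hm H).
assert (D : Cminus (f x) (Cmult (cint f) (RtoC (h x))) = RtoC 0).
{ apply is_lim_seq_const_0; eapply is_lim_seq_ext; [|exact Z]; intros n; simpl; rewrite En; reflexivity. }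
replace (f x) with (Cplus (Cmult (cint f) (RtoC (h x))) (Cminus (f x) (Cmult (cint f) (RtoC (h x))))) by ring.
rewrite D; unfold hC; ring.
Qed.

(** The operator preserves integrals, so an eigenvector for [z <> 1] has integral
    zero and its iterates tend to 0; but their modulus is constant if [|z| = 1]. *)
Lemma L0_peripheral m z : (1 <= m)%nat -> Cmod z = 1 -> eigenvalue m L0 z -> z = RtoC 1.
Proof.
intros hm hz (f & H & [x0 nz] & E).
assert (P := sobolev_periodic m f H). assert (Hc := sobolev_ccont m f H).
assert (I : Cmult (Cminus z (RtoC 1)) (cint f) = RtoC 0).
{ assert (J := cint_L0 f P Hc).
  rewrite (cint_ext _ _ E), cint_scal in J by exact Hc.
  replace (Cmult (Cminus z (RtoC 1)) (cint f)) with (Cminus (Cmult z (cint f)) (cint f)) by ring.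
  rewrite J; ring. }
destruct (Req_dec (Cmod (Cminus z (RtoC 1))) 0) as [h0|h0].
- apply Cmod_eq_0 in h0. replace z with (Cplus (RtoC 1) (Cminus z (RtoC 1))) by ring.
  rewrite h0; ring.
- exfalso; apply nz.
  assert (I0 : cint f = RtoC 0).
  { apply (f_equal Cmod) in I; rewrite Cmod_mult, Cmod_0 in I.
    apply Cmod_eq_0; apply Rmult_integral in I; destruct I as [I|I]; [contradiction|exact I]. }
  assert (En : forall n, Nat.iter n L0 f = fun x => Cmult (Cpow z n) (f x)).
  { induction n as [|n IH]; apply functional_extensionality; intros x; [simpl; ring|].
    simpl; rewrite IH, L_scal, E; ring. }
  apply is_lim_seq_const_0.
  eapply is_lim_seq_ext; [|exact (L0n_limit m f x0 hm H)].
  intros n; simpl; rewrite En, I0.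
  replace (Cminus (Cmult (Cpow z n) (f x0)) (Cmult (RtoC 0) (RtoC (h x0))))
    with (Cmult (Cpow z n) (f x0)) by ring.
  rewrite Cmod_mult, Cmod_pow, hz, pow1; ring.
Qed.

Lemma L0_eigenvalue_1 m : eigenvalue m L0 (RtoC 1).
Proof.
exists hC; split; [apply hC_sobolev|split].
- exists 0; apply hC_neq0.
- intros x; rewrite hC_fixed; ring.
Qed.

Lemma L0_sobolev m f : (1 <= m)%nat -> sobolev m f -> sobolev m (L0 f).
Proof. intros hm; exact (proj1 (L_bounded m 0 hm) f). Qed.

Lemma L0_gen_eigenspace m f : (1 <= m)%nat ->
  gen_eigenspace m L0 (RtoC 1) f <-> exists a : C, forall x, f x = Cmult a (hC x).
Proof.
intros hm; split.
- intros [H [p Hp]]; revert f H Hp; induction p as [|p IH]; intros f H Hp.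
  + exists (RtoC 0); intros x; simpl in Hp; rewrite Hp; ring.
  + assert (Hop : op_minus L0 (RtoC 1) f = fun x => Cplus (L0 f x) (Cmult (RtoC (-1)) (f x))).
    { apply functional_extensionality; intros x; unfold op_minus; ring. }
    assert (Ho : sobolev m (op_minus L0 (RtoC 1) f)).
    { rewrite Hop; apply sobolev_plus; [apply L0_sobolev; assumption|apply sobolev_scal, H]. }
    destruct (IH (op_minus L0 (RtoC 1) f) Ho) as [a Ha].
    { intros x; rewrite <- Nat.iter_succ_r; apply Hp. }
    assert (P := sobolev_periodic m f H). assert (Hc := sobolev_ccont m f H).
    (* The image of [L0 - 1] consists of functions with integral zero, and the
       density has integral one. *)
    assert (a0 : a = RtoC 0).
    { assert (J := cint_ext _ _ Ha).
      rewrite cint_scal, cint_hC, Cmult_1_r in J by (apply (sobolev_ccont m), hC_sobolev).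
      rewrite <- J, Hop, cint_plus.
      - rewrite cint_scal, cint_L0 by assumption; ring.
      - apply (sobolev_ccont m), L0_sobolev; assumption.
      - apply (sobolev_ccont m), sobolev_scal, H. }
    exists (cint f); apply (L0_fixed m); [assumption|assumption|].
    intros x; specialize (Ha x); unfold op_minus in Ha.
    replace (L0 f x) with (Cplus (f x) (Cminus (L0 f x) (Cmult (RtoC 1) (f x)))) by ring.
    rewrite Ha, a0; ring.
- intros [a Ha].
  assert (E : f = fun x => Cmult a (hC x)) by (apply functional_extensionality; exact Ha).
  rewrite E; split; [apply sobolev_scal, hC_sobolev|].
  exists 1%nat; intros x; simpl; unfold op_minus; rewrite L_scal, hC_fixed; ring.
Qed.

Lemma L0_simple m : (1 <= m)%nat -> simple_eigenvalue m L0 (RtoC 1).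
Proof.
intros hm; split; [apply L0_eigenvalue_1|].
exists hC; split; [|split].
- apply L0_gen_eigenspace; [assumption|]. exists (RtoC 1); intros; ring.
- exists 0; apply hC_neq0.
- intros f; apply L0_gen_eigenspace, hm.
Qed.

Lemma L0_lyapunov m f : (1 <= m)%nat ->
  lyapunov_subspace m L0 1 f <-> exists a : C, forall x, f x = Cmult a (hC x).
Proof.
intros hm; split.
- intros [l [Hl Ef]].
  assert (G : exists a, forall x, fold_right (fun q s => Cplus (snd q x) s) (RtoC 0) l = Cmult a (hC x)).
  { clear f Ef; induction l as [|[z psi] l IH].
    - exists (RtoC 0); intros x; simpl; ring.
    - destruct IH as [a Ha]; [intros z' psi' hin; apply Hl; right; exact hin|].
      destruct (Hl z psi (or_introl eq_refl)) as (hz & he & hg).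
      rewrite (L0_peripheral m z hm hz he) in hg.
      apply L0_gen_eigenspace in hg; [|assumption]. destruct hg as [b Hb].
      exists (Cplus b a); intros x; simpl; rewrite Hb, Ha; ring. }
  destruct G as [a Ha]; exists a; intros x; rewrite Ef; apply Ha.
- intros Ha; exists ((RtoC 1, f) :: nil); split.
  + intros z psi [E|[]]; injection E as <- <-; split; [apply Cmod_1|split].
    * apply L0_eigenvalue_1.
    * apply L0_gen_eigenspace; assumption.
  + intros x; simpl; ring.
Qed.

Lemma L0_one_dimensional m : (1 <= m)%nat -> one_dimensional (lyapunov_subspace m L0 1).
Proof.
intros hm; exists hC; split; [|split].
- apply L0_lyapunov; [assumption|]. exists (RtoC 1); intros; ring.
- exists 0; apply hC_neq0.
- intros f; apply L0_lyapunov, hm.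
Qed.

End Final.

Theorem theorem4p4 (k : nat) (g : circle_diffeo) (tau : R -> R)
    (lambda0 lambda kappa Ctau Rk : R) (m : nat)
    (hk : (2 <= k)%nat)
    (tau_smooth : smooth tau)
    (tau_periodic : periodic tau)
    (hlambda0 : is_minimum (Derive (expand k g)) lambda0)
    (lambda0_gt1 : 1 < lambda0)
    (hlambda : lambda = (lambda0 + 1) / 2)
    (hkappa : 1 < kappa < lambda)
    (hCtau : is_maximum (fun x => Rabs (Derive tau x)) (Ctau - 1))
    (hRk : Ctau / (lambda - kappa) <= Rk)
    (hm : (1 <= m)%nat) :
  (forall nu : Z, bounded_operator m (transfer k g tau nu)) /\
  (forall z : C, Cmod z = 1 ->
     (eigenvalue m (transfer k g tau 0) z <-> z = RtoC 1)) /\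
  simple_eigenvalue m (transfer k g tau 0) (RtoC 1) /\
  one_dimensional (lyapunov_subspace m (transfer k g tau 0) 1) /\
  (partially_captive k g tau Rk ->
   forall nu : Z, nu <> 0%Z ->
     Rbar_lt (spectral_radius m (transfer k g tau nu)) 1).
Proof.
assert (Hexp : expanding k g lambda0).
{ constructor; [assumption|assumption|apply hlambda0]. }
destruct (ruelle_perron_frobenius (k := k) (g := g) (lam := lambda0))
  as (A & c & C0 & h & Ap & hc & C0p & Hcone & Hmass & Hinv & Hlim).
split; [|split; [|split; [|split]]].
- intros nu; rewrite transfer_weighted_op; eapply L_bounded; eassumption.
- intros z hz; rewrite transfer_weighted_op; split.
  + eapply L0_peripheral with (m := m); eassumption.
  + intros ->; eapply L0_eigenvalue_1; eassumption.
- rewrite transfer_weighted_op; eapply L0_simple; eassumption.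
- rewrite transfer_weighted_op; eapply L0_one_dimensional; eassumption.
- intros Hc nu hnu; rewrite transfer_weighted_op.
  eapply twisted_spectral_radius with (T := Ctau - 1); try eassumption.
  + apply not_0_IZR, hnu.
  + apply hCtau.
  + assert (C1 : 0 <= Ctau - 1).
    { destruct hCtau as [[x E] _]; rewrite <- E; apply Rabs_pos. }
    eapply Rlt_le_trans; [|exact hRk].
    apply Rlt_le_trans with (Ctau / (lambda0 - 1)).
    * apply Rmult_lt_compat_r; [apply Rinv_0_lt_compat; lra|lra].
    * apply Rmult_le_compat_l; [lra|]. apply Rinv_le_contravar; lra.
Qed.
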